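(* Let $A$ be a finite dimensional algebra over a field and $U\in2\text{-}\mathsf{psilt}\,A$. Then there is a bijection $$C(U)\times L(U)\to D(U),\qquad(\eta,\eta')\mapsto\eta+\eta'$$ whose inverse is given by $\theta\mapsto(\lambda_U(\theta),\lambda'_U(\theta))$.
   Context: Let $K$ be a field and $A$ a finite dimensional $K$-algebra. $\mathsf{mod}\,A$, $\mathsf{proj}\,A$, $\mathsf{inj}\,A$ are the categories of finitely generated (f.g.), f.g. projective, f.g. injective right $A$-modules; $\mathsf K^{\mathrm b}(\mathsf{proj}\,A)$ is the homotopy category of bounded complexes; $\nu\colon\mathsf K^{\mathrm b}(\mathsf{proj}\,A)\to\mathsf K^{\mathrm b}(\mathsf{inj}\,A)$ is the Nakayama functor. $n:=|A|$ is the number of isoclasses of indecomposable projective $A$-modules. $U\in\mathsf K^{\mathrm b}(\mathsf{proj}\,A)$ is presilting if $\mathrm{Hom}(U,U[\ell])=0$ for all $\ell\ge1$, and 2-term if it is isomorphic to a complex concentrated in degrees $-1,0$. $2\text{-}\mathsf{psilt}\,A$ is the set of isoclasses of basic 2-term presilting complexes. We write $U=\bigoplus_{i=1}^mU_i$ with each $U_i$ indecomposable. $K_0(\mathsf{proj}\,A)_{\mathbb R}:=K_0(\mathsf{proj}\,A)\otimes_{\mathbb Z}\mathbb R\cong\mathbb R^n$; complexes in $\mathsf K^{\mathrm b}(\mathsf{proj}\,A)$ have classes in it. Each $\theta\in K_0(\mathsf{proj}\,A)_{\mathbb R}$ is a linear form on $K_0(\mathsf{mod}\,A)_{\mathbb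 R}$ via the Euler bilinear form, determined by $\langle[P],[M]\rangle=\dim_K\mathrm{Hom}_A(P,M)$ for $P\in\mathsf{proj}\,A$, $M\in\mathsf{mod}\,A$; write $\theta(M):=\langle\theta,[M]\rangle$. Define subcategories of $\mathsf{mod}\,A$: $M\in\overline{\mathcal T}_\theta$ (resp. $\mathcal T_\theta$) iff $\theta(X)\ge0$ (resp. $>0$) for all nonzero factor modules $X$ of $M$; $M\in\overline{\mathcal F}_\theta$ (resp. $\mathcal F_\theta$) iff $\theta(Y)\le0$ (resp. $<0$) for all nonzero submodules $Y$ of $M$. $C(U):=\sum_{i=1}^m\mathbb R_{\ge0}[U_i]$; $D(U):=\{\theta\mid H^0(U)\in\overline{\mathcal T}_\theta,\ H^{-1}(\nu U)\in\overline{\mathcal F}_\theta\}$; $D^\circ(U):=\{\theta\mid H^0(U)\in\mathcal T_\theta,\ H^{-1}(\nu U)\in\mathcal F_\theta\}$ (and similarly for any element of $2\text{-}\mathsf{psilt}\,A$, e.g. $U_i$). The link of $C(U)$ is $L(U):=D(U)\setminus\bigcup_{i=1}^mD^\circ(U_i)$. $\lambda_U,\lambda'_U\colon D(U)\to D(U)$ are the unique piecewise linear maps such that every $\theta\in D(U)$ satisfies $\lambda_U(\theta)+\lambda'_U(\theta)=\theta$, $\{\eta\in\mathbb R C(U)\mid\theta-\eta\in D(U)\}=\lambda_U(\theta)+(-C(U))$ and $(\theta+\mathbb R C(U))\cap D(U)=\lambda'_U(\theta)+C(U)$, where $\mathbb R C(U)$ is the linear span of $C(U)$. *)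

(* Defs.v *)
From HB Require Import structures.
From mathcomp Require Import all_boot all_order all_algebra all_field.
From mathcomp Require Import all_classical all_reals.
From mathcomp Require Import freeg zify.

Set Implicit Arguments.
Unset Strict Implicit.
Unset Printing Implicit Defensive.

Import Order.TTheory GRing.Theory Num.Theory.

Local Open Scope classical_set_scope.
Local Open Scope ring_scope.

Lemma linfun_linearE (K : fieldType) (V W : vectType K) (f : V -> W) :
  linear f -> linfun f =1 f.
Proof.
move=> lf; pose g : {linear V -> W} :=
  HB.pack f (GRing.isLinear.Build K V W _ f lf).
exact: (lfunE g).
Qed.

Section Modules.
Variables (K : fieldType) (A : falgType K).

(* Finitely generated right A-modules, that is, finite dimensional ones. The
   operator [ract a] is v |-> v * a, whence the order of factors in ractM. *)
Record rmod := RMod {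
  rcar :> vectType K;
  ract : A -> 'End(rcar);
  ract_is_linear : linear ract;
  ract1 : ract 1 = \1%VF;
  ractM : forall a b, ract (a * b) = (ract b \o ract a)%VF }.

HB.instance Definition _ (M : rmod) :=
  GRing.isLinear.Build K A 'End(M) _ (@ract M) (@ract_is_linear M).

Implicit Types L M N P Q : rmod.

Definition mzero M : Prop := \dim {: M} = 0%N.

Definition homs M N : {vspace 'Hom(M, N)} :=
  (\bigcap_(a <- vbasis {: A})
     lker (linfun (fun f : 'Hom(M, N) =>
                     (f \o ract M a)%VF - (ract N a \o f)%VF)))%VS.

Lemma homsP M N (f : 'Hom(M, N)) :
  reflect (forall a v, f (ract M a v) = ract N a (f v)) (f \in homs M N).
Proof.
have lin a : linear (fun f : 'Hom(M, N) =>
    (f \o ract M a)%VF - (ract N a \o f)%VF).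
  move=> k g h; apply/lfunP=> v.
  rewrite !(add_lfunE, opp_lfunE, scale_lfunE, comp_lfunE) linearP.
  by rewrite scalerBr opprD addrACA.
have memE a : (f \in lker (linfun (fun f : 'Hom(M, N) =>
    (f \o ract M a)%VF - (ract N a \o f)%VF)))
  = ((f \o ract M a)%VF == (ract N a \o f)%VF).
  by rewrite memv_ker (linfun_linearE (lin a)) subr_eq0.
apply: (iffP idP) => [fM a v | fM].
- have fb (i : 'I_(\dim {: A})) w : f (ract M (vbasis {: A})`_i w)
                                  = ract N (vbasis {: A})`_i (f w).
    have bi : (vbasis {: A})`_i \in (vbasis {: A} : seq A).
      by rewrite mem_nth // size_tuple.
    move: fM; rewrite /homs (big_rem _ bi) /= memv_cap => /andP[+ _].
    by rewrite memE => /eqP/lfunP/(_ w); rewrite !lfunE.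
  rewrite (coord_vbasis (memvf a)) !linear_sum /= !sum_lfunE linear_sum /=.
  by apply: eq_bigr => i _; rewrite !linearZ /= !scale_lfunE linearZ /= fb.
- rewrite /homs; elim: (vbasis _ : seq A) => [|a s IH]; first by
    rewrite big_nil memvf.
  rewrite big_cons memv_cap IH andbT memE.
  by apply/eqP/lfunP=> v; rewrite !lfunE /= fM.
Qed.

Definition hdim M N : nat := \dim (homs M N).

Definition projective P : Prop :=
  forall M N (g : 'Hom(M, N)) (f : 'Hom(P, N)),
    g \in homs M N -> limg g = fullv -> f \in homs P N ->
  exists2 h : 'Hom(P, M), h \in homs P M & (g \o h)%VF = f.

Definition short_exact L M N (f : 'Hom(L, M)) (g : 'Hom(M, N)) : Prop :=
  [/\ f \in homs L M, g \in homs M N, lker f = 0%VS, limg f = lker g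
    & limg g = fullv].

Lemma homs_id M : \1%VF \in homs M M.
Proof. by apply/homsP=> a v; rewrite !lfunE. Qed.

Lemma homs_comp L M N (f : 'Hom(L, M)) (g : 'Hom(M, N)) :
  f \in homs L M -> g \in homs M N -> (g \o f)%VF \in homs L N.
Proof.
by move=> /homsP fM /homsP gM; apply/homsP=> a v; rewrite !lfunE /= fM gM.
Qed.

Lemma hdim_short_exact L N P (M : rmod) (f : 'Hom(L, N)) (g : 'Hom(N, P)) :
  projective P -> short_exact f g -> hdim N M = (hdim L M + hdim P M)%N.
Proof.
move=> prP [fh gh /eqP f_inj fgE g_sur].
have [s sh gs] := prP N P g \1%VF gh g_sur (homs_id P).
have gsK x : g (s x) = x by rewrite -comp_lfunE gs id_lfunE.
have gf x : g (f x) = 0.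
  by apply/eqP; rewrite -memv_ker -fgE memv_img ?memvf.
pose r : 'Hom(N, L) := (f^-1 \o (\1 - (s \o g)))%VF.
have fr v : f (r v) = v - s (g v).
  rewrite comp_lfunE limg_lfunVK ?add_lfunE ?opp_lfunE ?id_lfunE ?comp_lfunE //.
  by rewrite fgE memv_ker linearB /= gsK subrr.
have rh : r \in homs N L.
  apply/homsP=> a v; apply/(lker0P f_inj).
  by rewrite fr (homsP _ gh) (homsP _ sh) (homsP _ fh) fr linearB.
have rf x : r (f x) = x.
  by apply/(lker0P f_inj); rewrite fr gf linear0 subr0.
clearbody r.
pose Phi : 'Hom('Hom(N, M), 'Hom(L, M)) := linfun (fun h => (h \o f)%VF).
pose Psi : 'Hom('Hom(P, M), 'Hom(N, M)) := linfun (fun h => (h \o g)%VF).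
have PhiE h : Phi h = (h \o f)%VF.
  by rewrite linfun_linearE // => k ? ?; rewrite comp_lfunDl -comp_lfunZl.
have PsiE h : Psi h = (h \o g)%VF.
  by rewrite linfun_linearE // => k ? ?; rewrite comp_lfunDl -comp_lfunZl.
have PhiK (h : 'Hom(L, M)) : Phi (h \o r)%VF = h.
  by rewrite PhiE; apply/lfunP=> x; rewrite !comp_lfunE rf.
have PsiK (h : 'Hom(N, M)) : (h \o f)%VF = 0 -> Psi (h \o s)%VF = h.
  move=> /lfunP hf; rewrite PsiE; apply/lfunP=> v; rewrite !comp_lfunE.
  have := hf (r v); rewrite comp_lfunE fr zero_lfunE linearB /=.
  by move/eqP; rewrite subr_eq0 => /eqP.
have Phi_Psi (h : 'Hom(P, M)) : Phi (Psi h) = 0.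
  rewrite PhiE PsiE; apply/lfunP=> x.
  by rewrite !comp_lfunE gf linear0 zero_lfunE.
have Psi_inj (h : 'Hom(P, M)) : Psi h = 0 -> h = 0.
  rewrite PsiE => /lfunP h0; apply/lfunP=> x.
  by have := h0 (s x); rewrite comp_lfunE gsK !zero_lfunE.
have imPhi : (Phi @: homs N M)%VS = homs L M.
  apply/eqP; rewrite eqEsubv; apply/andP; split; apply/subvP.
    by move=> _ /memv_imgP[h hM ->]; rewrite PhiE homs_comp.
  by move=> h hM; rewrite -(PhiK h) memv_img // homs_comp.
have kerPhi : (homs N M :&: lker Phi)%VS = (Psi @: homs P M)%VS.
  apply/eqP; rewrite eqEsubv; apply/andP; split; apply/subvP.
    move=> h; rewrite memv_cap memv_ker => /andP[hM /eqP hf].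
    by rewrite -(PsiK h) -?PhiE // memv_img // homs_comp.
  move=> _ /memv_imgP[h hM ->]; rewrite memv_cap memv_ker Phi_Psi eqxx andbT.
  by rewrite PsiE homs_comp.
have injPsi : (homs P M :&: lker Psi = 0)%VS.
  apply/eqP; rewrite -subv0; apply/subvP=> h; rewrite memv_cap memv_ker.
  by move=> /andP[_ /eqP/Psi_inj ->]; rewrite mem0v.
rewrite /hdim -(limg_ker_dim Phi) imPhi kerPhi addnC; congr (_ + _)%N.
exact: limg_dim_eq.
Qed.

(* The subquotient Z / B (in general (Z + B) / B), carried by the complement of
   B in Z provided by [diffv], with the action transported along the projection
   onto it with kernel B. *)
Definition stable M (W : {vspace M}) : Prop :=
  forall a v, v \in W -> ract M a v \in W.

Section Subquotient.
Variables (M : rmod) (Z B : {vspace M}).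
Hypotheses (stZ : stable Z) (stB : stable B).

Let C := (Z :\: B)%VS.
Let p := daddv_pi C B.

Definition subquot_act (a : A) : 'End(subvs_of C) :=
  linfun (fun u => vsproj C (p (ract M a (vsval u)))).

Let CB0 : (C :&: B = 0)%VS. Proof. exact: capv_diff. Qed.

Let subCZ u : u \in C -> u \in Z.
Proof. by apply: subvP; apply: diffvSl. Qed.

Let piC v : p v \in C. Proof. exact: memv_pi. Qed.

Let piB v : v \in B -> p v = 0.
Proof.
move=> Bv; have CBv : v \in (C + B)%VS by rewrite (subvP (addvSr _ _)).
have := daddv_pi_add CB0 CBv; rewrite (daddv_pi_id _ Bv) 1?capvC //.
by rewrite -[RHS]add0r => /addIr.
Qed.

Let piZ v : v \in Z -> v - p v \in B.
Proof.
move=> Zv; have CBv : v \in (C + B)%VS.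
  by rewrite addv_diff (subvP (addvSl _ _)).
by rewrite -{1}(daddv_pi_add CB0 CBv) addrC addKr memv_pi.
Qed.

Let actE a u : vsval (subquot_act a u) = p (ract M a (vsval u)).
Proof.
rewrite linfun_linearE ?vsprojK //.
by move=> k x y; rewrite !linearP.
Qed.

Lemma subquot_act_is_linear : linear subquot_act.
Proof.
move=> k a b; apply/lfunP=> u; apply: val_inj.
by rewrite !(add_lfunE, scale_lfunE) !linearP /= !actE linearP
   !(add_lfunE, scale_lfunE) linearP.
Qed.

Lemma subquot_act1 : subquot_act 1 = \1%VF.
Proof.
apply/lfunP=> u; apply: val_inj; rewrite /= actE ract1 !lfunE /=.
by rewrite /p daddv_pi_id ?subvsP.
Qed.

Lemma subquot_actM a b :
  subquot_act (a * b) = (subquot_act b \o subquot_act a)%VF.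
Proof.
apply/lfunP=> u; apply: val_inj; rewrite comp_lfunE /= !actE ractM comp_lfunE.
apply/eqP; rewrite -subr_eq0 -!linearB /=; apply/eqP/piB.
by apply/stB/piZ/stZ/subCZ/subvsP.
Qed.

Definition subquot : rmod :=
  RMod subquot_act_is_linear subquot_act1 subquot_actM.

End Subquotient.

Lemma stable_ker M N (f : 'Hom(M, N)) : f \in homs M N -> stable (lker f).
Proof.
move=> /homsP fM a v; rewrite !memv_ker fM => /eqP->.
by rewrite linear0.
Qed.

Lemma stable_img M N (f : 'Hom(M, N)) : f \in homs M N -> stable (limg f).
Proof.
by move=> /homsP fM a _ /memv_imgP[v _ ->]; rewrite -fM memv_img ?memvf.
Qed.

(* The Nakayama functor D Hom_A(-, A), where D = Hom_K(-, K). The left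
   A-module structure of Hom_A(M, A) is (a f)(v) = a f(v), and the right
   A-module structure of its dual is (phi a)(f) = phi (a f). *)
Definition regm : rmod :=
  @RMod A (@amulr K A) (@amulr_is_linear K A)
    (rmorph1 (@amulr K A)) (rmorphM (@amulr K A)).

Lemma amull_homs a : amull a \in homs regm regm.
Proof.
by apply/homsP=> b v; rewrite /= /amull /amulr !(@lfunE _ A A) /= mulrA.
Qed.

Local Notation HomA M := (subvs_of (homs M regm)).

Definition lact M (a : A) : 'End(HomA M) :=
  linfun (fun f => vsproj (homs M regm) ((amull a : 'End(regm)) \o vsval f)%VF).

Definition precomp M N (f : 'Hom(M, N)) : 'Hom(HomA N, HomA M) :=
  linfun (fun g => vsproj (homs M regm) (vsval g \o f)%VF).

Lemma lactE M a (f : HomA M) :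
  vsval (lact M a f) = ((amull a : 'End(regm)) \o vsval f)%VF.
Proof.
rewrite /lact linfun_linearE ?vsprojK ?homs_comp ?amull_homs ?subvsP //.
by move=> k g h; rewrite /= comp_lfunDr -comp_lfunZr linearP.
Qed.

Lemma precompE M N (f : 'Hom(M, N)) (g : HomA N) :
  f \in homs M N -> vsval (precomp f g) = (vsval g \o f)%VF.
Proof.
move=> fM; rewrite /precomp linfun_linearE ?vsprojK ?homs_comp ?subvsP //.
by move=> k h h'; rewrite /= comp_lfunDl -comp_lfunZl linearP.
Qed.

Definition nu_act M (a : A) : 'End('Hom(HomA M, K^o)) :=
  linfun (fun phi => (phi \o lact M a)%VF).

Lemma nu_actE M a phi : nu_act M a phi = (phi \o lact M a)%VF.
Proof.
by rewrite linfun_linearE // => k f g; rewrite comp_lfunDl -comp_lfunZl.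
Qed.

Lemma nu_act_is_linear M : linear (nu_act M).
Proof.
move=> k a b; apply/lfunP=> phi; apply/lfunP=> f.
rewrite !(add_lfunE, scale_lfunE, nu_actE, comp_lfunE) -linearP.
congr (phi _); apply: val_inj; rewrite /= !lactE.
by rewrite linearP /= comp_lfunDl -comp_lfunZl.
Qed.

Lemma nu_act1 M : nu_act M 1 = \1%VF.
Proof.
apply/lfunP=> phi; apply/lfunP=> f; rewrite nu_actE comp_lfunE id_lfunE.
by congr (phi _); apply: val_inj; rewrite /= lactE amull1 comp_lfun1l.
Qed.

Lemma nu_actM M a b : nu_act M (a * b) = (nu_act M b \o nu_act M a)%VF.
Proof.
apply/lfunP=> phi; apply/lfunP=> f.
rewrite !(nu_actE, comp_lfunE); congr (phi _); apply: val_inj.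
by rewrite /= !lactE amullM comp_lfunA.
Qed.

Definition nu M : rmod :=
  RMod (@nu_act_is_linear M) (@nu_act1 M) (@nu_actM M).

Definition nuf M N (f : 'Hom(M, N)) : 'Hom(nu M, nu N) :=
  linfun (fun phi : 'Hom(HomA M, K^o) => (phi \o precomp f)%VF).

Lemma nufE M N (f : 'Hom(M, N)) phi :
  nuf f phi = (phi \o precomp f)%VF :> 'Hom(HomA N, K^o).
Proof.
rewrite /nuf linfun_linearE // => k g h.
by rewrite comp_lfunDl -comp_lfunZl.
Qed.

Lemma nuf_homs M N (f : 'Hom(M, N)) :
  f \in homs M N -> nuf f \in homs (nu M) (nu N).
Proof.
move=> fM; apply/homsP=> a phi; rewrite /= !nufE !nu_actE.
rewrite -!comp_lfunA; congr (_ \o _)%VF; apply/lfunP=> g; apply: val_inj.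
by rewrite /= !(lactE, precompE, comp_lfunE) // comp_lfunA.
Qed.

Lemma nuf0 M N : nuf (0 : 'Hom(M, N)) = 0.
Proof.
apply/lfunP=> phi; rewrite nufE lfunE; apply/lfunP=> g.
rewrite lfunE /= [RHS]lfunE /= -[RHS](linear0 phi); congr (phi _).
by apply: val_inj; rewrite /= precompE ?mem0v // comp_lfun0r.
Qed.

Lemma nuf_comp L M N (f : 'Hom(L, M)) (g : 'Hom(M, N)) :
  f \in homs L M -> g \in homs M N -> nuf (g \o f)%VF = (nuf g \o nuf f)%VF.
Proof.
move=> fM gM; apply/lfunP=> phi; rewrite comp_lfunE !nufE -comp_lfunA.
congr (_ \o _)%VF; apply/lfunP=> h; apply: val_inj.
by rewrite /= !(precompE, comp_lfunE) ?homs_comp // comp_lfunA.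
Qed.

End Modules.

Section Complexes.
Variables (K : fieldType) (A : falgType K).

(* Cochain complexes. The differentials form a family indexed by all pairs of
   degrees, zero outside the pairs (i, i + 1): no transport along equalities
   between degrees is then needed below. *)
Record cplx := Cplx {
  ob :> int -> rmod A;
  dif : forall i j, 'Hom(ob i, ob j);
  dif_homs : forall i j, dif i j \in homs (ob i) (ob j);
  dif_shape : forall i j, j != i + 1 -> dif i j = 0;
  dif_dif : forall i j k, (dif j k \o dif i j)%VF = 0 }.

Implicit Types X Y Z : cplx.

Definition gmap X Y := forall i, 'Hom(X i, Y i).

Definition chain_map X Y (f : gmap X Y) : Prop :=
  (forall i, f i \in homs (X i) (Y i)) /\
  (forall i j, (f j \o dif X i j)%VF = (dif Y i j \o f i)%VF).

(* Only the components h i (i - 1) of the homotopy h are used. *)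
Definition null_homotopic X Y (f : gmap X Y) : Prop :=
  exists h : forall i j, 'Hom(X i, Y j),
    (forall i j, h i j \in homs (X i) (Y j)) /\
    (forall i, f i = (dif Y (i - 1) i \o h i (i - 1)%R)%VF
                     + (h (i + 1)%R i \o dif X i (i + 1))%VF).

Definition homotopic X Y (f g : gmap X Y) : Prop :=
  null_homotopic (fun i => f i - g i).

Definition idc X : gmap X X := fun i => \1%VF.

Definition compc X Y Z (g : gmap Y Z) (f : gmap X Y) : gmap X Z :=
  fun i => (g i \o f i)%VF.

Section Shift.
Variables (X : cplx) (l : int).

Let sob i := X (i + l).
Let sdif i j : 'Hom(sob i, sob j) := ((-1 : K) ^ l) *: dif X (i + l) (j + l).

Let sdif_homs i j : sdif i j \in homs (sob i) (sob j).
Proof. by rewrite memvZ ?dif_homs. Qed.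

Let sdif_shape i j : j != i + 1 -> sdif i j = 0.
Proof.
move=> ij; rewrite /sdif dif_shape ?scaler0 //.
by rewrite addrAC (inj_eq (addIr l)).
Qed.

Let sdif_dif i j k : (sdif j k \o sdif i j)%VF = 0.
Proof. by rewrite -comp_lfunZl -comp_lfunZr dif_dif !scaler0. Qed.

Definition shift : cplx := Cplx sdif_homs sdif_shape sdif_dif.

End Shift.

Section Nakayama.
Variable X : cplx.

Let nuX i := nu (X i).
Let nudif i j : 'Hom(nuX i, nuX j) := nuf (dif X i j).

Let nudif_homs i j : nudif i j \in homs (nuX i) (nuX j).
Proof. exact/nuf_homs/dif_homs. Qed.

Let nudif_shape i j : j != i + 1 -> nudif i j = 0.
Proof. by move=> ij; rewrite /nudif dif_shape ?nuf0. Qed.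

Let nudif_dif i j k : (nudif j k \o nudif i j)%VF = 0.
Proof. by rewrite -nuf_comp ?dif_homs // dif_dif nuf0. Qed.

Definition nuc : cplx := Cplx nudif_homs nudif_shape nudif_dif.

End Nakayama.

Lemma boundary_cycle X (i j k : int) :
  (limg (dif X i j) <= lker (dif X j k))%VS.
Proof.
apply/subvP=> _ /memv_imgP[v _ ->].
by rewrite memv_ker -comp_lfunE dif_dif lfunE.
Qed.

Definition cohomology X (i : int) : rmod A :=
  subquot (stable_ker (dif_homs X i (i + 1)))
          (stable_img (dif_homs X (i - 1) i)).

(* Objects of the homotopy category of bounded complexes over proj A; its
   morphisms are the chain maps up to homotopy. *)
Record kbproj := KbProj {
  kc :> cplx;
  kc_proj : forall i, projective (kc i);
  kc_bounded : exists n : nat, forall i : int, (n < `|i|)%N -> mzero (kc i) }.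

Implicit Types U V : kbproj.

Definition kb_iso U V : Prop :=
  exists (f : gmap U V) (g : gmap V U),
    [/\ chain_map f, chain_map g, homotopic (compc g f) (@idc U)
      & homotopic (compc f g) (@idc V)].

Definition kb_zero U : Prop := null_homotopic (@idc U).

(* U is the direct sum (biproduct) of the V i in the homotopy category. *)
Definition kb_dsum (I : finType) U (V : I -> kbproj) : Prop :=
  exists (inj : forall i, gmap (V i) U) (prj : forall i, gmap U (V i)),
    [/\ forall i, chain_map (inj i),
        forall i, chain_map (prj i),
        forall i, homotopic (compc (prj i) (inj i)) (@idc (V i)),
        forall i j, i != j -> null_homotopic (compc (prj j) (inj i))
      & homotopic (fun k => \sum_i compc (inj i) (prj i) k) (@idc U)].

Definition kb_indecomposable U : Prop :=
  ~ kb_zero U /\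
  forall V : bool -> kbproj, kb_dsum U V -> exists b, kb_zero (V b).

Definition presilting U : Prop :=
  forall l : int, 1 <= l ->
  forall f : gmap U (shift U l), chain_map f -> null_homotopic f.

Definition two_term U : Prop :=
  exists2 V, kb_iso U V & forall i, i != -1 -> i != 0 -> mzero (V i).

End Complexes.

(* The coordinate form of a module in the basis [vbasis {: M}]. *)
Section Coordinates.
Variables (K : fieldType) (A : falgType K) (M : rmod A).

Let n := \dim {: M}.
Let e := vbasis {: M}.

Definition crd : 'Hom(M, 'rV[K]_n) := linfun (fun v => \row_i coord e i v).
Definition uncrd : 'Hom('rV[K]_n, M) :=
  linfun (fun x : 'rV[K]_n => \sum_i x 0 i *: e`_i).

Lemma crdE v : crd v = \row_i coord e i v.
Proof.
rewrite linfun_linearE // => k u w; apply/rowP=> i.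
by rewrite !mxE linearP.
Qed.

Lemma uncrdE x : uncrd x = \sum_i x 0 i *: e`_i.
Proof.
rewrite linfun_linearE // => k y z.
rewrite scaler_sumr -big_split /=; apply: eq_bigr => i _.
by rewrite !mxE scalerDl scalerA.
Qed.

Lemma crdK : cancel crd uncrd.
Proof.
move=> v; rewrite crdE uncrdE [RHS](coord_vbasis (memvf v)).
by apply: eq_bigr => i _; rewrite mxE.
Qed.

Lemma uncrdK : cancel uncrd crd.
Proof.
move=> x; rewrite crdE uncrdE; apply/rowP=> i.
by rewrite mxE coord_sum_free ?(basis_free (vbasisP _)).
Qed.

Definition coord_act (a : A) : 'End('rV[K]_n) :=
  (crd \o (ract M a \o uncrd))%VF.

Lemma coord_act_is_linear : linear coord_act.
Proof.
move=> k a b; rewrite /coord_act linearP /=.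
by rewrite comp_lfunDl comp_lfunDr -comp_lfunZl -comp_lfunZr.
Qed.

Lemma coord_act1 : coord_act 1 = \1%VF.
Proof.
by apply/lfunP=> x; rewrite !comp_lfunE ract1 !id_lfunE uncrdK.
Qed.

Lemma coord_actM a b : coord_act (a * b) = (coord_act b \o coord_act a)%VF.
Proof. by apply/lfunP=> x; rewrite ?comp_lfunE ractM ?comp_lfunE crdK. Qed.

Definition coordm : rmod A := RMod coord_act_is_linear coord_act1 coord_actM.

Lemma crd_homs : crd \in homs M coordm.
Proof. by apply/homsP=> a v; rewrite /= !comp_lfunE crdK. Qed.

Lemma uncrd_homs : uncrd \in homs coordm M.
Proof. by apply/homsP=> a v; rewrite /= !comp_lfunE crdK. Qed.

Lemma coordm_projective : projective M -> projective coordm.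
Proof.
move=> prM L N g f gh gs fh.
have [h hh gE] := prM L N g (f \o crd)%VF gh gs (homs_comp crd_homs fh).
exists (h \o uncrd)%VF; first exact: homs_comp uncrd_homs hh.
by rewrite comp_lfunA gE; apply/lfunP=> x; rewrite !comp_lfunE uncrdK.
Qed.

End Coordinates.

Section Grothendieck.
Variables (R : realType) (K : fieldType) (A : falgType K).

(* Every module is isomorphic to one carried by some K ^ d. The latter form a
   small type, so that they can be taken as generators of K_0. *)
Record pmod := PMod {
  pdim : nat;
  pact : A -> 'End('rV[K]_pdim);
  pact_is_linear : linear pact;
  pact1 : pact 1 = \1%VF;
  pactM : forall a b, pact (a * b) = (pact b \o pact a)%VF;
  pact_proj : projective (RMod pact_is_linear pact1 pactM) }.

Coercion pm (P : pmod) : rmod A :=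
  RMod (@pact_is_linear P) (@pact1 P) (@pactM P).

HB.instance Definition _ := gen_eqMixin pmod.
HB.instance Definition _ := gen_choiceMixin pmod.

Definition lin_span (V : lmodType R) (S : set V) : set V :=
  [set v | exists n (a : 'I_n -> R) (x : 'I_n -> V),
     (forall i, S (x i)) /\ v = \sum_i a i *: x i].

(* K_0(proj A) tensored with the reals: the real vector space generated by the
   f.g. projective modules, modulo [Q] = [P] + [P'] for each short exact
   sequence 0 -> P -> Q -> P' -> 0. *)
Definition K0_relators : set {freeg pmod / R} :=
  [set x | exists (P Q P' : pmod) (f : 'Hom(P, Q)) (g : 'Hom(Q, P')),
     short_exact f g /\ x = << Q >> - << P >> - << P' >>].

Definition K0_rel : {pred {freeg pmod / R}} :=
  [pred x | `[< lin_span K0_relators x >]].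

Lemma lin_span0 (V : lmodType R) (S : set V) : lin_span S 0.
Proof.
exists 0, (fun=> 0), (fun=> 0); split; first by case.
by rewrite big_ord0.
Qed.

Lemma lin_spanP (V : lmodType R) (S : set V) a u v :
  lin_span S u -> lin_span S v -> lin_span S (a *: u + v).
Proof.
move=> [m [b [x [Sx ->]]]] [n [c [y [Sy ->]]]].
exists (m + n)%N,
  (fun i => match fintype.split i with inl j => a * b j | inr j => c j end),
  (fun i => match fintype.split i with inl j => x j | inr j => y j end).
split; first by move=> i; case: (fintype.split i).
rewrite big_split_ord scaler_sumr; congr (_ + _); apply: eq_bigr => i _.
  by rewrite (unsplitK (inl i)) scalerA.
by rewrite (unsplitK (inr i)).
Qed.

Lemma K0_rel_zmod : zmod_closed K0_rel.
Proof.
split=> [|x y]; first by apply/asboolP/lin_span0.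
move=> /asboolP Sx /asboolP Sy; apply/asboolP.
by rewrite addrC -scaleN1r; apply: lin_spanP.
Qed.

HB.instance Definition _ :=
  GRing.isZmodClosed.Build {freeg pmod / R} K0_rel K0_rel_zmod.

Definition K0 := Quotient.quot K0_rel.

HB.instance Definition _ := GRing.Zmodule.on K0.

Local Open Scope quotient_scope.

Lemma K0_eqP (x y : {freeg pmod / R}) :
  \pi_K0 x = \pi_K0 y <-> lin_span K0_relators (x - y).
Proof.
have -> : lin_span K0_relators (x - y) <-> x - y \in K0_rel.
  by split=> [?|/asboolP //]; apply/asboolP.
by rewrite Quotient.idealrBE; split=> [->|/eqP].
Qed.

Definition K0_scale (a : R) : K0 -> K0 := lift_op1 K0 ( *:%R a).

Lemma pi_K0_scale a : {morph \pi_K0 : x / a *: x >-> K0_scale a x}.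
Proof.
move=> x; unlock K0_scale; apply/K0_eqP; rewrite -scalerBr -[_ *: _]addr0.
apply: lin_spanP; last exact: lin_span0.
by apply/K0_eqP; rewrite reprK.
Qed.

Lemma pi_K0D (x y : {freeg pmod / R}) :
  \pi_K0 (x + y) = \pi_K0 x + \pi_K0 y :> K0.
Proof. exact: raddfD. Qed.

Lemma K0_surj (q : K0) : exists x, q = \pi_K0 x.
Proof. by exists (repr q); rewrite reprK. Qed.

Lemma K0_scaleA a b x : K0_scale a (K0_scale b x) = K0_scale (a * b) x.
Proof. by have [u ->] := K0_surj x; rewrite -!pi_K0_scale scalerA. Qed.

Lemma K0_scale1 : left_id 1 K0_scale.
Proof. by move=> x; have [u ->] := K0_surj x; rewrite -pi_K0_scale scale1r. Qed.

Lemma K0_scaleDr : right_distributive K0_scale +%R.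
Proof.
move=> a x y; have [u ->] := K0_surj x; have [v ->] := K0_surj y.
by rewrite -pi_K0D -!pi_K0_scale scalerDr pi_K0D.
Qed.

Lemma K0_scaleDl x : {morph K0_scale^~ x : a b / a + b}.
Proof.
move=> a b; have [u ->] := K0_surj x.
by rewrite -!pi_K0_scale scalerDl pi_K0D.
Qed.

HB.instance Definition _ := GRing.Zmodule_isLmodule.Build R K0
  K0_scaleA K0_scale1 K0_scaleDr K0_scaleDl.

Definition K0_class (P : rmod A) (prP : projective P) : K0 :=
  \pi_K0 << PMod (coordm_projective prP) >>.

Lemma K0_class0 (P : rmod A) (prP : projective P) :
  mzero P -> K0_class prP = 0.
Proof.
move=> P0; rewrite /K0_class; set Q := PMod _.
have Q0 (W : {vspace Q}) : W = 0%VS.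
  apply/eqP; rewrite -dimv_eq0 -leqn0 (leq_trans (dimvS (subvf W))) //.
  by rewrite dimvf /dim /= mul1n P0.
have rel : lin_span K0_relators (0 - << Q >>).
  exists 1%N, (fun=> 1), (fun=> << Q >> - << Q >> - << Q >>); split.
    move=> _; exists Q, Q, Q, 0, 0; split=> //.
    by split; rewrite ?mem0v // [LHS]Q0 ?[RHS]Q0.
  by rewrite big_ord1 scale1r subrr.
by move/K0_eqP: rel => <-; exact: raddf0.
Qed.

(* The Euler form: euler M is the linear form on K_0 with value dim Hom(P, M)
   at the class of P. *)
Section Euler.
Variable M : rmod A.

Definition euler_free (x : {freeg pmod / R}) : R :=
  fglift (fun P : pmod => (hdim P M)%:R : R^o) x.

Lemma euler_freeU P : euler_free << P >> = (hdim P M)%:R.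
Proof. by rewrite /euler_free liftU scale1r. Qed.

Let euler_free_zmod : zmod_morphism euler_free.
Proof. exact: (lift_is_additive (M := R^o)). Qed.

HB.instance Definition _ :=
  GRing.isZmodMorphism.Build {freeg pmod / R} R euler_free euler_free_zmod.

Lemma euler_freeZ : scalable_for *%R euler_free.
Proof.
move=> c D; rewrite -[in RHS](freeg_sumE D).
rewrite (_ : c *: D = \sum_(z <- dom D) << c * coeff z D *g z >>) //.
rewrite !raddf_sum mulr_sumr; apply: eq_bigr => z _.
by rewrite /= /euler_free !liftU [RHS]mulrA.
Qed.

Lemma euler_free_rel x : lin_span K0_relators x -> euler_free x = 0.
Proof.
move=> [n [a [y [Sy ->]]]]; rewrite raddf_sum big1 // => i _.
rewrite /= euler_freeZ; case: (Sy i) => [P [Q [P' [f [g [fgP ->]]]]]].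
rewrite !raddfB /= !euler_freeU (hdim_short_exact M (@pact_proj P') fgP).
by rewrite natrD addrAC addrK subrr mulr0.
Qed.

Definition euler : K0 -> R := lift_fun1 K0 euler_free.

Lemma pi_euler x : euler (\pi_K0 x) = euler_free x.
Proof.
unlock euler; apply/eqP; rewrite -subr_eq0 -raddfB /=; apply/eqP.
by apply/euler_free_rel/K0_eqP; rewrite reprK.
Qed.

Lemma euler_is_scalar : scalar euler.
Proof.
move=> k x y; have [u ->] := K0_surj x; have [v ->] := K0_surj y.
by rewrite -[_ *: _]pi_K0_scale -pi_K0D !pi_euler raddfD /= euler_freeZ.
Qed.

HB.instance Definition _ :=
  GRing.isLinear.Build R K0 R *%R euler euler_is_scalar.

Lemma euler_class (P : rmod A) (prP : projective P) :
  euler (K0_class prP) = (hdim P M)%:R.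
Proof.
rewrite pi_euler euler_freeU; congr _%:R; rewrite /hdim.
pose Phi : 'Hom('Hom(P, M), 'Hom(coordm P, M)) :=
  linfun (fun h => (h \o uncrd P)%VF).
have PhiE h : Phi h = (h \o uncrd P)%VF.
  by rewrite linfun_linearE // => k ? ?; rewrite comp_lfunDl -comp_lfunZl.
have PhiK (h : 'Hom(coordm P, M)) : Phi (h \o crd P)%VF = h.
  by rewrite PhiE; apply/lfunP=> x; rewrite !comp_lfunE uncrdK.
have Phi_inj h : Phi h = 0 -> h = 0.
  rewrite PhiE => /lfunP h0; apply/lfunP=> v.
  by have := h0 (crd P v); rewrite comp_lfunE crdK !zero_lfunE.
rewrite -(limg_dim_eq (f := Phi) (U := homs P M)).
  congr (\dim _); apply/eqP; rewrite eqEsubv; apply/andP; split; apply/subvP.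
    by move=> h hM; rewrite -(PhiK h) memv_img // homs_comp // crd_homs.
  move=> _ /memv_imgP[h hM ->]; rewrite PhiE homs_comp //.
  exact: uncrd_homs.
apply/eqP; rewrite -subv0; apply/subvP=> h; rewrite memv_cap memv_ker.
by move=> /andP[_ /eqP/Phi_inj ->]; rewrite mem0v.
Qed.

End Euler.

End Grothendieck.

Section WallChamber.
Variables (R : realType) (K : fieldType) (A : falgType K).

Implicit Types (theta eta : K0 R A) (M X Y : rmod A) (U : kbproj A).

Definition kb_class U : K0 R A :=
  \sum_(i \in [set: int]) ((-1 : R) ^ i) *: K0_class R (@kc_proj K A U i).

Lemma kb_class_finite U :
  finite_set [set i | K0_class R (@kc_proj K A U i) != 0].
Proof.
have [n n_ub] := kc_bounded U.
apply: (@sub_finite_set _ _ ((fun k : nat => k%:Z - n%:Z) @` `I_(n + n).+1)).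
  move=> i /= /eqP iN0; have : (absz i <= n)%N.
    by rewrite leqNgt; apply/negP=> /n_ub/K0_class0-/(_ R) /(_ _)/iN0.
  by move=> i_le; exists (absz (i + n%:Z)); rewrite /=; lia.
exact/finite_image/finite_II.
Qed.

Definition Tbar theta M : Prop :=
  forall X (g : 'Hom(M, X)), g \in homs M X -> limg g = fullv -> ~ mzero X ->
  0 <= euler X theta.

Definition Topen theta M : Prop :=
  forall X (g : 'Hom(M, X)), g \in homs M X -> limg g = fullv -> ~ mzero X ->
  0 < euler X theta.

Definition Fbar theta M : Prop :=
  forall Y (f : 'Hom(Y, M)), f \in homs Y M -> lker f = 0%VS -> ~ mzero Y ->
  euler Y theta <= 0.

Definition Fopen theta M : Prop :=
  forall Y (f : 'Hom(Y, M)), f \in homs Y M -> lker f = 0%VS -> ~ mzero Y ->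
  euler Y theta < 0.

Definition coneD U : set (K0 R A) :=
  [set theta | Tbar theta (cohomology U 0)
               /\ Fbar theta (cohomology (nuc U) (-1))].

Definition coneDo U : set (K0 R A) :=
  [set theta | Topen theta (cohomology U 0)
               /\ Fopen theta (cohomology (nuc U) (-1))].

(* Us is the family of indecomposable direct summands of U. *)
Definition coneC m (Us : 'I_m -> kbproj A) : set (K0 R A) :=
  [set eta | exists2 a : 'I_m -> R,
     forall i, 0 <= a i & eta = \sum_i a i *: kb_class (Us i)].

Definition link U m (Us : 'I_m -> kbproj A) : set (K0 R A) :=
  coneD U `\` \bigcup_i coneDo (Us i).

Definition polyhedral_cone (V : lmodType R) (P : set V) : Prop :=
  exists n (l : 'I_n -> {scalar V}), P = [set v | forall i, 0 <= l i v].

Definition piecewise_linear (V : lmodType R) (D : set V) (f : V -> V) : Prop :=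
  exists n (P : 'I_n -> set V) (g : 'I_n -> {linear V -> V}),
    [/\ forall i, polyhedral_cone (P i),
        D `<=` \bigcup_i P i
      & forall i v, D v -> P i v -> f v = g i v].

(* The conditions characterizing (lambda_U, lambda'_U); only the values on D(U)
   are relevant. *)
Definition lambda_maps U m (Us : 'I_m -> kbproj A)
    (lam lam' : K0 R A -> K0 R A) : Prop :=
  [/\ {homo lam : theta / coneD U theta} /\ {homo lam' : theta / coneD U theta},
      piecewise_linear (coneD U) lam /\ piecewise_linear (coneD U) lam'
    & forall theta, coneD U theta ->
      [/\ lam theta + lam' theta = theta,
          [set eta | lin_span (coneC Us) eta /\ coneD U (theta - eta)]
            = [set lam theta - eta | eta in coneC Us]
        & [set theta + eta | eta in lin_span (coneC Us)] `&` coneD U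
            = [set lam' theta + eta | eta in coneC Us]]].

End WallChamber.

(* Main.v *)
Require Import Defs.
From HB Require Import structures.
From mathcomp Require Import all_boot all_order all_algebra all_field.
From mathcomp Require Import all_classical all_reals.
From mathcomp Require Import freeg zify ring lra.

(** Let c_i be the class of U_i, H_i = H^0(U_i) and N_i = H^-1(nu U_i).

    Convexity. The cone D(U) consists of the theta that are nonnegative on all
    quotients X of the H_i and nonpositive on all submodules Y of the N_i. Only
    finitely many classes occur (euler_quotients_finite), so D(U) is polyhedral.
    Because U is presilting, Hom(H_i, N_j) = 0, and then c_i(X) = dim Hom(H_i, X)
    and -c_i(Y) = dim Hom(Y, N_i): each c_i lies in D(U). Let depth_i(theta) be
    the largest t with theta - t c_i in D(U), a minimum of ratios of linear
    forms. It is positive if and only if theta lies in D^o(U_i). The theorem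
    follows from the fact that theta minus the sum of the a_i c_i lies in D(U) if
    and only if a_i <= depth_i(theta) for all i (halfspaces_slice): lambda_U(theta)
    is then the sum of the depth_i(theta) c_i, the second map is the remainder,
    and the link is the set where all depths vanish (link_decomposition).

    No slanted walls. The fact just used says that the directions c_i do not
    interact: adding nonnegative multiples of the c_j with j distinct from i to
    theta does not move it from the complement of D^o(U_i) into D^o(U_i)
    (wall_step). Suppose it did. Then every nonzero quotient of H_i with theta = 0
    receives a nonzero map from some other H_j, and every nonzero submodule of N_i
    with theta = 0 has a nonzero map to some other N_j. Take such a quotient X of
    maximal dimension, say. Approximating X by the other H_j, one finds that the
    projection from H_i to X is unchanged by an endomorphism of H_i that factors
    through the other H_j (H_Topen). The presilting condition enters through
    liftings, which are obtained by counting dimensions with the formula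
    c_i(X) = dim Hom(H_i, X) - dim Hom(X, N_i). That endomorphism lifts to one of
    U_i that factors through the other U_j. As U_i is indecomposable and
    isomorphic to none of them, it is nilpotent (sum_through_nilpotent), whence
    X = 0.

    Homotopy. Each U_i is a retract of a complex of projectives in the degrees -1
    and 0. A retract of this kind of minimal dimension is isomorphic to U_i
    (model_iso), and its endomorphisms are nilpotent or invertible as plain maps
    of complexes (model_dichotomy), so that homotopies can be forgotten. The
    formula for c_i(X) follows from the duality between Hom(P, X) and
    Hom(X, nu P) (hdim_nu_kernel) and from the homotopy invariance of Euler
    characteristics (euler_kb_iso). *)

Set Implicit Arguments.
Unset Strict Implicit.
Unset Printing Implicit Defensive.

Import Order.TTheory GRing.Theory Num.Theory.

Local Open Scope classical_set_scope.
Local Open Scope ring_scope.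

(** * Modules, short exact sequences and direct sums *)

Section ModuleBasics.
Variables (K : fieldType) (A : falgType K).
Implicit Types L M N P Q S X Y : rmod A.

Lemma homsE M N (f : 'Hom(M, N)) a v :
  f \in homs M N -> f (ract M a v) = ract N a (f v).
Proof. by move/homsP. Qed.

Lemma daddv_pi_eq0 (V : vectType K) (C B : {vspace V}) v :
  (C :&: B)%VS = 0%VS -> v \in B -> daddv_pi C B v = 0.
Proof.
move=> CB0 Bv; have CBv : v \in (C + B)%VS by rewrite (subvP (addvSr _ _)).
have := daddv_pi_add CB0 CBv; rewrite (@daddv_pi_id _ _ B) 1?capvC //.
by rewrite -[RHS]add0r => /addIr.
Qed.

Section SubquotientMaps.
Variables (M : rmod A) (Z B : {vspace M}) (stZ : stable Z) (stB : stable B).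
Let C := (Z :\: B)%VS.
Let SQ := subquot stZ stB.

(** The projection is defined on all of M, but it is compatible with the action
    and has kernel B only on Z. *)
Definition subquot_proj : 'Hom(M, SQ) :=
  linfun (fun v : M => vsproj C (daddv_pi C B v) : SQ).

Definition subquot_lift : 'Hom(SQ, M) := linfun (fun u : SQ => vsval u).

Lemma subquot_projE v : vsval (subquot_proj v) = daddv_pi C B v.
Proof.
rewrite /subquot_proj linfun_linearE ?vsprojK ?memv_pi //.
by move=> k x y; rewrite !linearP.
Qed.

Lemma subquot_liftE u : subquot_lift u = vsval u.
Proof. by rewrite /subquot_lift linfun_linearE. Qed.

Lemma subquot_lift_mem u : subquot_lift u \in Z.
Proof. by rewrite subquot_liftE; apply: (subvP (diffvSl Z B)); apply: subvsP. Qed.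

Lemma subquot_liftK : cancel subquot_lift subquot_proj.
Proof.
move=> u; apply: val_inj; rewrite /= subquot_projE subquot_liftE.
by rewrite daddv_pi_id ?capv_diff ?subvsP.
Qed.

Lemma subquot_proj_diff v : v \in Z -> v - subquot_lift (subquot_proj v) \in B.
Proof.
move=> Zv; rewrite subquot_liftE subquot_projE.
have CBv : v \in (C + B)%VS by rewrite addv_diff (subvP (addvSl _ _)).
by rewrite -{1}(daddv_pi_add (capv_diff Z B) CBv) addrC addKr memv_pi.
Qed.

Lemma subquot_proj_eq0 v : v \in Z -> (subquot_proj v == 0) = (v \in B).
Proof.
move=> Zv; apply/eqP/idP => [q0|Bv].
  by have := subquot_proj_diff Zv; rewrite q0 linear0 subr0.
apply: val_inj; rewrite /= subquot_projE.
exact: daddv_pi_eq0 (capv_diff Z B) Bv.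
Qed.

Lemma subquot_proj_act a v :
  v \in Z -> subquot_proj (ract M a v) = ract SQ a (subquot_proj v).
Proof.
move=> Zv; have -> : ract SQ a (subquot_proj v)
    = subquot_proj (ract M a (subquot_lift (subquot_proj v))).
  apply: val_inj; rewrite /= subquot_projE linfun_linearE ?vsprojK ?memv_pi //.
    by rewrite subquot_liftE.
  by move=> k x y; rewrite !linearP.
apply/eqP; rewrite -subr_eq0 -!linearB /= subquot_proj_eq0.
  exact/stB/subquot_proj_diff.
by rewrite stZ // memvB // subquot_lift_mem.
Qed.

Lemma subquot_lift_act a u :
  B = 0%VS -> subquot_lift (ract SQ a u) = ract M a (subquot_lift u).
Proof.
move=> B0; rewrite -[u in LHS]subquot_liftK -subquot_proj_act ?subquot_lift_mem //.
have Zv : ract M a (subquot_lift u) \in Z by rewrite stZ ?subquot_lift_mem.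
have := subquot_proj_diff Zv.
have B0' w : w \in B -> w = 0 by rewrite B0 memv0 => /eqP.
by move/B0'/eqP; rewrite subr_eq0 => /eqP <-.
Qed.

End SubquotientMaps.

Lemma stable0 M : stable (0%VS : {vspace M}).
Proof. by move=> a v; rewrite !memv0 => /eqP->; rewrite linear0. Qed.

Lemma stablef M : stable (fullv : {vspace M}).
Proof. by move=> a v _; rewrite memvf. Qed.

Lemma lker_eq0 (V W : vectType K) (f : 'Hom(V, W)) :
  (forall v, f v = 0 -> v = 0) -> lker f = 0%VS.
Proof.
move=> f0; apply/eqP; rewrite -subv0; apply/subvP=> v.
by rewrite memv_ker memv0 => /eqP/f0->.
Qed.

Lemma limg_full (V W : vectType K) (f : 'Hom(V, W)) (g : W -> V) :
  cancel g f -> limg f = fullv.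
Proof.
move=> gK; apply/eqP; rewrite eqEsubv subvf; apply/subvP=> w _.
by rewrite -(gK w) memv_img ?memvf.
Qed.

Lemma limg_fullP (V W : vectType K) (f : 'Hom(V, W)) w :
  limg f = fullv -> exists v, f v = w.
Proof.
by move=> fs; have := memvf w; rewrite -fs => /memv_imgP[v _ ->]; exists v.
Qed.

Lemma lker0_inj (V W : vectType K) (f : 'Hom(V, W)) :
  lker f = 0%VS -> injective f.
Proof. by move/eqP/lker0P. Qed.

Lemma submodule M (W : {vspace M}) : stable W ->
  exists (S : rmod A) (i : 'Hom(S, M)),
    [/\ i \in homs S M, lker i = 0%VS & limg i = W].
Proof.
move=> stW; exists (subquot stW (@stable0 M)), (subquot_lift stW (@stable0 M)).
split.
- by apply/homsP=> a v; rewrite subquot_lift_act.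
- by apply: lker_eq0 => v /(congr1 (subquot_proj stW (@stable0 M))); rewrite subquot_liftK
  linear0.
- apply/vspaceP=> v; apply/memv_imgP/idP => [[u _ ->]|Wv].
    exact: subquot_lift_mem.
  exists (subquot_proj stW (@stable0 M) v); rewrite ?memvf //.
  have := subquot_proj_diff stW (@stable0 M) Wv.
  by rewrite memv0 subr_eq0 => /eqP.
Qed.

Lemma quotient M (W : {vspace M}) : stable W ->
  exists (Q : rmod A) (p : 'Hom(M, Q)),
    [/\ p \in homs M Q, limg p = fullv & lker p = W].
Proof.
move=> stW; exists (subquot (@stablef M) stW), (subquot_proj (@stablef M) stW).
split.
- by apply/homsP=> a v; rewrite subquot_proj_act ?memvf.
- exact: limg_full (@subquot_liftK _ _ _ _ _).
- by apply/vspaceP=> v; rewrite memv_ker subquot_proj_eq0 ?memvf.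
Qed.

(** Every map of modules is an epimorphism onto its image followed by a
    monomorphism; most arguments below use images through this factorization. *)
Lemma image_factor M N (f : 'Hom(M, N)) : f \in homs M N ->
  exists (I : rmod A) (p : 'Hom(M, I)) (i : 'Hom(I, N)),
    [/\ p \in homs M I, i \in homs I N, limg p = fullv, lker i = 0%VS
      & (i \o p)%VF = f].
Proof.
move=> fh; have [I [i [ih i0 iI]]] := submodule (stable_img fh).
have iK := lker0_lfunK (introT eqP i0).
have iVK v : i ((i^-1)%VF (f v)) = f v.
  by rewrite limg_lfunVK // iI memv_img ?memvf.
exists I, (i^-1 \o f)%VF, i; split=> //.
- apply/homsP=> a v; apply: (lker0_inj i0).
  by rewrite !comp_lfunE iVK (homsE _ _ ih) iVK (homsE _ _ fh).
- apply/eqP; rewrite eqEsubv subvf; apply/subvP=> w _.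
  have : i w \in limg f by rewrite -iI memv_img ?memvf.
  by case/memv_imgP=> v _ iw; rewrite -(iK w) iw -comp_lfunE memv_img ?memvf.
- by apply/lfunP=> v; rewrite !comp_lfunE iVK.
Qed.

Lemma factor_mono L M N (i : 'Hom(M, N)) (f : 'Hom(L, N)) :
  i \in homs M N -> lker i = 0%VS -> f \in homs L N -> (limg f <= limg i)%VS ->
  exists2 g : 'Hom(L, M), g \in homs L M & (i \o g)%VF = f.
Proof.
move=> ih i0 fh fi.
have iVK v : i ((i^-1)%VF (f v)) = f v.
  by rewrite limg_lfunVK // (subvP fi) // memv_img ?memvf.
exists (i^-1 \o f)%VF; last by apply/lfunP=> v; rewrite !comp_lfunE iVK.
apply/homsP=> a v; apply: (lker0_inj i0).
by rewrite !comp_lfunE iVK (homsE _ _ ih) iVK (homsE _ _ fh).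
Qed.

Lemma factor_epi L M N (p : 'Hom(L, M)) (f : 'Hom(L, N)) :
  p \in homs L M -> limg p = fullv -> f \in homs L N -> (lker p <= lker f)%VS ->
  exists2 g : 'Hom(M, N), g \in homs M N & (g \o p)%VF = f.
Proof.
move=> ph ps fh pf.
have pVK v : p ((p^-1)%VF v) = v by rewrite limg_lfunVK // ps memvf.
have fE v w : p v = p w -> f v = f w.
  move=> e; apply/eqP; rewrite -subr_eq0 -linearB -memv_ker (subvP pf) //.
  by rewrite memv_ker linearB /= e subrr.
exists (f \o p^-1)%VF; last first.
  by apply/lfunP=> v; rewrite !comp_lfunE; apply: fE; rewrite pVK.
apply/homsP=> a v; rewrite !comp_lfunE -(homsE _ _ fh); apply: fE.
by rewrite pVK (homsE _ _ ph) pVK.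
Qed.

(** A form of the lifting property in which the target need not be all of N:
    factor g through its image first. *)
Lemma proj_lift P M N (g : 'Hom(M, N)) (f : 'Hom(P, N)) :
  projective P -> g \in homs M N -> f \in homs P N -> (limg f <= limg g)%VS ->
  exists2 h : 'Hom(P, M), h \in homs P M & (g \o h)%VF = f.
Proof.
move=> prP gh fh fg; have [I [p [i [ph ih ps i0 gE]]]] := image_factor gh.
have [f' f'h f'E] : exists2 f' : 'Hom(P, I), f' \in homs P I & (i \o f')%VF = f.
  apply: factor_mono => //; apply: subv_trans fg _.
  by rewrite -gE limg_comp limgS ?subvf.
have [h hh hE] := prP _ _ p f' ph ps f'h.
by exists h => //; rewrite -gE -comp_lfunA hE.
Qed.

Lemma proj_summand P Q (i : 'Hom(Q, P)) (p : 'Hom(P, Q)) :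
  projective P -> i \in homs Q P -> p \in homs P Q -> (p \o i)%VF = \1%VF ->
  projective Q.
Proof.
move=> prP ih ph pi M N g f gh gs fh.
have [h hh hE] := prP M N g (f \o p)%VF gh gs (homs_comp ph fh).
exists (h \o i)%VF; first exact: homs_comp ih hh.
by rewrite comp_lfunA hE -comp_lfunA pi comp_lfun1r.
Qed.

Lemma mzeroP M : mzero M <-> (forall v : M, v = 0).
Proof.
rewrite /mzero; split=> [/eqP|M0].
  rewrite dimv_eq0 => /eqP M0 v; apply/eqP.
  by rewrite -memv0 -M0 memvf.
apply/eqP; rewrite dimv_eq0 -subv0; apply/subvP=> v _.
by rewrite (M0 v) mem0v.
Qed.

Lemma homs0 M N : (0 : 'Hom(M, N)) \in homs M N.
Proof. exact: mem0v. Qed.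

Lemma hdim_gt0P M N :
  reflect (exists2 f : 'Hom(M, N), f \in homs M N & f <> 0) (0 < hdim M N)%N.
Proof.
rewrite /hdim lt0n dimv_eq0; apply: (iffP idP) => [h0|[f fh f0]].
  exists (vpick (homs M N)); first exact: memv_pick.
  by apply/eqP; rewrite vpick0.
by apply/eqP=> h0; move: fh; rewrite h0 memv0 => /eqP.
Qed.

Lemma hdim_eq0P M N :
  hdim M N = 0%N <-> (forall f : 'Hom(M, N), f \in homs M N -> f = 0).
Proof.
split=> [h0 f fh|h0].
  apply: contrapT => fN0.
  by have /hdim_gt0P : exists2 f, f \in homs M N & f <> 0; [exists f | rewrite h0].
apply/eqP; rewrite -leqn0 leqNgt; apply/negP=> /hdim_gt0P[f fh fN0].
exact/fN0/h0.
Qed.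

Lemma dim_image_inj (V W : vectType K) (f : 'Hom(V, W)) (U : {vspace V}) :
  (forall v, v \in U -> f v = 0 -> v = 0) -> \dim (f @: U) = \dim U.
Proof.
move=> f0; apply: limg_dim_eq; apply/eqP; rewrite -subv0; apply/subvP=> v.
by rewrite memv_cap memv_ker memv0 => /andP[Uv /eqP/(f0 v Uv)->].
Qed.

Section CompLinear.
Variables (U V W : vectType K).
Definition precompl (f : 'Hom(U, V)) : 'Hom('Hom(V, W), 'Hom(U, W)) :=
  linfun (fun h => (h \o f)%VF).
Definition postcompl (g : 'Hom(V, W)) : 'Hom('Hom(U, V), 'Hom(U, W)) :=
  linfun (fun h => (g \o h)%VF).
Lemma precomplE f h : precompl f h = (h \o f)%VF.
Proof. by rewrite linfun_linearE // => k ? ?; rewrite comp_lfunDl -comp_lfunZl. Qed.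
Lemma postcomplE g h : postcompl g h = (g \o h)%VF.
Proof. by rewrite linfun_linearE // => k ? ?; rewrite comp_lfunDr -comp_lfunZr. Qed.
End CompLinear.

Lemma comp_mono_eq0 (U V W : vectType K) (i : 'Hom(V, W)) (f : 'Hom(U, V)) :
  lker i = 0%VS -> (i \o f)%VF = 0 -> f = 0.
Proof.
move=> i0 /lfunP h; apply/lfunP=> v; apply: (lker0_inj i0).
by rewrite -comp_lfunE h !lfunE linear0.
Qed.

Lemma comp_epi_eq0 (U V W : vectType K) (p : 'Hom(U, V)) (f : 'Hom(V, W)) :
  limg p = fullv -> (f \o p)%VF = 0 -> f = 0.
Proof.
move=> ps /lfunP h; apply/lfunP=> v; have [u <-] := limg_fullP v ps.
by rewrite -comp_lfunE h !lfunE.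
Qed.

(** Rank-nullity for composition with g: the kernel of this map on Hom(X, M)
    is Hom(X, L), and its image may be smaller than Hom(X, N). *)
Lemma hdim_left_exact L M N X (f : 'Hom(L, M)) (g : 'Hom(M, N)) :
  short_exact f g ->
  hdim X M = (hdim X L + \dim (postcompl X g @: homs X M))%N.
Proof.
move=> [fh gh f0 fg gs].
rewrite /hdim -(limg_ker_dim (postcompl X g) (homs X M)); congr (_ + _)%N.
rewrite -(@dim_image_inj _ _ (postcompl X f) (homs X L)); last first.
  by move=> h _; rewrite postcomplE => /(comp_mono_eq0 f0).
congr (\dim _); apply/vspaceP=> h; rewrite memv_cap memv_ker postcomplE.
apply/andP/memv_imgP => [[hh /eqP gh0]|[k kh ->]].
  have [|k kh kE] := factor_mono fh f0 hh; last by exists k; rewrite ?postcomplE.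
  rewrite fg; apply/subvP=> _ /memv_imgP[v _ ->].
  by rewrite memv_ker -comp_lfunE gh0 lfunE.
rewrite postcomplE (homs_comp kh fh); split=> //; apply/eqP/lfunP=> v.
rewrite !comp_lfunE lfunE /=; apply/eqP; rewrite -memv_ker -fg.
by rewrite memv_img ?memvf.
Qed.

(** Rank-nullity for composition with f: the kernel of this map on Hom(M, X)
    is Hom(N, X), and its image may be smaller than Hom(L, X). *)
Lemma hdim_right_exact L M N X (f : 'Hom(L, M)) (g : 'Hom(M, N)) :
  short_exact f g ->
  hdim M X = (hdim N X + \dim (precompl X f @: homs M X))%N.
Proof.
move=> [fh gh f0 fg gs].
rewrite /hdim -(limg_ker_dim (precompl X f) (homs M X)); congr (_ + _)%N.
rewrite -(@dim_image_inj _ _ (precompl X g) (homs N X)); last first.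
  by move=> h _; rewrite precomplE => /(comp_epi_eq0 gs).
congr (\dim _); apply/vspaceP=> h; rewrite memv_cap memv_ker precomplE.
apply/andP/memv_imgP => [[hh /eqP hf0]|[k kh ->]].
  have [|k kh kE] := factor_epi gh gs hh; last by exists k; rewrite ?precomplE.
  rewrite -fg; apply/subvP=> _ /memv_imgP[v _ ->].
  by rewrite memv_ker -comp_lfunE hf0 lfunE.
rewrite precomplE (homs_comp gh kh); split=> //; apply/eqP/lfunP=> v.
rewrite !comp_lfunE lfunE /=; have: f v \in lker g by rewrite -fg memv_img ?memvf.
by rewrite memv_ker => /eqP->; rewrite linear0.
Qed.

Lemma hdim_proj_exact L M N P (f : 'Hom(L, M)) (g : 'Hom(M, N)) :
  projective P -> short_exact f g -> hdim P M = (hdim P L + hdim P N)%N.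
Proof.
move=> prP se; rewrite (hdim_left_exact P se); congr (_ + \dim _)%N.
case: se => _ gh _ _ gs; apply/vspaceP=> h.
apply/memv_imgP/idP => [[k kh ->]|hh]; first by rewrite postcomplE (homs_comp kh gh).
by have [k kh <-] := prP _ _ g h gh gs hh; exists k; rewrite ?postcomplE.
Qed.

Lemma mono_epi_exact M N (f : 'Hom(M, N)) : f \in homs M N -> limg f = fullv ->
  exists (L : rmod A) (i : 'Hom(L, M)), short_exact i f.
Proof.
move=> fh fs; have [L [i [ih i0 iI]]] := submodule (stable_ker fh).
by exists L, i.
Qed.

Lemma epi_mono_exact L M (f : 'Hom(L, M)) : f \in homs L M -> lker f = 0%VS ->
  exists (N : rmod A) (p : 'Hom(M, N)), short_exact f p.
Proof.
move=> fh f0; have [N [p [ph ps pK]]] := quotient (stable_img fh).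
by exists N, p.
Qed.

Section Prod.
Variables M N : rmod A.
Let pact a : 'End((M * N)%type) :=
  linfun (fun v : M * N => (ract M a v.1, ract N a v.2)).
Let pactE a v : pact a v = (ract M a v.1, ract N a v.2).
Proof.
rewrite /pact linfun_linearE // => k [x1 x2] [y1 y2] /=.
by rewrite !linearP.
Qed.
Fact prod_act_linear : linear pact.
Proof.
move=> k a b; apply/lfunP=> -[x y]; rewrite add_lfunE scale_lfunE !pactE /=.
by rewrite !linearP !(add_lfunE, scale_lfunE).
Qed.
Fact prod_act1 : pact 1 = \1%VF.
Proof. by apply/lfunP=> -[x y]; rewrite pactE !ract1 !lfunE. Qed.
Fact prod_actM a b : pact (a * b) = (pact b \o pact a)%VF.
Proof. by apply/lfunP=> -[x y]; rewrite comp_lfunE !pactE !ractM /= !comp_lfunE. Qed.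
Definition prod_rmod := RMod prod_act_linear prod_act1 prod_actM.
Lemma prod_ractE a v : ract prod_rmod a v = (ract M a v.1, ract N a v.2).
Proof. exact: pactE. Qed.
End Prod.

Fact zero_act_linear : linear (fun _ : A => \1%VF : 'End('rV[K]_0)).
Proof. by move=> k a b; apply/lfunP=> v; rewrite !thinmx0. Qed.
Definition zero_rmod : rmod A :=
  RMod zero_act_linear (erefl _) (fun _ _ => esym (comp_lfun1l _)).

Lemma zero_rmod_mzero : mzero zero_rmod.
Proof. by apply/mzeroP=> v; apply: thinmx0. Qed.

(** The two universal properties are part of the statement: they give maps out
    of and into the sum without any computation of the composites of
    inclusions and projections. The proof adds one summand at a time. *)
Lemma direct_sum n (M : 'I_n -> rmod A) :
  exists (S : rmod A) (i : forall k, 'Hom(M k, S)) (p : forall k, 'Hom(S, M k)),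
    [/\ forall k, i k \in homs (M k) S, forall k, p k \in homs S (M k),
        forall v, v = \sum_k i k (p k v),
        forall X (f : forall k, 'Hom(M k, X)), (forall k, f k \in homs (M k) X) ->
          exists2 s : 'Hom(S, X), s \in homs S X & forall k, (s \o i k)%VF = f k
      & forall X (f : forall k, 'Hom(X, M k)), (forall k, f k \in homs X (M k)) ->
          exists2 s : 'Hom(X, S), s \in homs X S & forall k, (p k \o s)%VF = f k].
Proof.
elim: n M => [|n IH] M.
  exists zero_rmod, (fun=> 0), (fun=> 0).
  split=> [k|k|v|X f _|X f _]; rewrite ?homs0 //; first by rewrite thinmx0 big_ord0.
    by exists 0; [exact: homs0 | case].
  by exists 0; [exact: homs0 | case].
have [S [i [p [ih ph sE sI sP]]]] := IH (fun k => M (fintype.lift ord0 k)).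
pose inl : 'Hom(M ord0, prod_rmod (M ord0) S) :=
  linfun (fun v => (v, 0) : prod_rmod (M ord0) S).
pose inr : 'Hom(S, prod_rmod (M ord0) S) :=
  linfun (fun v => (0, v) : prod_rmod (M ord0) S).
pose pl : 'Hom(prod_rmod (M ord0) S, M ord0) :=
  linfun (fun v : prod_rmod (M ord0) S => v.1).
pose pr : 'Hom(prod_rmod (M ord0) S, S) :=
  linfun (fun v : prod_rmod (M ord0) S => v.2).
have inlE v : inl v = (v, 0).
  by rewrite linfun_linearE // => k x y; congr pair; rewrite /= scaler0 addr0.
have inrE v : inr v = (0, v).
  by rewrite linfun_linearE // => k x y; congr pair; rewrite /= scaler0 addr0.
have plE v : pl v = v.1 by rewrite linfun_linearE.
have prE v : pr v = v.2 by rewrite linfun_linearE.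
have inlh : inl \in homs _ _.
  by apply/homsP=> a v; rewrite !inlE prod_ractE /= linear0.
have inrh : inr \in homs _ _.
  by apply/homsP=> a v; rewrite !inrE prod_ractE /= linear0.
have plh : pl \in homs _ _ by apply/homsP=> a v; rewrite !plE prod_ractE.
have prh : pr \in homs _ _ by apply/homsP=> a v; rewrite !prE prod_ractE.
pose ii k : 'Hom(M k, prod_rmod (M ord0) S) :=
  match unliftP ord0 k with
  | UnliftSome j e => ecast k 'Hom(M k, prod_rmod (M ord0) S) (esym e) (inr \o i j)%VF
  | UnliftNone e => ecast k 'Hom(M k, prod_rmod (M ord0) S) (esym e) inl
  end.
pose pp k : 'Hom(prod_rmod (M ord0) S, M k) :=
  match unliftP ord0 k with
  | UnliftSome j e => ecast k 'Hom(prod_rmod (M ord0) S, M k) (esym e) (p j \o pr)%VF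
  | UnliftNone e => ecast k 'Hom(prod_rmod (M ord0) S, M k) (esym e) pl
  end.
have ii0 : ii ord0 = inl.
  rewrite /ii; case: (unliftP ord0 ord0) => [j e|e]; last by rewrite (eq_axiomK e).
  by exfalso; have := neq_lift ord0 j; rewrite -e eqxx.
have pp0 : pp ord0 = pl.
  rewrite /pp; case: (unliftP ord0 ord0) => [j e|e]; last by rewrite (eq_axiomK e).
  by exfalso; have := neq_lift ord0 j; rewrite -e eqxx.
have iiS j : ii (fintype.lift ord0 j) = (inr \o i j)%VF.
  rewrite /ii; case: (unliftP ord0 (fintype.lift ord0 j)) => [j' e|e].
    by have := lift_inj e => ej; subst j'; rewrite (eq_axiomK e).
  by exfalso; have := neq_lift ord0 j; rewrite e eqxx.
have ppS j : pp (fintype.lift ord0 j) = (p j \o pr)%VF.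
  rewrite /pp; case: (unliftP ord0 (fintype.lift ord0 j)) => [j' e|e].
    by have := lift_inj e => ej; subst j'; rewrite (eq_axiomK e).
  by exfalso; have := neq_lift ord0 j; rewrite e eqxx.
exists (prod_rmod (M ord0) S), ii, pp; split.
- move=> k; case: (unliftP ord0 k) => [j|] ->; first by rewrite iiS homs_comp.
  by rewrite ii0.
- move=> k; case: (unliftP ord0 k) => [j|] ->; first by rewrite ppS homs_comp.
  by rewrite pp0.
- move=> v; rewrite big_ord_recl ii0 pp0.
  under eq_bigr do rewrite iiS ppS !comp_lfunE.
  rewrite -linear_sum /= prE -sE inlE inrE plE; case: v => x y /=.
  by congr pair; rewrite /= ?addr0 ?add0r.
- move=> X f fh.
  have [s sh sE'] := sI X (fun j => f (fintype.lift ord0 j)) (fun j => fh _).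
  exists ((f ord0 \o pl) + (s \o pr))%VF.
    by apply: memvD; apply: homs_comp.
  move=> k; apply/lfunP=> v; rewrite comp_lfunE add_lfunE !comp_lfunE.
  case: (unliftP ord0 k) v => [j|] -> v.
    by rewrite iiS comp_lfunE inrE plE prE linear0 add0r -comp_lfunE sE'.
  by rewrite ii0 inlE plE prE linear0 addr0.
- move=> X f fh.
  have [s sh sE'] := sP X (fun j => f (fintype.lift ord0 j)) (fun j => fh _).
  exists ((inl \o f ord0) + (inr \o s))%VF.
    by apply: memvD; apply: homs_comp.
  move=> k; apply/lfunP=> v; rewrite comp_lfunE add_lfunE !comp_lfunE.
  case: (unliftP ord0 k) => [j|] ->.
    by rewrite ppS comp_lfunE linearD /= inlE inrE !prE add0r -comp_lfunE sE'.
  by rewrite pp0 inlE inrE plE /= addr0.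
Qed.

End ModuleBasics.

(** * Polyhedral cones with independent directions *)

(** The conditions characterizing the pair (lambda_U, lambda'_U), for a cone D
    with a subcone C in the place of D(U) and C(U). *)
Definition link_maps (R : realType) (V : lmodType R) (C D : set V) (f g : V -> V) : Prop :=
  [/\ {homo f : v / D v} /\ {homo g : v / D v},
      piecewise_linear D f /\ piecewise_linear D g
    & forall v, D v ->
      [/\ f v + g v = v,
          [set u | lin_span C u /\ D (v - u)] = [set f v - u | u in C]
        & [set v + u | u in lin_span C] `&` D = [set g v + u | u in C]]].

Definition link_decomposes (R : realType) (V : lmodType R) (C D L : set V) : Prop :=
  exists f g : V -> V,
    [/\ link_maps C D f g,
        forall f' g', link_maps C D f' g' -> forall v, D v -> f' v = f v /\ g' v = g v,
        set_bij (C `*` L) D (fun p : V * V => p.1 + p.2),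
        forall v, D v -> [/\ C (f v), L (g v) & f v + g v = v]
      & forall u v, C u -> L v -> f (u + v) = u /\ g (u + v) = v].

Section ConeDecomposition.
Variables (R : realType) (V : lmodType R) (r m : nat).
Variables (l : 'I_r -> {scalar V}) (c : 'I_m -> V).

Definition halfspaces : set V := [set v | forall q, 0 <= l q v].

Hypothesis lc_ge0 : forall q i, 0 <= l q (c i).
Hypothesis lc_gt0 : forall i, exists q, 0 < l q (c i).
(** No wall of the cone is slanted: adding nonnegative multiples of the c j with
    j distinct from i does not turn a v that lies on a wall transversal to c i
    into one that lies on none. *)
Hypothesis wall_stable : forall i v (b : 'I_m -> R),
  halfspaces v -> (forall j, 0 <= b j) -> b i = 0 ->
  (forall q, 0 < l q (c i) -> 0 < l q (v + \sum_j b j *: c j)) ->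
  forall q, 0 < l q (c i) -> 0 < l q v.

Let D := halfspaces.
Let q0 i : 'I_r := xchoose (lc_gt0 i).
Let q0P i : 0 < l (q0 i) (c i). Proof. exact: xchooseP (lc_gt0 i). Qed.

Let ratio i v q : R := l q v / l q (c i).
Definition tight i v : 'I_r :=
  [arg min_(q < q0 i | 0 < l q (c i)) ratio i v q]%O.

(** The largest t such that v - t c i lies in D. The walls parallel to c i, with
    l q (c i) = 0, do not bound t, so t is the minimum of finitely many ratios;
    tight i v is a wall reached first. *)
Definition depth i v : R := ratio i v (tight i v).

Lemma tight_gt0 i v : 0 < l (tight i v) (c i).
Proof. by rewrite /tight; case: arg_minP => [|q]; first exact: q0P. Qed.

Lemma depthE i v : l (tight i v) v = depth i v * l (tight i v) (c i).
Proof. by rewrite /depth /ratio divfK // gt_eqF // tight_gt0. Qed.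

Lemma depth_le i v q : 0 < l q (c i) -> depth i v * l q (c i) <= l q v.
Proof.
move=> qi; rewrite -ler_pdivlMr // /depth /tight.
by case: arg_minP => [|q' _ ->]; first exact: q0P.
Qed.

Lemma depth_geP i v t :
  reflect (forall q, 0 < l q (c i) -> t * l q (c i) <= l q v) (t <= depth i v).
Proof.
apply: (iffP idP) => [t_le q qi | t_le].
  by apply: le_trans (depth_le v qi); rewrite ler_pM2r.
by rewrite -(ler_pM2r (tight_gt0 i v)) -depthE t_le ?tight_gt0.
Qed.

Lemma halfspacesB i v t : D v -> t <= depth i v -> D (v - t *: c i).
Proof.
move=> Dv /depth_geP t_le q; rewrite linearB linearZ /= subr_ge0.
have := lc_ge0 q i; rewrite le_eqVlt => /predU1P[<-|/t_le //].
by rewrite mulr0; apply: Dv.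
Qed.

Lemma depth_ge0 i v : D v -> 0 <= depth i v.
Proof. by move=> Dv; apply/depth_geP=> q _; rewrite mul0r; apply: Dv. Qed.

Lemma depth_gt0 i v : 0 < depth i v <-> (forall q, 0 < l q (c i) -> 0 < l q v).
Proof.
split=> [d_gt0 q qi | l_gt0].
  by apply: lt_le_trans (depth_le v qi); apply: mulr_gt0.
by rewrite /depth /ratio divr_gt0 ?tight_gt0 ?l_gt0 ?tight_gt0.
Qed.

Lemma halfspacesD v (b : 'I_m -> R) :
  D v -> (forall j, 0 <= b j) -> D (v + \sum_j b j *: c j).
Proof.
move=> Dv b0 q; rewrite linearD linear_sum addr_ge0 ?Dv // sumr_ge0 // => j _.
by rewrite linearZ /= mulr_ge0.
Qed.

(** The heart of the convex part. Push v to the boundary of D along c i. If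
    the depth of v grew after adding the c j, the pushed point would leave every
    wall transversal to c i, against the hypothesis on walls; but it lies on the
    tight one. *)
Lemma depth_invariant i v (b : 'I_m -> R) :
  D v -> (forall j, 0 <= b j) -> b i = 0 ->
  depth i (v + \sum_j b j *: c j) <= depth i v.
Proof.
move=> Dv b0 bi; rewrite leNgt; apply/negP=> lt_d.
have /(_ (tight i v) (tight_gt0 i v)) : forall q, 0 < l q (c i) ->
    0 < l q (v - depth i v *: c i).
  (* The depth after the addition exceeds depth i v, so after subtracting
     depth i v times c i all transversal walls are still strict. *)
  apply: (wall_stable (halfspacesB Dv (lexx _)) b0 bi) => q qi.
  rewrite addrAC linearB linearZ /= subr_gt0.
  apply: lt_le_trans (depth_le _ qi).
  by rewrite ltr_pM2r.
by rewrite linearB linearZ /= depthE subrr ltxx.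
Qed.

Definition orthant_part v : V := \sum_i depth i v *: c i.

(** All the depths can be used up simultaneously: after subtracting depth j v
    times c j for j < k, the depth along c k is still at least depth k v, by
    depth_invariant. *)
Lemma halfspaces_sub_orthant_part v : D v -> D (v - orthant_part v).
Proof.
move=> Dv; suff /(_ m) : forall k, D (v - \sum_(i < m | (i < k)%N) depth i v *: c i).
  by under eq_bigl do rewrite ltn_ord.
elim=> [|k IH]; first by rewrite big_pred0 ?subr0 // => i; rewrite ltn0.
have [k_lt | k_ge] := ltnP k m; last first.
  rewrite (eq_bigl (fun i : 'I_m => (i < k)%N)) // => i.
  have ik : (i < k)%N := leq_trans (ltn_ord i) k_ge.
  by rewrite ik ltnS ltnW.
rewrite (bigD1 (Ordinal k_lt)) //= (eq_bigl (fun i : 'I_m => (i < k)%N)); last first.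
  move=> i; rewrite ltnS -val_eqE /= andbC.
  by rewrite ltn_neqAle.
rewrite opprD addrCA addrC; apply: halfspacesB => //.
set w := v - _; pose b (j : 'I_m) := if (j < k)%N then depth j v else 0.
have -> : v = w + \sum_j b j *: c j.
  rewrite /w [in RHS]big_mkcond /= -[LHS](subrK (\sum_j b j *: c j)).
  congr (_ - _ + _); apply: eq_bigr => j _; rewrite /b.
  by case: ifP; rewrite ?scale0r.
apply: depth_invariant => // [j|]; last by rewrite /b /= ltnn.
by rewrite /b; case: ifP => // _; apply: depth_ge0.
Qed.

(** The slice of D through v parallel to the c i is a translate of the negative
    orthant. For the direct implication, move the coordinates other than the
    i-th one up to nonnegative values, which stays in D, and compare depths. *)
Lemma halfspaces_slice v (a : 'I_m -> R) : D v ->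
  D (v - \sum_j a j *: c j) <-> (forall i, a i <= depth i v).
Proof.
move=> Dv; split=> [Dva i | a_le]; last first.
  have -> : v - \sum_j a j *: c j
      = (v - orthant_part v) + \sum_j (depth j v - a j) *: c j.
    under [in RHS]eq_bigr do rewrite scalerBl.
    by rewrite sumrB addrA subrK.
  apply: halfspacesD; first exact: halfspaces_sub_orthant_part.
  by move=> j; rewrite subr_ge0.
(* b moves the other coordinates of -a up to nonnegative values, and e is the
   required increment. *)
pose b j := if j == i then 0 else Num.max 0 (- a j).
have b0 j : 0 <= b j by rewrite /b; case: ifP => // _; rewrite le_max lexx.
apply: le_trans (depth_invariant Dv b0 _); last by rewrite /b eqxx.
apply/depth_geP=> q qi.
pose e j := if j == i then 0 else b j + a j.
have e0 j : 0 <= e j.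
  by rewrite /e /b; case: (j == i); rewrite ?lexx //; rewrite -lerBlDr sub0r le_max lexx orbT.
have := halfspacesD Dva e0 q.
have -> : v - \sum_j a j *: c j + \sum_j e j *: c j
    = v + \sum_j b j *: c j - a i *: c i.
  rewrite -!addrA; congr (_ + _).
  rewrite -sumrN -big_split /= [LHS](bigD1 i) //= [in RHS](bigD1 i) //=.
  rewrite /e /b !eqxx !scale0r addr0 add0r addrC; congr (_ + _).
  by apply: eq_bigr => j /negPf ->; rewrite scalerDl addrCA addNr addr0.
by rewrite linearB linearZ /= subr_ge0.
Qed.

Let choice_ok (s : {ffun 'I_m -> 'I_r}) := [forall i, 0 < l (s i) (c i)].

(** The region where s selects, for each i, a wall reached first along c i; the
    depths are linear there. Pairs (i, q) whose ratio is meaningless impose no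
    condition. *)
Let piece (s : {ffun 'I_m -> 'I_r}) : set V :=
  [set v | forall i q, 0 < l q (c i) -> 0 < l (s i) (c i) ->
     0 <= l q v / l q (c i) - l (s i) v / l (s i) (c i)].

Lemma scalarMl (f : {scalar V}) (k : R) : scalar (fun v => f v * k).
Proof. by move=> a x y; rewrite linearP mulrDl mulrA. Qed.

Let form i q : {scalar V} :=
  HB.pack (fun v => l q v * (l q (c i))^-1)
    (GRing.isLinear.Build R V R _ _ (@scalarMl (l q) (l q (c i))^-1)).

Let part_fun (s : {ffun 'I_m -> 'I_r}) (v : V) : V := \sum_i form i (s i) v *: c i.
Let part_lin s : linear (part_fun s).
Proof.
move=> a x y; rewrite /part_fun scaler_sumr -big_split; apply: eq_bigr => i _.
by rewrite linearP scalerDl scalerA.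
Qed.
Let part (s : {ffun 'I_m -> 'I_r}) : {linear V -> V} :=
  HB.pack (part_fun s) (GRing.isLinear.Build R V V _ _ (part_lin s)).

Let rest_lin s : linear (fun v => v - part_fun s v).
Proof.
move=> a x y; rewrite part_lin scalerBr opprD !addrA; congr (_ - _).
by rewrite addrAC.
Qed.
Let rest (s : {ffun 'I_m -> 'I_r}) : {linear V -> V} :=
  HB.pack (fun v => v - part_fun s v) (GRing.isLinear.Build R V V _ _ (rest_lin s)).

Let diff_scalar (f g : {scalar V}) : scalar (fun v => f v - g v).
Proof. by move=> a x y; rewrite !linearP mulrBr opprD addrACA. Qed.
Let diff (f g : {scalar V}) : {scalar V} :=
  HB.pack (fun v => f v - g v) (GRing.isLinear.Build R V R _ _ (diff_scalar f g)).
Let zero_scalar : scalar (fun _ : V => 0 : R).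
Proof. by move=> a x y; rewrite mulr0 addr0. Qed.
Let zeroF : {scalar V} :=
  HB.pack (fun _ : V => 0 : R) (GRing.isLinear.Build R V R _ _ zero_scalar).

Let I2 : finType := ('I_m * 'I_r)%type.

Lemma piece_polyhedral s : polyhedral_cone (piece s).
Proof.
pose L (k : 'I_#|I2|) := let p := enum_val k in
  if (0 < l p.2 (c p.1)) && (0 < l (s p.1) (c p.1))
  then diff (form p.1 p.2) (form p.1 (s p.1)) else zeroF.
exists #|I2|, L; apply/seteqP; split=> v /=.
  by move=> Pv k; rewrite /L; case: ifP => //= /andP[]; apply: Pv.
move=> Pv i q qi si; have := Pv (enum_rank (i, q)).
by rewrite /L enum_rankK /= qi si.
Qed.

Lemma piece_depth s v : choice_ok s -> piece s v ->
  forall i, depth i v = form i (s i) v.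
Proof.
move=> /forallP s_ok Pv i; apply/eqP; rewrite eq_le; apply/andP; split.
  by rewrite /= ler_pdivlMr ?s_ok //; apply: depth_le; apply: s_ok.
have := Pv i (tight i v) (tight_gt0 i v) (s_ok i); rewrite subr_ge0.
by rewrite [X in _ <= X -> _]/(ratio i v _).
Qed.

Let n_choice := #|{: {s : {ffun 'I_m -> 'I_r} | choice_ok s}}|.
Let nth_choice (k : 'I_n_choice) : {ffun 'I_m -> 'I_r} := val (enum_val k).

Lemma orthant_part_piecewise_linear : piecewise_linear D orthant_part
  /\ piecewise_linear D (fun v => v - orthant_part v).
Proof.
have covered : D `<=` \bigcup_k piece (nth_choice k).
  move=> v _; pose s := [ffun i => tight i v].
  have s_ok : choice_ok s by apply/forallP=> i; rewrite ffunE tight_gt0.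
  exists (enum_rank (exist _ s s_ok)) => //.
  rewrite /nth_choice enum_rankK /= => i q qi _; rewrite ffunE subr_ge0.
  by rewrite ler_pdivlMr //; apply: depth_le.
have orthant_partE k v : piece (nth_choice k) v ->
    orthant_part v = part_fun (nth_choice k) v.
  move=> Pv; apply: eq_bigr => i _.
  by rewrite (piece_depth _ Pv) // /nth_choice (valP (enum_val k)).
split.
- exists n_choice, (fun k => piece (nth_choice k)), (fun k => part (nth_choice k)).
  split=> // [k|k v _ Pv]; first exact: piece_polyhedral.
  by rewrite (orthant_partE k).
- exists n_choice, (fun k => piece (nth_choice k)), (fun k => rest (nth_choice k)).
  split=> // [k|k v _ Pv]; first exact: piece_polyhedral.
  by rewrite (orthant_partE k).
Qed.

Definition orthant : set V :=
  [set v | exists2 a : 'I_m -> R, forall i, 0 <= a i & v = \sum_i a i *: c i].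

(** Evaluate at a wall with l q (c i) > 0: the i-th coefficients are
    nonnegative and sum to zero. *)
Lemma orthant_pointed u v : orthant u -> orthant v -> u + v = 0 -> u = 0.
Proof.
move=> [a a0 ->] [b b0 ->] uv0; rewrite big1 // => i _.
have [q qi] := lc_gt0 i.
have : l q (\sum_i a i *: c i + \sum_i b i *: c i) = 0 by rewrite uv0 linear0.
rewrite -big_split linear_sum /= => /eqP; rewrite psumr_eq0; last first.
  by move=> j _; rewrite -scalerDl linearZ /= mulr_ge0 // addr_ge0.
move=> /allP/(_ i); rewrite mem_index_enum => /(_ isT).
rewrite -scalerDl linearZ /= mulf_eq0 (gt_eqF qi) orbF.
by rewrite paddr_eq0 // => /andP[/eqP-> _]; rewrite scale0r.
Qed.

Lemma orthant_span : lin_span orthant = [set v | exists a : 'I_m -> R, v = \sum_i a i *: c i].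
Proof.
apply/seteqP; split=> v.
  move=> [n [a [x [Ox ->]]]].
  have [b bE] : exists b : 'I_n -> 'I_m -> R, forall k, x k = \sum_i b k i *: c i.
    have [b bE] := choice (fun k => let: ex_intro2 b _ e := Ox k in ex_intro
      (fun b : 'I_m -> R => x k = \sum_i b i *: c i) b e).
    by exists b.
  exists (fun i => \sum_k a k * b k i).
  under eq_bigr do rewrite bE scaler_sumr.
  rewrite exchange_big /=; apply: eq_bigr => i _; rewrite scaler_suml.
  by apply: eq_bigr => k _; rewrite scalerA.
move=> [a ->]; exists m, a, c; split=> // i.
exists (fun j => (j == i)%:R) => [j|]; first by rewrite ler0n.
rewrite (bigD1 i) //= eqxx scale1r big1 ?addr0 // => j /negPf ->.
by rewrite scale0r.
Qed.

Lemma orthant_part_orthant v : D v -> orthant (orthant_part v).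
Proof. by move=> Dv; exists (fun i => depth i v) => // i; apply: depth_ge0. Qed.

Lemma orthant_halfspaces v : orthant v -> D v.
Proof.
move=> [a a0 ->] q; rewrite linear_sum sumr_ge0 // => i _.
by rewrite linearZ /= mulr_ge0.
Qed.

(** The depths are the coordinates of the corner of the slice through v, and the
    slice does not change when v moves along it. *)
Lemma depthD v (a : 'I_m -> R) i : D v -> (forall j, 0 <= a j) ->
  depth i (v + \sum_j a j *: c j) = depth i v + a i.
Proof.
move=> Dv a0; set w := v + _; have Dw : D w by apply: halfspacesD.
have key (b : 'I_m -> R) : (forall j, b j <= depth j w)
    <-> (forall j, b j - a j <= depth j v).
  rewrite -(halfspaces_slice b Dw) -(halfspaces_slice (fun j => b j - a j) Dv).
  rewrite (_ : v - _ = w - \sum_j b j *: c j) // /w.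
  under eq_bigr do rewrite scalerBl.
  by rewrite sumrB opprB addrA.
apply/eqP; rewrite eq_le -lerBlDr; apply/andP; split.
  by have /(_ (fun=> lexx _) i) := (key (depth^~ w)).1.
suff /(_ i) : forall j, depth j v + a j <= depth j w by [].
by apply/(key (fun j => depth j v + a j)) => j; rewrite addrK.
Qed.

Variables (Do : 'I_m -> set V).
Hypothesis DoP : forall i v, D v ->
  Do i v <-> (forall q, 0 < l q (c i) -> 0 < l q v).

Let L := D `\` \bigcup_i Do i.

(** Points of the link are those whose depths all vanish, because the interior
    condition Do i says exactly that the depth along c i is positive. *)
Lemma linkP v : L v <-> D v /\ forall i, depth i v = 0.
Proof.
split=> [[Dv nDo] | [Dv d0]]; split=> //.
  move=> i; apply/eqP; rewrite eq_le depth_ge0 // andbT leNgt; apply/negP.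
  by move/depth_gt0/(DoP i Dv) => Doi; apply: nDo; exists i.
by move=> [i _ /(DoP i Dv)/depth_gt0]; rewrite d0 ltxx.
Qed.

Lemma rest_link v : D v -> L (v - orthant_part v).
Proof.
move=> Dv; have Dr := halfspaces_sub_orthant_part Dv; apply/linkP; split=> // i.
have d0 j : 0 <= depth j v by apply: depth_ge0.
have := depthD i Dr d0; rewrite subrK => e.
by apply: (addIr (depth i v)); rewrite add0r -e.
Qed.

Lemma orthant_part_sum u v : orthant u -> L v -> orthant_part (u + v) = u.
Proof.
move=> [a a0 ->] /linkP[Dv d0]; apply: eq_bigr => i _.
by rewrite addrC depthD // d0 add0r.
Qed.

Theorem link_decomposition : link_decomposes orthant D L.
Proof.
exists orthant_part, (fun v => v - orthant_part v).
have coefB (a b : 'I_m -> R) :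
    \sum_i (a i - b i) *: c i = \sum_i a i *: c i - \sum_i b i *: c i.
  by rewrite -sumrB; apply: eq_bigr => i _; rewrite scalerBl.
have slice v : D v -> [set u | lin_span orthant u /\ D (v - u)]
    = [set orthant_part v - u | u in orthant].
  move=> Dv; rewrite orthant_span; apply/seteqP; split=> u /=.
    move=> [[a ->] /(halfspaces_slice a Dv) a_le].
    exists (\sum_i (depth i v - a i) *: c i).
      by exists (fun i => depth i v - a i) => // i; rewrite subr_ge0.
    by rewrite coefB subKr.
  move=> [_ [a a0 ->] <-].
  rewrite -coefB.
  split; first by exists (fun i => depth i v - a i).
  by apply/(halfspaces_slice _ Dv) => i; rewrite gerBl.
have sumE u v : orthant u -> L v ->
    orthant_part (u + v) = u /\ u + v - orthant_part (u + v) = v.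
  by move=> Ou Lv; rewrite orthant_part_sum // addrC addKr.
have decE v : D v -> [/\ orthant (orthant_part v), L (v - orthant_part v)
    & orthant_part v + (v - orthant_part v) = v].
  by move=> Dv; split; [exact: orthant_part_orthant | exact: rest_link | rewrite addrC subrK].
split=> //.
- split=> [||v Dv].
  + split=> v Dv; first exact/orthant_halfspaces/orthant_part_orthant.
    exact: halfspaces_sub_orthant_part.
  + exact: orthant_part_piecewise_linear.
  + split; [by rewrite addrC subrK | exact: slice | ].
    apply/seteqP; split=> w /=.
      rewrite orthant_span => -[[_ [a ->] <-] Dva].
      have Dva' : D (v - \sum_i (- a i) *: c i).
        by under eq_bigr do rewrite scaleNr; rewrite sumrN opprK.
      have /(halfspaces_slice (fun i => - a i) Dv) a_le := Dva'.
      exists (\sum_i (depth i v + a i) *: c i).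
        exists (fun i => depth i v + a i) => // i.
        by rewrite -[a i]opprK subr_ge0.
      rewrite (_ : \sum_i _ = orthant_part v + \sum_i a i *: c i) ?addrA ?subrK //.
      by rewrite -big_split; apply: eq_bigr => i _; rewrite scalerDl.
    move=> [_ [a a0 ->] <-]; split.
      rewrite orthant_span; exists (\sum_i (a i - depth i v) *: c i).
        by exists (fun i => a i - depth i v).
      by rewrite coefB addrCA addrC.
    by apply: halfspacesD => //; apply: halfspaces_sub_orthant_part.
- move=> f' g' [_ _ fg'] v Dv; have [fgE sliceE _] := fg' v Dv.
  have fE : f' v = orthant_part v.
    rewrite slice // in sliceE.
    have O0 : orthant 0 by exists (fun=> 0) => //; rewrite big1 // => i _; rewrite scale0r.
    have [u Ou uE] : [set orthant_part v - u | u in orthant] (f' v).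
      by rewrite sliceE; exists 0; rewrite ?subr0.
    have [w Ow wE] : [set f' v - u | u in orthant] (orthant_part v).
      by rewrite -sliceE; exists 0; rewrite ?subr0.
    have uw0 : u + w = 0.
      by move: uE; rewrite -wE -addrA -opprD => /eqP; rewrite -subr_eq0 addrAC subrr add0r
        oppr_eq0 addrC => /eqP.
    by rewrite -uE (orthant_pointed Ou Ow uw0) subr0.
  split=> //; rewrite -fE; apply: (addrI (f' v)).
  by rewrite fgE addrC subrK.
- split.
  + move=> [u v] /= [Ou /linkP[Dv _]].
    by rewrite addrC; case: Ou => a a0 ->; apply: halfspacesD.
  + move=> [u v] [u' v'] /set_mem[/= Ou Lv] /set_mem[/= Ou' Lv'] /= e.
    have [eu ev] := sumE _ _ Ou Lv; have [eu' ev'] := sumE _ _ Ou' Lv'.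
    by congr pair; [rewrite -eu -eu' e | rewrite -ev -ev' e].
  + move=> v Dv; exists (orthant_part v, v - orthant_part v) => /=.
      by case: (decE v Dv).
    by case: (decE v Dv).
Qed.

End ConeDecomposition.

(** * Euler forms and short exact sequences *)

Section EulerExact.
Variables (R : realType) (K : fieldType) (A : falgType K).
Implicit Types (L M N X Y Z I Q S T : rmod A) (theta : K0 R A).

(** On the class of a projective this is exactness of Hom(P, -), and these
    classes generate K_0. *)
Lemma euler_exact L M N (f : 'Hom(L, M)) (g : 'Hom(M, N)) theta :
  short_exact f g -> euler M theta = euler L theta + euler N theta.
Proof.
move=> fg; have [x ->] := K0_surj theta; rewrite !pi_euler.
rewrite -(freeg_sumE x) !raddf_sum -big_split; apply: eq_bigr => P _ /=.
rewrite /euler_free !liftU -[RHS]mulrDr; congr (_ * _).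
by rewrite (hdim_proj_exact (@pact_proj K A P) fg) natrD.
Qed.

Lemma dim_exact L M N (f : 'Hom(L, M)) (g : 'Hom(M, N)) :
  short_exact f g -> \dim {: M} = (\dim {: L} + \dim {: N})%N.
Proof.
move=> [_ _ f0 fg gs]; rewrite -(limg_ker_dim g fullv) capfv gs -fg.
by congr (_ + _)%N; apply: limg_dim_eq; rewrite f0 capv0.
Qed.

Lemma euler_mzero X theta : mzero X -> euler X theta = 0.
Proof.
move=> /mzeroP X0.
have h0 : short_exact (0 : 'Hom(X, X)) (0 : 'Hom(X, X)).
  have V0 (V W : {vspace X}) : V = W.
    by apply/vspaceP=> v; rewrite (X0 v) !mem0v.
  by split; rewrite ?homs0 //; exact: V0.
apply: (addrI (euler X theta)); rewrite addr0; exact/esym/(euler_exact theta h0).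
Qed.

Lemma mono_mzero X Y (f : 'Hom(X, Y)) : lker f = 0%VS -> f = 0 -> mzero X.
Proof.
by move=> f0 fE; apply/mzeroP=> v; apply: (lker0_inj f0); rewrite fE !lfunE.
Qed.

Lemma epi_mzero X Y (f : 'Hom(X, Y)) : limg f = fullv -> f = 0 -> mzero Y.
Proof.
move=> fs fE; apply/mzeroP=> v; have [u <-] := limg_fullP v fs.
by rewrite fE lfunE.
Qed.

Lemma mzero_lfun X Y (f : 'Hom(X, Y)) : mzero X -> f = 0.
Proof. by move=> /mzeroP X0; apply/lfunP=> v; rewrite (X0 v) !linear0. Qed.

Lemma mzero_colfun X Y (f : 'Hom(X, Y)) : mzero Y -> f = 0.
Proof. by move=> /mzeroP Y0; apply/lfunP=> v; rewrite (Y0 (f v)) lfunE. Qed.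

Lemma epi_comp L M N (f : 'Hom(L, M)) (g : 'Hom(M, N)) :
  limg f = fullv -> limg g = fullv -> limg (g \o f)%VF = fullv.
Proof. by move=> fs gs; rewrite limg_comp fs. Qed.

Lemma mono_comp L M N (f : 'Hom(L, M)) (g : 'Hom(M, N)) :
  lker f = 0%VS -> lker g = 0%VS -> lker (g \o f)%VF = 0%VS.
Proof.
move=> f0 g0; apply: lker_eq0 => v; rewrite comp_lfunE => gfv.
apply: (lker0_inj f0); rewrite linear0; apply: (lker0_inj g0).
by rewrite gfv linear0.
Qed.

Definition is_quotient M X := exists2 p : 'Hom(M, X), p \in homs M X & limg p = fullv.
Definition is_sub Y M := exists2 i : 'Hom(Y, M), i \in homs Y M & lker i = 0%VS.

Lemma is_quotient_refl M : is_quotient M M.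
Proof. by exists \1%VF; [exact: homs_id | rewrite lim1g]. Qed.

Lemma is_sub_refl M : is_sub M M.
Proof.
exists \1%VF; [exact: homs_id | apply: lker_eq0 => v].
by rewrite id_lfunE.
Qed.

Lemma is_quotient_trans L M N : is_quotient L M -> is_quotient M N -> is_quotient L N.
Proof.
move=> [p ph ps] [q qh qs]; exists (q \o p)%VF; first exact: homs_comp ph qh.
exact: epi_comp.
Qed.

Lemma is_sub_trans L M N : is_sub L M -> is_sub M N -> is_sub L N.
Proof.
move=> [p ph ps] [q qh qs]; exists (q \o p)%VF; first exact: homs_comp ph qh.
exact: mono_comp.
Qed.

Lemma exact_sub L M N (f : 'Hom(L, M)) (g : 'Hom(M, N)) :
  short_exact f g -> is_sub L M.
Proof. by case=> fh _ f0 _ _; exists f. Qed.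

Lemma exact_quotient L M N (f : 'Hom(L, M)) (g : 'Hom(M, N)) :
  short_exact f g -> is_quotient M N.
Proof. by case=> _ gh _ _ gs; exists g. Qed.

Lemma TbarP theta M :
  Tbar theta M <-> (forall X, is_quotient M X -> 0 <= euler X theta).
Proof.
split=> [TM X [p ph ps]|TM X p ph ps _]; last by apply: TM; exists p.
have [/(euler_mzero theta)->//|X0] := pselect (mzero X).
exact: TM ph ps X0.
Qed.

Lemma FbarP theta M :
  Fbar theta M <-> (forall Y, is_sub Y M -> euler Y theta <= 0).
Proof.
split=> [FM Y [p ph ps]|FM Y p ph ps _]; last by apply: FM; exists p.
have [/(euler_mzero theta)->//|Y0] := pselect (mzero Y).
exact: FM ph ps Y0.
Qed.

Lemma TopenP theta M : Topen theta M <->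
  (forall X, is_quotient M X -> ~ mzero X -> 0 < euler X theta).
Proof.
split=> [TM X [p ph ps]|TM X p ph ps]; first exact: TM ph ps.
by apply: TM; exists p.
Qed.

Lemma FopenP theta M : Fopen theta M <->
  (forall Y, is_sub Y M -> ~ mzero Y -> euler Y theta < 0).
Proof.
split=> [TM X [p ph ps]|TM X p ph ps]; first exact: TM ph ps.
by apply: TM; exists p.
Qed.

(** Equivalently, the images of the f k span X. The categorical form dualizes. *)
Definition jointly_epi (I : Type) (M : I -> rmod A) X (f : forall k, 'Hom(M k, X)) :=
  forall Y (q : 'Hom(X, Y)), q \in homs X Y -> (forall k, (q \o f k)%VF = 0) -> q = 0.

Definition jointly_mono (I : Type) (M : I -> rmod A) X (f : forall k, 'Hom(X, M k)) :=
  forall Y (q : 'Hom(Y, X)), q \in homs Y X -> (forall k, (f k \o q)%VF = 0) -> q = 0.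

Lemma id_lfun_eq0 X : (\1%VF : 'Hom(X, X)) = 0 -> mzero X.
Proof. by move/lfunP=> h; apply/mzeroP=> v; rewrite -[v]id_lfunE h lfunE. Qed.

(** Filter X by the images of the f k: if some f k is nonzero, its image is a
    quotient of M k, and the cokernel is again generated by the family but
    smaller. *)
Lemma euler_ge0_span theta (I : Type) (M : I -> rmod A) X
    (f : forall k, 'Hom(M k, X)) :
  (forall k, f k \in homs (M k) X) -> (forall k, Tbar theta (M k)) ->
  jointly_epi f -> 0 <= euler X theta.
Proof.
have [n] := ubnP (\dim {: X}); elim: n X f => // n IH X f Xn fh TM fe.
have [X0|XN0] := pselect (mzero X); first by rewrite euler_mzero.
have [f0|] := pselect (forall k, f k = 0).
  exfalso; apply: XN0; apply: id_lfun_eq0; apply: fe (homs_id X) _ => k.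
  by rewrite f0 comp_lfun0r.
move=> /existsNP[k fk0]; have [J [p [i [ph ih ps i0 fkE]]]] := image_factor (fh k).
have [Q [q se]] := epi_mono_exact ih i0; rewrite (euler_exact theta se) addr_ge0 //.
  by apply: ((TbarP theta (M k)).1 (TM k)); exists p.
have qh : q \in homs X Q by case: se.
apply: (IH Q (fun k => q \o f k)%VF) => //.
- rewrite -ltnS (leq_trans _ Xn) // ltnS (dim_exact se) -[X in (X < _)%N]add0n ltn_add2r lt0n.
  by apply/negP=> /eqP J0; apply: fk0; rewrite -fkE (mzero_lfun i J0) comp_lfun0l.
- by move=> l; apply: homs_comp.
- move=> Y r rh r0; have qs : limg q = fullv by case: se.
  apply: (comp_epi_eq0 qs); apply: fe => [|l]; first exact: homs_comp qh rh.
  by rewrite -comp_lfunA r0.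
Qed.

(** Dual to the preceding lemma: the image of a nonzero f k is a submodule of
    M k, and the kernel is again separated by the family but smaller. *)
Lemma euler_le0_cospan theta (I : Type) (M : I -> rmod A) X
    (f : forall k, 'Hom(X, M k)) :
  (forall k, f k \in homs X (M k)) -> (forall k, Fbar theta (M k)) ->
  jointly_mono f -> euler X theta <= 0.
Proof.
have [n] := ubnP (\dim {: X}); elim: n X f => // n IH X f Xn fh TM fe.
have [X0|XN0] := pselect (mzero X); first by rewrite euler_mzero.
have [f0|] := pselect (forall k, f k = 0).
  exfalso; apply: XN0; apply: id_lfun_eq0; apply: fe (homs_id X) _ => k.
  by rewrite f0 comp_lfun0l.
move=> /existsNP[k fk0]; have [J [p [i [ph ih ps i0 fkE]]]] := image_factor (fh k).
have [Q [q se]] := mono_epi_exact ph ps; rewrite (euler_exact theta se) addrC -[leRHS]addr0.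
apply: lerD.
  by apply: ((FbarP theta (M k)).1 (TM k)); exists i.
have qh : q \in homs Q X by case: se.
apply: (IH Q (fun k => f k \o q)%VF) => //.
- rewrite -ltnS (leq_trans _ Xn) // ltnS (dim_exact se) -[X in (X < _)%N]addn0 ltn_add2l lt0n.
  by apply/negP=> /eqP J0; apply: fk0; rewrite -fkE (mzero_lfun i J0) comp_lfun0l.
- by move=> l; apply: homs_comp.
- move=> Y r rh r0; have q0 : lker q = 0%VS by case: se.
  apply: (comp_mono_eq0 q0); apply: fe => [|l]; first exact: homs_comp rh qh.
  by rewrite comp_lfunA r0.
Qed.

Lemma Tbar_span theta (I : Type) (M : I -> rmod A) X (f : forall k, 'Hom(M k, X)) :
  (forall k, f k \in homs (M k) X) -> (forall k, Tbar theta (M k)) ->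
  jointly_epi f -> Tbar theta X.
Proof.
move=> fh TM fe; apply/TbarP=> Y [p ph ps].
apply: (@euler_ge0_span theta I M Y (fun k => p \o f k)%VF) => // [k|Z q qh q0].
  exact: homs_comp.
apply: (comp_epi_eq0 ps); apply: fe => [|k]; first exact: homs_comp ph qh.
by rewrite -comp_lfunA q0.
Qed.

Lemma Fbar_cospan theta (I : Type) (M : I -> rmod A) X (f : forall k, 'Hom(X, M k)) :
  (forall k, f k \in homs X (M k)) -> (forall k, Fbar theta (M k)) ->
  jointly_mono f -> Fbar theta X.
Proof.
move=> fh TM fe; apply/FbarP=> Y [p ph p0].
apply: (@euler_le0_cospan theta I M Y (fun k => f k \o p)%VF) => // [k|Z q qh q0].
  exact: homs_comp.
apply: (comp_mono_eq0 p0); apply: fe => [|k]; first exact: homs_comp qh ph.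
by rewrite comp_lfunA q0.
Qed.

Lemma Tbar_quotient theta M X : Tbar theta M -> is_quotient M X -> Tbar theta X.
Proof.
move=> /TbarP TM MX; apply/TbarP=> Y XY; apply: TM.
exact: is_quotient_trans MX XY.
Qed.

Lemma Fbar_sub theta M X : Fbar theta M -> is_sub X M -> Fbar theta X.
Proof.
move=> /FbarP TM MX; apply/FbarP=> Y XY; apply: TM.
exact: is_sub_trans XY MX.
Qed.

(** Q is M modulo the kernel of p, an extension of X by I. Only its class and
    dimension are needed. *)
Lemma euler_push L M X I (f : 'Hom(L, M)) (g : 'Hom(M, X))
    (p : 'Hom(L, I)) : short_exact f g -> p \in homs L I -> limg p = fullv ->
  exists Q, [/\ is_quotient M Q,
    forall theta, euler Q theta = euler X theta + euler I theta
    & \dim {: Q} = (\dim {: X} + \dim {: I})%N].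
Proof.
move=> fg ph ps; have [Z [k kp]] := mono_epi_exact ph ps.
have [fh kh f0 k0] : [/\ f \in homs L M, k \in homs Z L, lker f = 0%VS & lker k = 0%VS].
  by case: fg => ? _ ? _ _; case: kp.
have [Q [q se]] := epi_mono_exact (homs_comp kh fh) (mono_comp k0 f0).
exists Q; split; first exact: exact_quotient se.
- move=> theta; apply: (addrI (euler Z theta)).
  rewrite -(euler_exact theta se) (euler_exact theta fg) (euler_exact theta kp).
  by rewrite -addrA [_ + euler X _]addrC.
- apply: (@addnI (\dim {: Z})).
  rewrite -(dim_exact se) (dim_exact fg) (dim_exact kp).
  by rewrite -addnA [(_ + \dim {: X})%N]addnC.
Qed.

(** Q is the preimage of I in M, an extension of I by Y. *)
Lemma euler_pull Y M N I (f : 'Hom(Y, M)) (g : 'Hom(M, N))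
    (i : 'Hom(I, N)) : short_exact f g -> i \in homs I N -> lker i = 0%VS ->
  exists Q, [/\ is_sub Q M,
    forall theta, euler Q theta = euler Y theta + euler I theta
    & \dim {: Q} = (\dim {: Y} + \dim {: I})%N].
Proof.
move=> fg ih i0; have [Z [k ik]] := epi_mono_exact ih i0.
have [gh kh gs ks] : [/\ g \in homs M N, k \in homs N Z, limg g = fullv & limg k = fullv].
  by case: fg => _ ? _ _ ?; case: ik.
have [Q [q se]] := mono_epi_exact (homs_comp gh kh) (epi_comp gs ks).
exists Q; split; first exact: exact_sub se.
- move=> theta; apply: (addIr (euler Z theta)).
  rewrite -(euler_exact theta se) (euler_exact theta fg) (euler_exact theta ik).
  by rewrite addrA.
- apply: (@addIn (\dim {: Z})).
  rewrite -(dim_exact se) (dim_exact fg) (dim_exact ik).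
  by rewrite addnA.
Qed.

(** A proper nonzero submodule L of M splits each quotient of M into a quotient
    of L and one of M / L, so the classes are sums of those for L and M / L; a
    simple module has two quotients. This is why D(U) is polyhedral. *)
Lemma euler_quotients_finite M :
  finite_set [set e : K0 R A -> R | exists2 X, is_quotient M X & e = euler X].
Proof.
have [n] := ubnP (\dim {: M}); elim: n M => // n IH M Mn.
(* W is a proper nonzero submodule, if there is one; otherwise M is simple or
   zero. *)
have [[W stW /andP[W0 Wf]]|nsub] :=
  pselect (exists2 W : {vspace M}, stable W & (W != 0%VS) && (W != fullv)).
- have [Q [q [qh qs qK]]] := quotient stW.
  have [L [i se]] := mono_epi_exact qh qs.
  have ML := dim_exact se.
  have LN0 : (0 < \dim {: L})%N.
    rewrite lt0n; apply/negP=> /eqP L0; move/negP: W0; apply; apply/eqP.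
    case: se => ih _ i0 iq _; rewrite -qK -iq (mzero_lfun i L0).
    exact: lim0g.
  have QN0 : (0 < \dim {: Q})%N.
    rewrite lt0n; apply/negP=> /eqP Q0; move/negP: Wf; apply; apply/eqP.
    rewrite -qK; apply/vspaceP=> v; rewrite memvf memv_ker.
    by rewrite (mzero_colfun q Q0) lfunE eqxx.
  have Ln : (\dim {: L} < n)%N by lia.
  have Qn : (\dim {: Q} < n)%N by lia.
  apply: sub_finite_set (finite_image2 (fun e e' : K0 R A -> R => (fun t => e t + e' t))
    (IH _ Ln) (IH _ Qn)).
  move=> e [X [p ph ps] ->] /=.
  have ih : i \in homs L M by case: se.
  have [J [a [b [ah bh sa b0 ab]]]] := image_factor (homs_comp ih ph).
  have [Z [r bz]] := epi_mono_exact bh b0.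
  have [rh rs] : r \in homs X Z /\ limg r = fullv by case: bz.
  exists (euler J); first by exists J => //; exists a.
  exists (euler Z); last by apply/funext=> t; rewrite (euler_exact t bz).
  exists Z => //.
  have [c ch cE] : exists2 c : 'Hom(Q, Z), c \in homs Q Z & (c \o q)%VF = (r \o p)%VF.
    apply: (factor_epi qh qs (homs_comp ph rh)); apply/subvP=> v.
    case: (se) => _ _ _ <- _ /memv_imgP[u _ ->]; rewrite memv_ker !comp_lfunE.
    rewrite -[p (i u)]comp_lfunE -ab comp_lfunE.
    have : b (a u) \in lker r by case: bz => _ _ _ <- _; rewrite memv_img ?memvf.
    by rewrite memv_ker.
  exists c => //; apply/eqP; rewrite eqEsubv subvf /=.
  have /(congr1 (fun W : {vspace Z} => W)) : limg (c \o q)%VF = fullv.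
    by rewrite cE; apply: epi_comp.
  by rewrite limg_comp => <-; apply: limgS; rewrite subvf.
- apply: (@sub_finite_set _ _ [set euler M; fun=> 0]); last exact: finite_set2.
  move=> e [X [p ph ps] ->].
  have [k0|kN0] := eqVneq (lker p) 0%VS; [left|right] => /=.
    have [L [i se]] := mono_epi_exact ph ps; apply/funext=> t.
    have L0 : mzero L.
      case: (se) => _ _ i0 ip _; apply: (mono_mzero i0); apply/lfunP=> v.
      have : i v \in lker p by rewrite -ip memv_img ?memvf.
      by rewrite k0 memv0 lfunE => /eqP.
    by rewrite (euler_exact t se) (euler_mzero t L0) add0r.
  have kf : lker p = fullv.
    apply/eqP/negPn/negP=> kNf; apply: nsub; exists (lker p); last by rewrite kN0.
    exact: stable_ker.
  apply/funext=> t; apply: euler_mzero; apply: (epi_mzero ps).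
  apply/lfunP=> v; rewrite lfunE; apply/eqP; rewrite -memv_ker kf.
  exact: memvf.
Qed.

Lemma euler_subs_finite M :
  finite_set [set e : K0 R A -> R | exists2 Y, is_sub Y M & e = euler Y].
Proof.
apply: sub_finite_set (finite_image (fun e t => euler M t - e t)
  (euler_quotients_finite M)).
move=> e [Y [i ih i0] ->]; have [X [p se]] := epi_mono_exact ih i0.
exists (euler X); first by exists X => //; exact: exact_quotient se.
by apply/funext=> t; rewrite (euler_exact t se) addrK.
Qed.

End EulerExact.

(** * Crossing the walls of D(U) *)

Section Core.
Variables (R : realType) (K : fieldType) (A : falgType K).
Implicit Types (L M X Y Z I Q S T : rmod A) (theta : K0 R A).
Variables (m : nat) (H N : 'I_m -> rmod A) (c : 'I_m -> K0 R A).

(** H i, N i and c i stand for H^0(U_i), H^-1(nu U_i) and the class of U_i. The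
    Euler form gives dim Hom(U_i, X) - dim Hom(U_i, X[1]), and HN0 expresses
    Hom(U_j, U_i[1]) = 0. The two radical conditions are what remains of the
    facts that the U_i have local endomorphism rings and are not isomorphic to
    each other. *)
Hypothesis eulerc : forall i X,
  euler X (c i) = (hdim (H i) X)%:R - (hdim X (N i))%:R.
Hypothesis HN0 : forall i j, hdim (H i) (N j) = 0%N.
Hypothesis HN_nonzero : forall i, ~ mzero (H i) \/ ~ mzero (N i).
Hypothesis H_radical : forall i n (j : 'I_n -> 'I_m)
    (g : forall k, 'Hom(H i, H (j k))) (h : forall k, 'Hom(H (j k), H i)),
  (forall k, j k != i) -> (forall k, g k \in homs (H i) (H (j k))) ->
  (forall k, h k \in homs (H (j k)) (H i)) ->
  exists d, forall v, iter d (fun v => \sum_k h k (g k v)) v = 0.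
Hypothesis N_radical : forall i n (j : 'I_n -> 'I_m)
    (g : forall k, 'Hom(N i, N (j k))) (h : forall k, 'Hom(N (j k), N i)),
  (forall k, j k != i) -> (forall k, g k \in homs (N i) (N (j k))) ->
  (forall k, h k \in homs (N (j k)) (N i)) ->
  exists d, forall v, iter d (fun v => \sum_k h k (g k v)) v = 0.

Lemma homs_HN i j (f : 'Hom(H i, N j)) : f \in homs (H i) (N j) -> f = 0.
Proof. by apply: (hdim_eq0P _ _).1 => //; apply: HN0. Qed.

Lemma natR_eq0D a b : a%:R + b%:R = 0 :> R -> a = 0%N /\ b = 0%N.
Proof.
by rewrite -natrD => /eqP; rewrite pnatr_eq0 addn_eq0 => /andP[/eqP-> /eqP->].
Qed.

(** The connecting map Hom(H i, X) -> D Hom(L, N i) vanishes since its target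
    does. The six term sequence is replaced by a count of dimensions: eulerc and
    additivity of the Euler form leave no room for a smaller image. *)
Lemma lift_of_hdim i L M X (f : 'Hom(L, M)) (g : 'Hom(M, X)) (h : 'Hom(H i, X)) :
  short_exact f g -> hdim L (N i) = 0%N -> h \in homs (H i) X ->
  exists2 k : 'Hom(H i, M), k \in homs (H i) M & (g \o k)%VF = h.
Proof.
move=> se L0 hh; have gh : g \in homs M X by case: se.
have e := euler_exact (c i) se; rewrite !eulerc L0 subr0 in e.
have hM := hdim_left_exact (H i) se; have hN := hdim_right_exact (N i) se.
(* Since Hom(L, N i) = 0, X and M have the same maps to N i. *)
have im0 : \dim (precompl (N i) f @: homs M (N i)) = 0%N.
  apply/eqP; rewrite -leqn0 -L0 /hdim; apply/dimvS/subvP=> _ /memv_imgP[k kh ->].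
  by rewrite precomplE; case: se => fh *; apply: homs_comp fh kh.
have sub : (postcompl (H i) g @: homs (H i) M <= homs (H i) X)%VS.
  by apply/subvP=> _ /memv_imgP[k kh ->]; rewrite postcomplE (homs_comp kh gh).
have : (postcompl (H i) g @: homs (H i) M)%VS == homs (H i) X.
  rewrite eqEdim sub -(leq_add2l (hdim (H i) L)) -hM.
  rewrite -(ler_nat R) natrD -/(hdim (H i) X).
  have : (hdim M (N i))%:R = (hdim X (N i))%:R :> R by rewrite hN im0 addn0.
  by move=> eN; rewrite eN in e; lra.
move=> /eqP E; move: hh; rewrite -E => /memv_imgP[k kh ->].
by exists k; rewrite ?postcomplE.
Qed.

(** Dual count: the connecting map now starts from Hom(H i, X), which is zero. *)
Lemma extend_of_hdim i L M X (f : 'Hom(L, M)) (g : 'Hom(M, X)) (h : 'Hom(L, N i)) :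
  short_exact f g -> hdim (H i) X = 0%N -> h \in homs L (N i) ->
  exists2 k : 'Hom(M, N i), k \in homs M (N i) & (k \o f)%VF = h.
Proof.
move=> se X0 hh; have fh : f \in homs L M by case: se.
have e := euler_exact (c i) se; rewrite !eulerc X0 sub0r in e.
have hM := hdim_left_exact (H i) se; have hN := hdim_right_exact (N i) se.
have im0 : \dim (postcompl (H i) g @: homs (H i) M) = 0%N.
  apply/eqP; rewrite -leqn0 -X0 /hdim; apply/dimvS/subvP=> _ /memv_imgP[k kh ->].
  by rewrite postcomplE; case: se => _ gh *; apply: homs_comp kh gh.
have sub : (precompl (N i) f @: homs M (N i) <= homs L (N i))%VS.
  by apply/subvP=> _ /memv_imgP[k kh ->]; rewrite precomplE (homs_comp fh kh).
have : (precompl (N i) f @: homs M (N i))%VS == homs L (N i).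
  rewrite eqEdim sub -(leq_add2l (hdim X (N i))) -hN.
  rewrite -(ler_nat R) natrD -/(hdim L (N i)).
  have : (hdim (H i) M)%:R = (hdim (H i) L)%:R :> R by rewrite hM im0 addn0.
  by move=> eN; rewrite eN in e; lra.
move=> /eqP E; move: hh; rewrite -E => /memv_imgP[k kh ->].
by exists k; rewrite ?precomplE.
Qed.

(** If all maps H i -> X lift, the connecting map into D Hom(L, N i) is zero, and
    it is onto because Hom(M, N i) = 0. *)
Lemma kernel_hdim i L M X (f : 'Hom(L, M)) (g : 'Hom(M, X)) :
  short_exact f g -> hdim M (N i) = 0%N ->
  (forall h : 'Hom(H i, X), h \in homs (H i) X ->
     exists2 k : 'Hom(H i, M), k \in homs (H i) M & (g \o k)%VF = h) ->
  hdim L (N i) = 0%N.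
Proof.
move=> se M0 lift; have gh : g \in homs M X by case: se.
have e := euler_exact (c i) se; rewrite !eulerc M0 subr0 in e.
have hM := hdim_left_exact (H i) se.
have E : (postcompl (H i) g @: homs (H i) M)%VS = homs (H i) X.
  apply/vspaceP=> h; apply/memv_imgP/idP => [[k kh ->]|/lift[k kh <-]].
    by rewrite postcomplE (homs_comp kh gh).
  by exists k; rewrite ?postcomplE.
rewrite E -/(hdim (H i) X) in hM; rewrite hM natrD in e.
have : (hdim L (N i))%:R + (hdim X (N i))%:R = 0 :> R by lra.
by case/natR_eq0D.
Qed.

Lemma cokernel_hdim i L M X (f : 'Hom(L, M)) (g : 'Hom(M, X)) :
  short_exact f g -> hdim (H i) M = 0%N ->
  (forall h : 'Hom(L, N i), h \in homs L (N i) ->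
     exists2 k : 'Hom(M, N i), k \in homs M (N i) & (k \o f)%VF = h) ->
  hdim (H i) X = 0%N.
Proof.
move=> se M0 lift; have fh : f \in homs L M by case: se.
have e := euler_exact (c i) se; rewrite !eulerc M0 sub0r in e.
have hM := hdim_right_exact (N i) se.
have E : (precompl (N i) f @: homs M (N i))%VS = homs L (N i).
  apply/vspaceP=> h; apply/memv_imgP/idP => [[k kh ->]|/lift[k kh <-]].
    by rewrite precomplE (homs_comp fh kh).
  by exists k; rewrite ?precomplE.
rewrite E -/(hdim L (N i)) in hM; rewrite hM natrD in e.
have : (hdim (H i) L)%:R + (hdim (H i) X)%:R = 0 :> R by lra.
by case/natR_eq0D.
Qed.


(** Take one summand H j for each element of a basis of each Hom(H j, X) with j
    distinct from i. *)
Lemma right_approx i X : exists n (j : 'I_n -> 'I_m) S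
    (inc : forall k, 'Hom(H (j k), S)) (prj : forall k, 'Hom(S, H (j k)))
    (s : 'Hom(S, X)),
  [/\ forall k, j k != i,
      [/\ forall k, inc k \in homs (H (j k)) S, forall k, prj k \in homs S (H (j k)),
        (forall v, v = \sum_k inc k (prj k v)) & s \in homs S X]
    & forall j', j' != i -> forall f : 'Hom(H j', X), f \in homs (H j') X ->
        exists2 g : 'Hom(H j', S), g \in homs (H j') S & (s \o g)%VF = f].
Proof.
(* A list of pairs rather than a dependent sum of index types: its members can
   be destructed without transport along equalities of indices. *)
pose fam := [seq Tagged (fun j => 'Hom(H j, X)) f
  | j <- enum (predC1 i), f <- vbasis (homs (H j) X)].
pose x k := tnth (in_tuple fam) k.
have xP k : tag (x k) != i /\ tagged (x k) \in homs (H (tag (x k))) X.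
  have /allpairsPdep[j [f [jin fin ->]]] : x k \in fam by apply: mem_tnth.
  by move: jin; rewrite mem_enum /=; split=> //; apply: vbasis_mem.
have [S [inc [prj [inch prjh sumE univ _]]]] := direct_sum (fun k => H (tag (x k))).
have [s sh sinc] := univ X (fun k => tagged (x k)) (fun k => (xP k).2).
exists (size fam), (fun k => tag (x k)), S, inc, prj, s; split=> //.
  by move=> k; case: (xP k).
move=> j' j'i; suff sub : (homs (H j') X <= postcompl (H j') s @: homs (H j') S)%VS.
  by move=> f /(subvP sub)/memv_imgP[g gh ->]; exists g; rewrite ?postcomplE.
rewrite -(span_basis (vbasisP (homs (H j') X))); apply/span_subvP=> f fin.
have : Tagged (fun j => 'Hom(H j, X)) f \in fam.
  by apply/allpairsPdep; exists j', f; rewrite mem_enum.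
move=> /(tnthP (in_tuple fam))[k xk].
move: (inch k) (sinc k); rewrite /x; move: (inc k); rewrite /x -xk /= => g gh gE.
by apply/memv_imgP; exists g; rewrite ?postcomplE.
Qed.

(** Take one summand N j for each element of a basis of each Hom(Y, N j) with j
    distinct from i. *)
Lemma left_approx i Y : exists n (j : 'I_n -> 'I_m) S
    (inc : forall k, 'Hom(N (j k), S)) (prj : forall k, 'Hom(S, N (j k)))
    (s : 'Hom(Y, S)),
  [/\ forall k, j k != i,
      [/\ forall k, inc k \in homs (N (j k)) S, forall k, prj k \in homs S (N (j k)),
        (forall v, v = \sum_k inc k (prj k v)) & s \in homs Y S]
    & forall j', j' != i -> forall f : 'Hom(Y, N j'), f \in homs Y (N j') ->
        exists2 g : 'Hom(S, N j'), g \in homs S (N j') & (g \o s)%VF = f].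
Proof.
pose fam := [seq Tagged (fun j => 'Hom(Y, N j)) f
  | j <- enum (predC1 i), f <- vbasis (homs Y (N j))].
pose x k := tnth (in_tuple fam) k.
have xP k : tag (x k) != i /\ tagged (x k) \in homs Y (N (tag (x k))).
  have /allpairsPdep[j [f [jin fin ->]]] : x k \in fam by apply: mem_tnth.
  by move: jin; rewrite mem_enum /=; split=> //; apply: vbasis_mem.
have [S [inc [prj [inch prjh sumE _ univ]]]] := direct_sum (fun k => N (tag (x k))).
have [s sh sprj] := univ Y (fun k => tagged (x k)) (fun k => (xP k).2).
exists (size fam), (fun k => tag (x k)), S, inc, prj, s; split=> //.
  by move=> k; case: (xP k).
move=> j' j'i; suff sub : (homs Y (N j') <= precompl (N j') s @: homs S (N j'))%VS.
  by move=> f /(subvP sub)/memv_imgP[g gh ->]; exists g; rewrite ?precomplE.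
rewrite -(span_basis (vbasisP (homs Y (N j')))); apply/span_subvP=> f fin.
have : Tagged (fun j => 'Hom(Y, N j)) f \in fam.
  by apply/allpairsPdep; exists j', f; rewrite mem_enum.
move=> /(tnthP (in_tuple fam))[k xk].
move: (prjh k) (sprj k); rewrite /x; move: (prj k); rewrite /x -xk /= => g gh gE.
by apply/memv_imgP; exists g; rewrite ?precomplE.
Qed.

Lemma sum_jointly_epi n (M : 'I_n -> rmod A) S (inc : forall k, 'Hom(M k, S))
    (prj : forall k, 'Hom(S, M k)) :
  (forall v, v = \sum_k inc k (prj k v)) -> jointly_epi inc.
Proof.
move=> sE Y q qh q0; apply/lfunP=> v; rewrite [v in LHS]sE linear_sum lfunE big1 // => k _.
by rewrite /= -comp_lfunE q0 lfunE.
Qed.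

Lemma sum_jointly_mono n (M : 'I_n -> rmod A) S (inc : forall k, 'Hom(M k, S))
    (prj : forall k, 'Hom(S, M k)) :
  (forall v, v = \sum_k inc k (prj k v)) -> jointly_mono prj.
Proof.
move=> sE Y q qh q0; apply/lfunP=> v; rewrite [LHS]sE lfunE big1 // => k _.
by rewrite /= -[prj k _]comp_lfunE q0 lfunE linear0.
Qed.

Lemma max_nat (P : nat -> Prop) b : (forall n, P n -> (n <= b)%N) ->
  (exists n, P n) -> exists n, P n /\ forall k, P k -> (k <= n)%N.
Proof.
move=> Pb exP; have exPb : exists n, `[< P n >] by case: exP => n /asboolT; exists n.
have bP n : `[< P n >] -> (n <= b)%N by move=> /asboolP/Pb.
case: (ex_maxnP exPb bP) => n /asboolP Pn nmax; exists n; split=> // k /asboolT.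
exact: nmax.
Qed.

Lemma quotient_dim L M : is_quotient L M -> (\dim {: M} <= \dim {: L})%N.
Proof.
by case=> p _ <-; rewrite -[X in (_ <= X)%N](limg_ker_dim p) leq_addl.
Qed.

Lemma sub_dim L M : is_sub L M -> (\dim {: L} <= \dim {: M})%N.
Proof.
case=> i _ i0; rewrite -(@limg_dim_eq _ _ _ i fullv) ?i0 ?capv0 //.
by rewrite dimvS ?subvf.
Qed.

Section WallStep.
Variables (i : 'I_m) (theta : K0 R A).
Hypothesis H_Tbar : forall j, Tbar theta (H j).
Hypothesis N_Fbar : forall j, Fbar theta (N j).
Hypothesis H_other : forall X, is_quotient (H i) X -> ~ mzero X ->
  euler X theta = 0 -> exists2 j, j != i & (0 < hdim (H j) X)%N.
Hypothesis N_other : forall Y, is_sub Y (N i) -> ~ mzero Y ->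
  euler Y theta = 0 -> exists2 j, j != i & (0 < hdim Y (N j))%N.

(** Suppose some nonzero quotient of H i has theta = 0 and let p : H i -> X be
    one of maximal dimension, with kernel t. Maximality gives Hom(t, N j) = 0 for
    all j: the image of such a map would enlarge X by a piece on which theta is
    both nonnegative and nonpositive. So maps H j -> X lift to H i.
    Let s : S -> X be a right approximation by the other summands. It is onto:
    its cokernel Q is a quotient of H i with theta = 0, and a nonzero map
    H j -> Q would lift to X, hence factor through s. Its kernel L satisfies
    Hom(L, N j) = 0 for j distinct from i, hence also for j = i, because the
    image of a map L -> N i is a submodule of N i with theta = 0, which maps
    nontrivially to some other N j if it is nonzero. So p lifts to S, and the
    components S -> X lift to H i. Thus p = p phi with phi an endomorphism of
    H i that factors through the other summands; phi is nilpotent, and X = 0. *)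
Lemma H_Topen : Topen theta (H i).
Proof.
apply/TopenP=> X0 HX0 X0N0; rewrite lt_neqAle ((TbarP _ _).1 (@H_Tbar i)) // andbT.
apply/eqP => /esym eX0.
have [d [[X [[p ph ps] eX Xd]] dmax]] : exists d,
    (exists X, [/\ is_quotient (H i) X, euler X theta = 0 & \dim {: X} = d]) /\
    forall k, (exists X, [/\ is_quotient (H i) X, euler X theta = 0 & \dim {: X} = k])
      -> (k <= d)%N.
  apply: (@max_nat _ (\dim {: H i})) => [k [X [HX _ <-]]|].
    exact: quotient_dim.
  by exists (\dim {: X0}), X0.
have XN0 : ~ mzero X.
  move=> X00; apply: X0N0; apply/eqP; rewrite -leqn0 -X00 Xd.
  by apply: dmax; exists X0.
have [t [u up]] := mono_epi_exact ph ps.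
have t0 j : hdim t (N j) = 0%N.
  apply/hdim_eq0P=> f fh; have [I [a [b [ah bh as_ b0 abE]]]] := image_factor fh.
  have [Q [HQ eQ dQ]] := euler_push R up ah as_.
  (* Q is a quotient of H i containing X as a quotient, and I a submodule of
     N j. *)
  have eI : euler Q theta = 0.
    apply/eqP; rewrite eq_le ((TbarP _ _).1 (@H_Tbar i)) // andbT eQ eX add0r.
    by apply: ((FbarP _ _).1 (@N_Fbar j)); exists b.
  have : (\dim {: Q} <= d)%N by apply: dmax; exists Q.
  rewrite dQ Xd -[leqRHS]addn0 leq_add2l leqn0 => /eqP I0.
  by rewrite -abE (mzero_lfun b I0) comp_lfun0l.
have [n [j [S [inc [prj [s [ji [inch prjh sumE sh] sapp]]]]]]] := right_approx i X.
have S_Tbar : Tbar theta S.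
  exact: (Tbar_span inch (fun k => @H_Tbar (j k)) (sum_jointly_epi sumE)).
have S0 j' : hdim S (N j') = 0%N.
  apply/hdim_eq0P=> f fh; apply: (sum_jointly_epi sumE fh) => k.
  exact/homs_HN/homs_comp/fh.
have ss : limg s = fullv.
  have [T [a [b [ah bh as_ b0 abE]]]] := image_factor sh.
  have [Q [q bq]] := epi_mono_exact bh b0.
  have T0 j' : hdim T (N j') = 0%N.
    apply/hdim_eq0P=> f fh; apply: (comp_epi_eq0 as_).
    by apply: (hdim_eq0P _ _).1; [exact: S0 | exact: homs_comp fh].
  have [qh qs] : q \in homs X Q /\ limg q = fullv by case: bq.
  have HQ : is_quotient (H i) Q.
    by apply: is_quotient_trans (exact_quotient bq); exists p.
  have eQ : euler Q theta = 0.
    have eT : 0 <= euler T theta by apply: ((TbarP _ _).1 S_Tbar); exists a.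
    have eQ : 0 <= euler Q theta by apply: ((TbarP _ _).1 (@H_Tbar i)).
    by have := euler_exact theta bq; rewrite eX; lra.
  have [Q0|QN0] := pselect (mzero Q).
    have : lker q = fullv.
      by apply/vspaceP=> v; rewrite memvf memv_ker (mzero_colfun q Q0) lfunE eqxx.
    case: bq => _ _ _ <- _; rewrite -abE => bf.
    by rewrite limg_comp as_.
  have [j' j'i /hdim_gt0P[f fh]] := H_other HQ QN0 eQ; case.
  have [f' f'h <-] := lift_of_hdim bq (T0 j') fh.
  have [g gh <-] := sapp j' j'i f' f'h.
  apply/lfunP=> v; rewrite -abE !comp_lfunE lfunE; apply/eqP.
  by rewrite -memv_ker; case: bq => _ _ _ <- _; rewrite memv_img ?memvf.
have [L [w ws]] := mono_epi_exact sh ss.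
have L0 j' : j' != i -> hdim L (N j') = 0%N.
  by move=> j'i; apply: (kernel_hdim ws (S0 j')) (sapp j' j'i).
have Li : hdim L (N i) = 0%N.
  apply/hdim_eq0P=> f fh; have [I [a [b [ah bh as_ b0 abE]]]] := image_factor fh.
  have [Q [HQ eQ dQ]] := euler_push R ws ah as_.
  have IN : is_sub I (N i) by exists b.
  have eI : euler I theta = 0.
    apply/eqP; rewrite eq_le ((FbarP _ _).1 (@N_Fbar i)) //=.
    by have := (TbarP _ _).1 S_Tbar Q HQ; rewrite eQ eX add0r.
  have [I0|IN0] := pselect (mzero I).
    by rewrite -abE (mzero_lfun b I0) comp_lfun0l.
  have [j' j'i /hdim_gt0P[g gh]] := N_other IN IN0 eI; case.
  apply: (comp_epi_eq0 as_); apply: ((hdim_eq0P _ _).1 (L0 j' j'i)).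
  exact: homs_comp ah gh.
have [psi psih psiE] := lift_of_hdim ws Li ph.
have hex : forall k, exists h : 'Hom(H (j k), H i),
    h \in homs (H (j k)) (H i) /\ (p \o h)%VF = (s \o inc k)%VF.
  move=> k; have [h hh hE] := lift_of_hdim up (t0 (j k)) (homs_comp (inch k) sh).
  by exists h.
pose h k := sval (cid (hex k)); pose hP k := svalP (cid (hex k)).
have [d' nil] := @H_radical i n j (fun k => prj k \o psi)%VF h ji
  (fun k => homs_comp psih (prjh k)) (fun k => (hP k).1).
apply: XN0; apply: (epi_mzero ps); apply/lfunP=> v; rewrite lfunE.
rewrite -[RHS](linear0 p) -(nil v) {nil}; elim: d' => //= d' ->.
set x := iter _ _ _; rewrite linear_sum -[in LHS]psiE comp_lfunE [psi x in LHS]sumE linear_sum.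
by apply: eq_bigr => k _ /=; rewrite -[LHS]comp_lfunE -(hP k).2 !comp_lfunE.
Qed.

(** The dual argument, with submodules of N i, left approximations and
    extensions of maps in the place of quotients of H i, right approximations
    and lifts. *)
Lemma N_Fopen : Fopen theta (N i).
Proof.
apply/FopenP=> X0 HX0 X0N0; rewrite lt_neqAle ((FbarP _ _).1 (@N_Fbar i)) // andbT.
apply/eqP => eX0.
have [d [[X [[p ph ps] eX Xd]] dmax]] : exists d,
    (exists X, [/\ is_sub X (N i), euler X theta = 0 & \dim {: X} = d]) /\
    forall k, (exists X, [/\ is_sub X (N i), euler X theta = 0 & \dim {: X} = k])
      -> (k <= d)%N.
  apply: (@max_nat _ (\dim {: N i})) => [k [X [HX _ <-]]|].
    exact: sub_dim.
  by exists (\dim {: X0}), X0.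
have XN0 : ~ mzero X.
  move=> X00; apply: X0N0; apply/eqP; rewrite -leqn0 -X00 Xd.
  by apply: dmax; exists X0.
have [t [u up]] := epi_mono_exact ph ps.
have t0 j : hdim (H j) t = 0%N.
  apply/hdim_eq0P=> f fh; have [I [a [b [ah bh as_ b0 abE]]]] := image_factor fh.
  have [Q [HQ eQ dQ]] := euler_pull R up bh b0.
  have eI : euler Q theta = 0.
    apply/eqP; rewrite eq_le ((FbarP _ _).1 (@N_Fbar i)) //= eQ eX add0r.
    by apply: ((TbarP _ _).1 (@H_Tbar j)); exists a.
  have : (\dim {: Q} <= d)%N by apply: dmax; exists Q.
  rewrite dQ Xd -[leqRHS]addn0 leq_add2l leqn0 => /eqP I0.
  by rewrite -abE (mzero_lfun b I0) comp_lfun0l.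
have [n [j [S [inc [prj [s [ji [inch prjh sumE sh] sapp]]]]]]] := left_approx i X.
have S_Fbar : Fbar theta S.
  exact: (Fbar_cospan prjh (fun k => @N_Fbar (j k)) (sum_jointly_mono sumE)).
have S0 j' : hdim (H j') S = 0%N.
  apply/hdim_eq0P=> f fh; apply: (sum_jointly_mono sumE fh) => k.
  exact/homs_HN/homs_comp/prjh.
have s0 : lker s = 0%VS.
  have [T [a [b [ah bh as_ b0 abE]]]] := image_factor sh.
  have [Q [q qa]] := mono_epi_exact ah as_.
  have T0 j' : hdim (H j') T = 0%N.
    apply/hdim_eq0P=> f fh; apply: (comp_mono_eq0 b0).
    by apply: (hdim_eq0P _ _).1; [exact: S0 | exact: homs_comp bh].
  have [qh q0] : q \in homs Q X /\ lker q = 0%VS by case: qa.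
  have HQ : is_sub Q (N i).
    by apply: is_sub_trans (exact_sub qa) _; exists p.
  have eQ : euler Q theta = 0.
    have eT : euler T theta <= 0 by apply: ((FbarP _ _).1 S_Fbar); exists b.
    have eQ : euler Q theta <= 0 by apply: ((FbarP _ _).1 (@N_Fbar i)).
    by have := euler_exact theta qa; rewrite eX; lra.
  have [Q0|QN0] := pselect (mzero Q).
    have : limg q = 0%VS by rewrite (mzero_lfun q Q0) lim0g.
    case: qa => _ _ _ -> _ ak; rewrite -abE.
    by apply: mono_comp.
  have [j' j'i /hdim_gt0P[f fh]] := N_other HQ QN0 eQ; case.
  have [f' f'h <-] := extend_of_hdim qa (T0 j') fh.
  have [g gh <-] := sapp j' j'i f' f'h.
  apply/lfunP=> v; rewrite -abE !comp_lfunE lfunE.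
  have : q v \in lker a by case: qa => _ _ _ <- _; rewrite memv_img ?memvf.
  by rewrite memv_ker => /eqP->; rewrite !linear0.
have [L [w ws]] := epi_mono_exact sh s0.
have L0 j' : j' != i -> hdim (H j') L = 0%N.
  by move=> j'i; apply: (cokernel_hdim ws (S0 j')) (sapp j' j'i).
have Li : hdim (H i) L = 0%N.
  apply/hdim_eq0P=> f fh; have [I [a [b [ah bh as_ b0 abE]]]] := image_factor fh.
  have [Q [HQ eQ dQ]] := euler_pull R ws bh b0.
  have IN : is_quotient (H i) I by exists a.
  have eI : euler I theta = 0.
    apply/eqP; rewrite eq_le ((TbarP _ _).1 (@H_Tbar i)) // andbT.
    by have := (FbarP _ _).1 S_Fbar Q HQ; rewrite eQ eX add0r.
  have [I0|IN0] := pselect (mzero I).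
    by rewrite -abE (mzero_lfun b I0) comp_lfun0l.
  have [j' j'i /hdim_gt0P[g gh]] := H_other IN IN0 eI; case.
  apply: (comp_mono_eq0 b0); apply: ((hdim_eq0P _ _).1 (L0 j' j'i)).
  exact: homs_comp gh bh.
have [psi psih psiE] := extend_of_hdim ws Li ph.
have gex : forall k, exists g : 'Hom(N i, N (j k)),
    g \in homs (N i) (N (j k)) /\ (g \o p)%VF = (prj k \o s)%VF.
  move=> k; have [g gh gE] := extend_of_hdim up (t0 (j k)) (homs_comp sh (prjh k)).
  by exists g.
pose g k := sval (cid (gex k)); pose gP k := svalP (cid (gex k)).
have [d' nil] := @N_radical i n j g (fun k => psi \o inc k)%VF ji
  (fun k => (gP k).1) (fun k => homs_comp (inch k) psih).
apply: XN0; apply: (mono_mzero ps); apply/lfunP=> v; rewrite zero_lfunE.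
rewrite -(nil (p v)) {nil}; elim: d' => //= d' <-.
rewrite -[in LHS]psiE comp_lfunE [s v in LHS]sumE linear_sum.
by apply: eq_bigr => k _; rewrite /= -[g k _]comp_lfunE (gP k).2 !comp_lfunE.
Qed.

End WallStep.

Lemma quotient_H_hdim i j X : is_quotient (H j) X -> hdim X (N i) = 0%N.
Proof.
move=> [p ph ps]; apply/hdim_eq0P=> f fh; apply: (comp_epi_eq0 ps).
exact/homs_HN/homs_comp/fh.
Qed.

Lemma sub_N_hdim i j Y : is_sub Y (N j) -> hdim (H i) Y = 0%N.
Proof.
move=> [p ph ps]; apply/hdim_eq0P=> f fh; apply: (comp_mono_eq0 ps).
exact/homs_HN/homs_comp/ph.
Qed.

Lemma euler_quotient_H i j X : is_quotient (H j) X -> euler X (c i) = (hdim (H i) X)%:R.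
Proof. by move=> HX; rewrite eulerc (quotient_H_hdim _ HX) subr0. Qed.

Lemma euler_sub_N i j Y : is_sub Y (N j) -> euler Y (c i) = - (hdim Y (N i))%:R.
Proof. by move=> NY; rewrite eulerc (sub_N_hdim _ NY) sub0r. Qed.

Definition wall_cone : set (K0 R A) :=
  [set theta | forall i, Tbar theta (H i) /\ Fbar theta (N i)].

Definition open_cone i : set (K0 R A) :=
  [set theta | Topen theta (H i) /\ Fopen theta (N i)].

(** Let theta' be theta plus the sum of the b j c j. A nonzero quotient X of
    H i with theta = 0 has theta' > 0, so some c j, necessarily with j distinct
    from i, is positive on X, that is, Hom(H j, X) is nonzero. The same holds for
    submodules of N i, and the two preceding lemmas apply. *)
Lemma wall_step i theta (b : 'I_m -> R) :
  wall_cone theta -> (forall j, 0 <= b j) -> b i = 0 ->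
  open_cone i (theta + \sum_j b j *: c j) -> open_cone i theta.
Proof.
move=> Dt b0 bi [/TopenP HT /FopenP NF].
have HTb j : Tbar theta (H j) by case: (Dt j).
have NFb j : Fbar theta (N j) by case: (Dt j).
have H_other X : is_quotient (H i) X -> ~ mzero X -> euler X theta = 0 ->
    exists2 j, j != i & (0 < hdim (H j) X)%N.
  move=> HX X0 eX; have := HT X HX X0; rewrite linearD /= eX add0r linear_sum /=.
  apply: contraPP => nj; apply/negP; rewrite -leNgt big1 // => j _.
  rewrite linearZ /= (euler_quotient_H j HX).
  have [->|ji] := eqVneq j i; first by rewrite bi mul0r.
  have [->|jX] := posnP (hdim (H j) X); first by rewrite mulr0.
  by case: nj; exists j.
have N_other Y : is_sub Y (N i) -> ~ mzero Y -> euler Y theta = 0 ->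
    exists2 j, j != i & (0 < hdim Y (N j))%N.
  move=> NY Y0 eY; have := NF Y NY Y0; rewrite linearD /= eY add0r linear_sum /=.
  apply: contraPP => nj; apply/negP; rewrite -leNgt big1 // => j _.
  rewrite linearZ /= (euler_sub_N j NY).
  have [->|ji] := eqVneq j i; first by rewrite bi mul0r.
  have [->|jY] := posnP (hdim Y (N j)); first by rewrite oppr0 mulr0.
  by case: nj; exists j.
split; [exact: (H_Topen HTb NFb H_other N_other) |
        exact: (N_Fopen HTb NFb H_other N_other)].
Qed.

Definition is_wall (l : {scalar (K0 R A)}) : Prop :=
  (exists j X, is_quotient (H j) X /\ l =1 euler X) \/
  (exists j Y, is_sub Y (N j) /\ forall theta, l theta = - euler Y theta).

Lemma finite_range (T : eqType) (B : set T) : finite_set B ->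
  exists n (f : 'I_n -> T), (forall k, B (f k)) /\ forall x, B x -> exists k, f k = x.
Proof.
move=> /finite_seqP[s ->]; exists (size s), (tnth (in_tuple s)).
split=> [k|x /= /(tnthP (in_tuple s))[k ->]]; first exact: mem_tnth.
by exists k.
Qed.

Let opp_euler_scalar Y : scalar (fun t : K0 R A => - euler Y t).
Proof. by move=> k x y; rewrite linearP opprD mulrN. Qed.

Lemma finite_walls : exists r (l : 'I_r -> {scalar (K0 R A)}),
  [/\ forall q, is_wall (l q),
      forall j X, is_quotient (H j) X -> exists q, l q =1 euler X
    & forall j Y, is_sub Y (N j) -> exists q, forall theta, l q theta = - euler Y theta].
Proof.
pose BH := \bigcup_j [set e : K0 R A -> R | exists2 X, is_quotient (H j) X & e = euler X].
pose BN := \bigcup_j [set e : K0 R A -> R | exists2 Y, is_sub Y (N j)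
  & e = fun theta => - euler Y theta].
have fin : finite_set (BH `|` BN).
  rewrite finite_setU; split; apply: bigcup_finite => // j _.
    exact: euler_quotients_finite.
  apply: sub_finite_set (finite_image (fun e t => - e t) (euler_subs_finite R (N j))).
  by move=> _ [Y NY ->]; exists (euler Y) => //; exists Y.
have [n [f [fB fS]]] := finite_range fin.
have /choice[l lP] : forall k, exists l : {scalar (K0 R A)}, is_wall l /\ l =1 f k.
  move=> k; case: (fB k) => [[j _ [X HX ->]]|[j _ [Y NY ->]]].
    by exists (euler X); split=> //; left; exists j, X.
  pose lE : {scalar (K0 R A)} := HB.pack (fun t => - euler Y t)
    (GRing.isLinear.Build R (K0 R A) R _ _ (opp_euler_scalar Y)).
  by exists lE; split=> //; right; exists j, Y.
exists n, l; split=> [q|j X HX|j Y NY]; first by case: (lP q).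
  have [k fk] : exists k, f k = euler X by apply: fS; left; exists j => //; exists X.
  by exists k => t; rewrite (lP k).2 fk.
have [k fk] : exists k, f k = fun t => - euler Y t.
  by apply: fS; right; exists j => //; exists Y.
by exists k => t; rewrite (lP k).2 fk.
Qed.

Lemma wall_ge0 l i : is_wall l -> 0 <= l (c i).
Proof.
move=> [[j [X [HX ->]]]|[j [Y [NY ->]]]].
  by rewrite (euler_quotient_H i HX) ler0n.
by rewrite (euler_sub_N i NY) opprK ler0n.
Qed.

Lemma hdim_self_gt0 X : ~ mzero X -> (0 < hdim X X)%N.
Proof.
move=> X0; apply/hdim_gt0P; exists \1%VF; first exact: homs_id.
by move=> /id_lfun_eq0.
Qed.

(** If X is a quotient of H j and Hom(H i, X) is nonzero, X is an extension of a
    quotient of H j by a nonzero quotient of H i, and theta is positive on the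
    latter. The other case is dual. *)
Lemma open_wall_gt0 i theta l : wall_cone theta -> open_cone i theta ->
  is_wall l -> 0 < l (c i) -> 0 < l theta.
Proof.
move=> Dt [/TopenP HT /FopenP NF] [[j [X [HX lE]]]|[j [Y [NY lE]]]]; rewrite !lE.
  rewrite (euler_quotient_H i HX) ltr0n => /hdim_gt0P[f fh f0].
  have [I [a [b [ah bh as_ b0 abE]]]] := image_factor fh.
  have [Q [q bq]] := epi_mono_exact bh b0; rewrite (euler_exact _ bq).
  apply: ltr_wpDr.
    apply: ((TbarP _ _).1 (Dt j).1); apply: is_quotient_trans HX _.
    exact: exact_quotient bq.
  apply: HT; first by exists a.
  by move=> I0; apply: f0; rewrite -abE (mzero_lfun b I0) comp_lfun0l.
rewrite (euler_sub_N i NY) opprK ltr0n oppr_gt0 => /hdim_gt0P[f fh f0].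
have [I [a [b [ah bh as_ b0 abE]]]] := image_factor fh.
have [Q [q qa]] := mono_epi_exact ah as_; rewrite (euler_exact _ qa) addrC.
rewrite -[ltRHS]addr0; apply: ltr_leD.
  apply: NF; first by exists b.
  by move=> I0; apply: f0; rewrite -abE (mzero_lfun b I0) comp_lfun0l.
apply: ((FbarP _ _).1 (Dt j).2); apply: is_sub_trans NY.
exact: exact_sub qa.
Qed.

(** The walls are the Euler forms of the quotients of the H j and the opposites
    of those of the submodules of the N j; there are finitely many. They turn
    the module-theoretic wall_step into the hypothesis of link_decomposition. *)
Theorem core_decomposition :
  link_decomposes (orthant c) wall_cone (wall_cone `\` \bigcup_i open_cone i).
Proof.
have [r [l [lW lH lN]]] := finite_walls.
(* D(U) is a finite intersection of half-spaces. *)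
have DE : wall_cone = halfspaces l.
  apply/seteqP; split=> theta.
    move=> Dt q; case: (lW q) => [[j [X [HX ->]]]|[j [Y [NY ->]]]].
      exact: (TbarP _ _).1 (Dt j).1 X HX.
    by rewrite oppr_ge0; apply: (FbarP _ _).1 (Dt j).2 Y NY.
  move=> lt i; split.
    by apply/TbarP=> X /lH[q <-]; apply: lt.
  by apply/FbarP=> Y /lN[q qE]; rewrite -oppr_ge0 -qE; apply: lt.
have lc_gt0 i : exists q, 0 < l q (c i).
  case: (HN_nonzero i) => [H0|N0].
    have [q qE] := lH i _ (is_quotient_refl _); exists q.
    by rewrite qE (euler_quotient_H i (is_quotient_refl _)) ltr0n hdim_self_gt0.
  have [q qE] := lN i _ (is_sub_refl _); exists q.
  by rewrite qE (euler_sub_N i (is_sub_refl _)) opprK ltr0n hdim_self_gt0.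
have DoP i v : halfspaces l v ->
    open_cone i v <-> (forall q, 0 < l q (c i) -> 0 < l q v).
  rewrite -DE => Dv; split=> [Dov q qi|lv]; first exact: open_wall_gt0 (lW q) qi.
  split.
    apply/TopenP=> X HX X0; have [q qE] := lH i X HX; rewrite -qE; apply: lv.
    rewrite qE (euler_quotient_H i HX) ltr0n; apply/hdim_gt0P.
    by case: HX => p ph ps; exists p => // p0; apply/X0/(epi_mzero ps).
  apply/FopenP=> X HX X0; have [q qE] := lN i X HX; rewrite -oppr_gt0 -qE; apply: lv.
  rewrite qE (euler_sub_N i HX) opprK ltr0n; apply/hdim_gt0P.
  by case: HX => p ph ps; exists p => // p0; apply/X0/(mono_mzero ps).
have lc_ge0 q i : 0 <= l q (c i) by apply: wall_ge0.
have wall i v (b : 'I_m -> R) : halfspaces l v -> (forall j, 0 <= b j) -> b i = 0 ->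
  (forall q, 0 < l q (c i) -> 0 < l q (v + \sum_j b j *: c j)) ->
  forall q, 0 < l q (c i) -> 0 < l q v.
  move=> Dv b0 bi lb; apply/DoP => //; apply: (wall_step _ b0 bi); first by rewrite DE.
  by apply/DoP => //; apply: halfspacesD.
have := link_decomposition lc_ge0 lc_gt0 wall DoP.
by rewrite -DE.
Qed.

End Core.

(** * Nakayama duality *)

Section Nakayama.
Variables (K : fieldType) (A : falgType K).
Implicit Types (M N P Q X Y : rmod A).
Local Notation reg := (@regm K A).

Lemma regE a (r : reg) : ract reg a r = (r : A) * a.
Proof. by rewrite /= /amulr lfunE. Qed.

Lemma amullE a (r : reg) : (amull a : 'End(reg)) r = a * (r : A).
Proof. by rewrite /amull lfunE. Qed.

Lemma amull_hom a : (amull a : 'End(reg)) \in homs reg reg.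
Proof. exact: amull_homs. Qed.

(** The A-linear map from A to X with value x at 1. *)
Definition act_map X (x : X) : 'Hom(reg, X) := linfun (fun r : reg => ract X (r : A) x).

Lemma act_mapE X (x : X) r : act_map x r = ract X (r : A) x.
Proof.
rewrite /act_map linfun_linearE // => k a b.
by rewrite linearP /= add_lfunE scale_lfunE.
Qed.

Lemma act_map_homs X (x : X) : act_map x \in homs reg X.
Proof. by apply/homsP=> a r; rewrite !act_mapE regE ractM comp_lfunE. Qed.

(** The data that exhibit P as a direct summand of a free module of rank n. *)
Definition dual_basis P n (p : 'I_n -> P) (a : 'I_n -> 'Hom(P, reg)) : Prop :=
  (forall k, a k \in homs P reg) /\ forall v, v = \sum_k ract P (a k v : A) (p k).

Lemma exists_dual_basis P : projective P ->
  exists n (p : 'I_n -> P) (a : 'I_n -> 'Hom(P, reg)), dual_basis p a.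
Proof.
move=> prP; pose e := vbasis {: P}.
have [F [inc [prj [inch prjh sumE univ _]]]] := direct_sum (fun _ : 'I_(\dim {: P}) => reg).
have [s sh sE] := univ P (fun k => act_map e`_k) (fun k => act_map_homs _).
have ss : limg s = fullv.
  apply/eqP; rewrite eqEsubv subvf; apply/subvP=> v _.
  rewrite (coord_vbasis (memvf v)); apply: memv_suml => k _; apply: memvZ.
  have -> : (vbasis {: P})`_k = s (inc k (1 : A)).
    by rewrite -comp_lfunE sE act_mapE ract1 id_lfunE.
  by rewrite memv_img ?memvf.
have [h hh hE] := prP F P s \1%VF sh ss (homs_id P).
exists (\dim {: P}), (fun k => e`_k), (fun k => prj k \o h)%VF; split.
  by move=> k; apply: homs_comp hh (prjh k).
move=> v; rewrite -[LHS]id_lfunE -hE comp_lfunE [h v]sumE linear_sum /=.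
by apply: eq_bigr => k _; rewrite -[LHS]comp_lfunE sE act_mapE comp_lfunE.
Qed.

Lemma dual_basis_expand P n (p : 'I_n -> P) (a : 'I_n -> 'Hom(P, reg)) X (f : 'Hom(P, X)) :
  dual_basis p a -> f \in homs P X -> f = \sum_k (act_map (f (p k)) \o a k)%VF.
Proof.
move=> [ah aE] fh; apply/lfunP=> v; rewrite [v in LHS]aE linear_sum sum_lfunE.
by apply: eq_bigr => k _; rewrite comp_lfunE act_mapE; apply: homsE.
Qed.

Lemma act_map_reg (r : reg) : act_map r = amull (r : A).
Proof. by apply/lfunP=> s; rewrite act_mapE amullE regE. Qed.

(** Elements of nu P are linear forms on the subspace Hom_A(P, A) of Hom_K(P, A).
    They are extended to the whole space through a projection, and only the
    values on Hom_A(P, A) are meaningful. *)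
Definition nuval P (phi : nu P) (f : 'Hom(P, reg)) : K :=
  (phi : 'Hom(subvs_of (homs P reg), K^o)) (vsproj (homs P reg) f).

Lemma nuval_scalar P (phi : nu P) : scalar (nuval phi).
Proof. by move=> k x y; rewrite /nuval !linearP. Qed.
HB.instance Definition _ P (phi : nu P) :=
  GRing.isLinear.Build K 'Hom(P, reg) K *%R (nuval phi) (nuval_scalar phi).

Lemma nuvalP P k (phi psi : nu P) f :
  nuval (k *: phi + psi) f = k * nuval phi f + nuval psi f.
Proof.
by rewrite /nuval (@add_lfunE _ (subvs_of (homs P reg)) K^o) (@scale_lfunE _ (subvs_of (homs P
  reg)) K^o).
Qed.

Lemma nuval0 P f : nuval (0 : nu P) f = 0.
Proof. by rewrite /nuval (@zero_lfunE _ (subvs_of (homs P reg)) K^o). Qed.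

Lemma nuval_ext P (phi psi : nu P) :
  (forall f, f \in homs P reg -> nuval phi f = nuval psi f) -> phi = psi.
Proof.
move=> e; apply/(@lfunP _ (subvs_of (homs P reg)) K^o) => u.
by have := e (vsval u) (subvsP u); rewrite /nuval vsvalK.
Qed.

Lemma nuval_act P b (phi : nu P) f : f \in homs P reg ->
  nuval (ract (nu P) b phi) f = nuval phi ((amull b : 'End(reg)) \o f)%VF.
Proof.
move=> fh; rewrite /nuval /= nu_actE comp_lfunE; congr (_ _).
by apply: val_inj; rewrite /= lactE !vsprojK ?(homs_comp fh (amull_hom b)).
Qed.

Lemma nuval_nuf P Q (d : 'Hom(P, Q)) (phi : nu P) f :
  d \in homs P Q -> f \in homs Q reg -> nuval (nuf d phi) f = nuval phi (f \o d)%VF.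
Proof.
move=> dh fh; rewrite /nuval nufE comp_lfunE; congr (_ _).
by apply: val_inj; rewrite /= precompE // !vsprojK ?(homs_comp dh fh).
Qed.

Definition mknu P (F : 'Hom(P, reg) -> K) : nu P :=
  (linfun (fun u : subvs_of (homs P reg) => F (vsval u) : K^o)
    : 'Hom(subvs_of (homs P reg), K^o)).

Lemma mknuE P (F : 'Hom(P, reg) -> K) f :
  scalar F -> f \in homs P reg -> nuval (mknu F) f = F f.
Proof.
move=> Fl fh; rewrite /nuval /mknu linfun_linearE ?vsprojK // => k x y.
by rewrite /= Fl.
Qed.

Section Pairing.
Variables (P : rmod A) (n : nat) (p : 'I_n -> P) (a : 'I_n -> 'Hom(P, reg)).
Hypothesis pa : dual_basis p a.

(** The duality between Hom_A(X, nu P) and Hom_A(P, X). For P = A with the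
    dual basis p = 1, a = id it is g, f |-> g(f(1))(id). *)
Definition pairing X (g : 'Hom(X, nu P)) (f : 'Hom(P, X)) : K :=
  \sum_k nuval (g (f (p k))) (a k).

Lemma pairing_scalar X (g : 'Hom(X, nu P)) : scalar (pairing g).
Proof.
move=> k f f'; rewrite /pairing mulr_sumr -big_split /=; apply: eq_bigr => j _.
by rewrite add_lfunE scale_lfunE linearP nuvalP.
Qed.

Lemma pairingDl X k (g g' : 'Hom(X, nu P)) f :
  pairing (k *: g + g') f = k * pairing g f + pairing g' f.
Proof.
rewrite /pairing mulr_sumr -big_split /=; apply: eq_bigr => j _.
by rewrite add_lfunE scale_lfunE nuvalP.
Qed.

(** Hom_A(P, X) is spanned by the maps v |-> x b(v), and on these the pairing
    does not depend on the dual basis. *)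
Lemma pairing_act X (g : 'Hom(X, nu P)) x b :
  g \in homs X (nu P) -> b \in homs P reg ->
  pairing g (act_map x \o b)%VF = nuval (g x) b.
Proof.
move=> gh bh; rewrite [b in RHS](dual_basis_expand pa bh) linear_sum.
apply: eq_bigr => k _; rewrite comp_lfunE act_mapE (homsE _ _ gh).
by rewrite nuval_act ?act_map_reg //; case: pa.
Qed.

Lemma pairing_ext X (g : 'Hom(X, nu P)) : g \in homs X (nu P) ->
  (forall f, f \in homs P X -> pairing g f = 0) -> g = 0.
Proof.
move=> gh g0; apply/lfunP=> x; rewrite zero_lfunE; apply: nuval_ext => b bh.
by rewrite nuval0 -(pairing_act x gh bh) g0 // homs_comp ?act_map_homs.
Qed.

Lemma act_mapD X k (x y : X) : act_map (k *: x + y) = k *: act_map x + act_map y.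
Proof.
by apply/lfunP=> r; rewrite add_lfunE scale_lfunE !act_mapE linearP.
Qed.

Definition pairing_inv X (xi : 'Hom(P, X) -> K) : 'Hom(X, nu P) :=
  linfun (fun x => mknu (fun b => xi (act_map x \o b)%VF)).

Section Inverse.
Variables (X : rmod A) (xi : 'Hom(P, X) -> K).
Hypothesis xil : scalar xi.

Lemma pairing_invE x b : b \in homs P reg ->
  nuval (pairing_inv xi x) b = xi (act_map x \o b)%VF.
Proof.
have lin x' : scalar (fun b => xi (act_map x' \o b)%VF).
  by move=> k u v; rewrite comp_lfunDr -comp_lfunZr xil.
move=> bh; rewrite /pairing_inv linfun_linearE ?mknuE // => k y z.
apply: nuval_ext => f fh; rewrite nuvalP !mknuE //.
by rewrite act_mapD comp_lfunDl -comp_lfunZl xil.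
Qed.

Lemma pairing_inv_homs : pairing_inv xi \in homs X (nu P).
Proof.
apply/homsP=> c x; apply: nuval_ext => b bh.
rewrite nuval_act // !pairing_invE // ?homs_comp ?amull_hom //.
congr (xi _); apply/lfunP=> v; rewrite !comp_lfunE !act_mapE amullE.
by rewrite ractM comp_lfunE.
Qed.

Lemma pairing_invK f : f \in homs P X -> pairing (pairing_inv xi) f = xi f.
Proof.
move=> fh; have xi0 : xi 0 = 0.
  by have := xil 1 0 0; rewrite scaler0 addr0 mul1r -[LHS]addr0 => /addrI.
have xiD u v : xi (u + v) = xi u + xi v by have := xil 1 u v; rewrite scale1r mul1r.
rewrite [in RHS](dual_basis_expand pa fh) (big_morph xi xiD xi0).
by apply: eq_bigr => k _; rewrite pairing_invE //; case: pa.
Qed.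

End Inverse.

End Pairing.

(** Under the pairing, extending g along i means extending a linear form from
    Hom(P, X) to Hom(P, Y), so any linear retraction of i will do. *)
Lemma nu_injective P X Y (i : 'Hom(X, Y)) (g : 'Hom(X, nu P)) :
  projective P -> i \in homs X Y -> lker i = 0%VS -> g \in homs X (nu P) ->
  exists2 g' : 'Hom(Y, nu P), g' \in homs Y (nu P) & (g' \o i)%VF = g.
Proof.
move=> prP ih i0 gh; have [n [p [a pa]]] := exists_dual_basis prP.
pose xi (F : 'Hom(P, Y)) := pairing p a g (i^-1 \o F)%VF.
have xil : scalar xi.
  move=> k u v; rewrite /xi comp_lfunDr -comp_lfunZr.
  exact: pairing_scalar.
exists (pairing_inv xi); first exact: pairing_inv_homs.
apply/lfunP=> x; apply: nuval_ext => b bh.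
rewrite comp_lfunE (pairing_invE xil) // /xi -(pairing_act pa x gh bh).
congr (pairing p a g _); apply/lfunP=> v; rewrite !comp_lfunE !act_mapE.
by rewrite -(homsE _ _ ih) (lker0_lfunK (introT eqP i0)).
Qed.

Lemma bidual (V : vectType K) (F : 'Hom(V, K^o) -> K) :
  scalar F -> exists v, forall m, F m = m v.
Proof.
move=> Fl; pose e := vbasis {: V}.
have F0 : F 0 = 0.
  by have := Fl 1 0 0; rewrite scaler0 addr0 mul1r -[LHS]addr0 => /addrI.
have FD u v : F (u + v) = F u + F v by have := Fl 1 u v; rewrite scale1r mul1r.
pose c k : 'Hom(V, K^o) := linfun (fun v => coord e k v : K^o).
have cE k v : c k v = coord e k v.
  by rewrite linfun_linearE // => t x y; rewrite linearP.
exists (\sum_(k < \dim {: V}) F (c k) *: e`_k) => m.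
have {1}-> : m = \sum_(k < \dim {: V}) (m e`_k : K) *: c k.
  apply/lfunP=> v; rewrite sum_lfunE [v in LHS](coord_vbasis (memvf v)) linear_sum.
  by apply: eq_bigr => k _; rewrite linearZ scale_lfunE cE; apply: mulrC.
rewrite (big_morph F FD F0) linear_sum; apply: eq_bigr => k _.
by have := Fl (m e`_k) (c k) 0; rewrite !addr0 F0 addr0 => ->; rewrite linearZ mulrC.
Qed.

(** For a in Hom_A(Q, A) the form m |-> g(m)(a) on the dual of Hom_A(P, A) is
    evaluation at some t in Hom_A(P, A), and a |-> t must be a |-> a f. Only the
    members of a dual basis of Q are needed to recover f. *)
Lemma nu_full P Q (g : 'Hom(nu P, nu Q)) : projective Q ->
  g \in homs (nu P) (nu Q) -> exists2 f : 'Hom(P, Q), f \in homs P Q & nuf f = g.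
Proof.
move=> prQ gh; have [n [q [a qa]]] := exists_dual_basis prQ.
have /choice[t tP] : forall k, exists t : 'Hom(P, reg),
    t \in homs P reg /\ forall m, nuval (g m) (a k) = nuval m t.
  move=> k; have [|v vE] := @bidual (subvs_of (homs P reg))
    (fun m => nuval (g (m : nu P)) (a k)).
    by move=> c u v; rewrite linearP nuvalP.
  exists (vsval v); split; first exact: subvsP.
  by move=> m; rewrite (vE m) /nuval vsvalK.
(* The map a |-> t is A-linear, so it suffices to prescribe it on the a k. *)
pose f : 'Hom(P, Q) := \sum_k (act_map (q k) \o t k)%VF.
have fh : f \in homs P Q.
  by apply: memv_suml => k _; apply: homs_comp (act_map_homs _); case: (tP k).
exists f => //; apply/lfunP=> m; apply: nuval_ext => b bh.
rewrite (nuval_nuf _ fh bh) [b in RHS](dual_basis_expand qa bh) linear_sum /=.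
have -> : (b \o f)%VF = \sum_k ((amull (b (q k) : A) : 'End(reg)) \o t k)%VF.
  apply/lfunP=> v; rewrite comp_lfunE !sum_lfunE linear_sum; apply: eq_bigr => k _.
  by rewrite !comp_lfunE act_mapE amullE /= (homsE _ _ bh) regE.
rewrite linear_sum; apply: eq_bigr => k _ /=; have [th tE] := tP k.
by rewrite -nuval_act // -tE (homsE _ _ gh) nuval_act ?act_map_reg //; case: qa.
Qed.

Lemma nu_faithful P Q (f : 'Hom(P, Q)) : projective Q ->
  f \in homs P Q -> nuf f = 0 -> f = 0.
Proof.
move=> prQ fh f0; have [n [q [a [ah aE]]]] := exists_dual_basis prQ.
have af0 k : (a k \o f)%VF = 0.
  have afh := homs_comp fh (ah k); pose V := homs P reg.
  have coord0 j : coord (vbasis V) j (a k \o f)%VF = 0.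
    pose m : nu P := mknu (coord (vbasis V) j).
    rewrite -(@mknuE P _ _ _ afh); last by move=> c x y; rewrite linearP.
    by rewrite -nuval_nuf // f0 zero_lfunE nuval0.
  by rewrite (coord_vbasis afh) big1 // => j _; rewrite coord0 scale0r.
apply/lfunP=> v; rewrite [f v]aE zero_lfunE big1 // => k _.
by rewrite -comp_lfunE af0 zero_lfunE linear0 zero_lfunE.
Qed.

Lemma dim_dual (V : vectType K) : \dim {: 'Hom(V, K^o)} = \dim {: V}.
Proof. by rewrite !dimvf /dim /= muln1. Qed.

(** Maps X -> N are maps X -> nu P killed by nu d, that is, by the pairing,
    linear forms on Hom(P, X) that vanish on the multiples of d. This is the
    Auslander-Reiten formula dim Hom(X, N) = dim Hom(U, X[1]) for the complex U
    given by d. *)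
Lemma hdim_nu_kernel P Q (d : 'Hom(P, Q)) X (N : rmod A) (i : 'Hom(N, nu P)) :
  projective P -> projective Q -> d \in homs P Q -> i \in homs N (nu P) ->
  lker i = 0%VS -> limg i = lker (nuf d) ->
  (hdim X N + \dim (precompl X d @: homs Q X))%N = hdim P X.
Proof.
move=> prP prQ dh ih i0 iI; have [n [p [a pa]]] := exists_dual_basis prP.
have [n' [q [b qb]]] := exists_dual_basis prQ.
set B := (_ @: _)%VS; pose C := homs P X; pose V := (C :\: B)%VS.
have BC : (B <= C)%VS.
  by apply/subvP=> _ /memv_imgP[f fh ->]; rewrite precomplE (homs_comp dh fh).
have -> : hdim P X = (\dim V + \dim B)%N.
  rewrite /hdim -/C -(dimv_cap_compl C B) addnC; congr (_ + \dim _)%N.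
  exact/capv_idPr.
congr (_ + _)%N.
have pairB (g : 'Hom(X, N)) f : g \in homs X N -> f \in B -> pairing p a (i \o g)%VF f = 0.
  move=> gh /memv_imgP[f' f'h ->]; rewrite precomplE.
  have igh := homs_comp gh ih.
  have pl := pairing_scalar p a (i \o g)%VF.
  pose pr : {scalar 'Hom(P, X)} := HB.pack (pairing p a (i \o g)%VF)
    (GRing.isLinear.Build K 'Hom(P, X) K _ _ pl).
  have -> : (f' \o d)%VF = \sum_k (act_map (f' (q k)) \o (b k \o d))%VF.
    apply/lfunP=> v; rewrite comp_lfunE [f' in LHS](dual_basis_expand qb f'h) !sum_lfunE.
    by apply: eq_bigr => k _; rewrite !comp_lfunE.
  rewrite -[LHS]/(pr _) linear_sum big1 // => k _ /=.
  have bh : b k \in homs Q reg by case: qb.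
  rewrite (pairing_act pa _ igh (homs_comp dh bh)) -nuval_nuf // comp_lfunE.
  have : i (g (f' (q k))) \in lker (nuf d) by rewrite -iI memv_img ?memvf.
  by rewrite memv_ker => /eqP->; rewrite nuval0.
pose Phi : 'Hom('Hom(X, N), 'Hom(subvs_of V, K^o)) :=
  linfun (fun g : 'Hom(X, N) => linfun (fun f : subvs_of V =>
    pairing p a (i \o g)%VF (vsval f) : K^o)).
have PhiE g f : Phi g f = pairing p a (i \o g)%VF (vsval f).
  have lin (h : 'Hom(X, N)) : linear (fun f : subvs_of V => pairing p a (i \o h)%VF (vsval f) :
    K^o).
    by move=> k x y; rewrite linearP pairing_scalar.
  rewrite /Phi linfun_linearE ?linfun_linearE //.
  move=> k x y; apply/lfunP=> v; rewrite add_lfunE scale_lfunE !linfun_linearE //.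
  by rewrite comp_lfunDr -comp_lfunZr pairingDl.
have -> : \dim V = \dim {: 'Hom(subvs_of V, K^o)} by rewrite dim_dual dimvf.
rewrite -(_ : Phi @: homs X N = fullv)%VS; last first.
  apply/eqP; rewrite eqEsubv subvf; apply/subvP=> psi _.
  pose xi (f : 'Hom(P, X)) : K := psi (vsproj V (daddv_pi V B f)).
  have xil : scalar xi by move=> k x y; rewrite /xi !linearP.
  have VB0 : (V :&: B = 0)%VS by exact: capv_diff.
  have xiB f : f \in B -> xi f = 0.
    by move=> fB; rewrite /xi (daddv_pi_eq0 VB0 fB) !linear0.
  have xiV (f : subvs_of V) : xi (vsval f) = psi f.
    by rewrite /xi daddv_pi_id ?subvsP // vsvalK.
  have [g gh gE] : exists2 g : 'Hom(X, N), g \in homs X N & (i \o g)%VF = pairing_inv xi.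
    apply: factor_mono => //; first exact: pairing_inv_homs.
    rewrite iI; apply/subvP=> _ /memv_imgP[x _ ->]; rewrite memv_ker; apply/eqP.
    apply: nuval_ext => c ch; rewrite nuval_nuf // pairing_invE ?homs_comp // nuval0.
    rewrite comp_lfunA; apply: xiB; rewrite -precomplE memv_img //.
    exact: homs_comp ch (act_map_homs _).
  apply/memv_imgP; exists g => //; apply/lfunP=> f; rewrite PhiE gE.
  by rewrite (pairing_invK pa xil) ?xiV // (subvP (diffvSl C B)) // subvsP.
apply/esym/dim_image_inj => g gh g0; apply: (comp_mono_eq0 i0).
apply: (pairing_ext pa (homs_comp gh ih)) => f fC.
have : f \in (V + B)%VS by rewrite addv_diff (subvP (addvSl _ _)).
case/memv_addP=> f1 f1V [f2 f2B ->].
have := pairing_scalar p a (i \o g)%VF 1 f1 f2; rewrite scale1r mul1r => ->.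
rewrite (pairB g f2) // addr0.
by have := PhiE g (Subvs f1V); rewrite g0 zero_lfunE /= => <-.
Qed.

End Nakayama.

(** * Homotopies, cohomology and the Nakayama functor on complexes *)

Section HomotopyCalculus.
Variables (K : fieldType) (A : falgType K).
Implicit Types (X Y Z : cplx A) (M N : rmod A).

Lemma null_homotopic_ext X Y (f g : gmap X Y) :
  (forall i, f i = g i) -> null_homotopic f -> null_homotopic g.
Proof. by move=> fg [h [hh fE]]; exists h; split=> // i; rewrite -fg. Qed.

Lemma null_homotopic0 X Y : null_homotopic (fun i => 0 : 'Hom(X i, Y i)).
Proof.
exists (fun i j => 0); split=> [i j|i]; first exact: homs0.
by rewrite comp_lfun0l comp_lfun0r addr0.
Qed.

Lemma null_homotopicD X Y (f g : gmap X Y) :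
  null_homotopic f -> null_homotopic g -> null_homotopic (fun i => f i + g i).
Proof.
move=> [h [hh fE]] [k [kh gE]]; exists (fun i j => h i j + k i j).
split=> [i j|i]; first by rewrite memvD ?hh ?kh.
by rewrite fE gE comp_lfunDl comp_lfunDr addrACA.
Qed.

Lemma null_homotopicN X Y (f : gmap X Y) :
  null_homotopic f -> null_homotopic (fun i => - f i).
Proof.
move=> [h [hh fE]]; exists (fun i j => - h i j).
split=> [i j|i]; first by rewrite memvN hh.
by rewrite fE comp_lfunNl comp_lfunNr opprD.
Qed.

Lemma null_homotopic_compl X Y Z (g : gmap Y Z) (f : gmap X Y) :
  chain_map g -> null_homotopic f -> null_homotopic (compc g f).
Proof.
move=> [gh gd] [h [hh fE]]; exists (fun i j => g j \o h i j)%VF.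
split=> [i j|i]; first exact: homs_comp (hh i j) (gh j).
by rewrite /compc fE comp_lfunDr !comp_lfunA gd.
Qed.

Lemma null_homotopic_compr X Y Z (g : gmap Y Z) (f : gmap X Y) :
  chain_map f -> null_homotopic g -> null_homotopic (compc g f).
Proof.
move=> [fh fd] [h [hh gE]]; exists (fun i j => h i j \o f i)%VF.
split=> [i j|i]; first exact: homs_comp (fh i) (hh i j).
by rewrite /compc gE comp_lfunDl -!comp_lfunA fd.
Qed.

Lemma homotopic_ext X Y (f g : gmap X Y) : (forall i, f i = g i) -> homotopic f g.
Proof.
move=> fg; apply: null_homotopic_ext (@null_homotopic0 X Y) => i.
by rewrite fg subrr.
Qed.

Lemma homotopic_sym X Y (f g : gmap X Y) : homotopic f g -> homotopic g f.
Proof.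
by move=> /null_homotopicN; apply: null_homotopic_ext => i; rewrite opprB.
Qed.

Lemma homotopic_trans X Y (f g h : gmap X Y) :
  homotopic f g -> homotopic g h -> homotopic f h.
Proof.
move=> fg gh; apply: null_homotopic_ext (null_homotopicD fg gh) => i.
by rewrite addrA subrK.
Qed.

Lemma homotopic_compl X Y Z (g : gmap Y Z) (f f' : gmap X Y) :
  chain_map g -> homotopic f f' -> homotopic (compc g f) (compc g f').
Proof.
move=> gc ff'; apply: null_homotopic_ext (null_homotopic_compl gc ff') => i.
by rewrite /compc comp_lfunDr comp_lfunNr.
Qed.

Lemma homotopic_compr X Y Z (g g' : gmap Y Z) (f : gmap X Y) :
  chain_map f -> homotopic g g' -> homotopic (compc g f) (compc g' f).
Proof.
move=> fc gg'; apply: null_homotopic_ext (null_homotopic_compr fc gg') => i.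
by rewrite /compc comp_lfunDl comp_lfunNl.
Qed.

Lemma chain_comp X Y Z (g : gmap Y Z) (f : gmap X Y) :
  chain_map g -> chain_map f -> chain_map (compc g f).
Proof.
move=> [gh gd] [fh fd]; split=> [i|i j]; first exact: homs_comp (fh i) (gh i).
by rewrite /compc -comp_lfunA fd !comp_lfunA gd.
Qed.

Lemma chain_id X : chain_map (@idc K A X).
Proof.
split=> [i|i j]; first exact: homs_id.
by rewrite comp_lfun1l comp_lfun1r.
Qed.

(** X is a direct summand of Y in the homotopy category, with the complement
    left implicit. *)
Definition homotopy_retract X Y : Prop := exists (i : gmap X Y) (p : gmap Y X),
  [/\ chain_map i, chain_map p & homotopic (compc p i) (@idc K A X)].

Lemma retract_trans X Y Z : homotopy_retract X Y -> homotopy_retract Y Z -> homotopy_retract X Z.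
Proof.
move=> [i [p [ic pc pi]]] [j [q [jc qc qj]]].
exists (compc j i), (compc p q); split; try exact: chain_comp.
apply: homotopic_trans pi.
have h := homotopic_compl pc (homotopic_compr ic qj).
apply: (homotopic_trans _ (homotopic_trans h _)); apply: homotopic_ext => k.
  by rewrite /compc !comp_lfunA.
by rewrite /compc comp_lfun1l.
Qed.

Section CohomologyMap.
Variables (X Y : cplx A) (f : gmap X Y) (i : int).

(** The projection from X j to its cohomology is meaningful on cycles only. *)
Definition cohom_proj (X : cplx A) j : 'Hom(X j, cohomology X j) :=
  subquot_proj (stable_ker (dif_homs X j (j + 1))) (stable_img (dif_homs X (j - 1) j)).
Definition cohom_lift (X : cplx A) j : 'Hom(cohomology X j, X j) :=
  subquot_lift (stable_ker (dif_homs X j (j + 1))) (stable_img (dif_homs X (j - 1) j)).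

Definition cohom_map : 'Hom(cohomology X i, cohomology Y i) :=
  (cohom_proj Y i \o (f i \o cohom_lift X i))%VF.

Lemma cohom_mapE v : chain_map f -> v \in lker (dif X i (i + 1)) ->
  cohom_map (cohom_proj X i v) = cohom_proj Y i (f i v).
Proof.
move=> [fh fd] Zv; rewrite /cohom_map !comp_lfunE; apply/eqP.
rewrite eq_sym -subr_eq0 -!linearB /=.
have Bv := subquot_proj_diff (stable_ker (dif_homs X i (i + 1)))
  (stable_img (dif_homs X (i - 1) i)) Zv.
have fB : f i (v - cohom_lift X i (cohom_proj X i v)) \in limg (dif Y (i - 1) i).
  case/memv_imgP: Bv => u _ ->.
  by rewrite -comp_lfunE fd comp_lfunE memv_img ?memvf.
by rewrite subquot_proj_eq0 // (subvP (boundary_cycle _ _ _ _) _ fB).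
Qed.

End CohomologyMap.

Lemma cohom_projK X i u : cohom_proj X i (cohom_lift X i u) = u.
Proof. exact: subquot_liftK. Qed.

Lemma cohom_lift_cycle X i u : cohom_lift X i u \in lker (dif X i (i + 1)).
Proof. exact: subquot_lift_mem. Qed.

Lemma chain_cycle X Y (f : gmap X Y) i v : chain_map f ->
  v \in lker (dif X i (i + 1)) -> f i v \in lker (dif Y i (i + 1)).
Proof.
move=> [_ fd]; rewrite !memv_ker => /eqP Zv.
by rewrite -comp_lfunE -fd comp_lfunE Zv linear0.
Qed.

Lemma cohom_map_homs X Y (f : gmap X Y) i : chain_map f ->
  cohom_map f i \in homs (cohomology X i) (cohomology Y i).
Proof.
move=> fc; apply/homsP=> a u; rewrite -[u]cohom_projK.
have Zu := cohom_lift_cycle u.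
have pact Z w : w \in lker (dif Z i (i + 1)) ->
    ract (cohomology Z i) a (cohom_proj Z i w) = cohom_proj Z i (ract (Z i) a w).
  by move=> Zw; rewrite [RHS]subquot_proj_act.
rewrite pact // !cohom_mapE //; last exact: (stable_ker (dif_homs _ _ _)).
rewrite pact; last exact: chain_cycle.
by congr (cohom_proj _ _ _); case: fc => fh _; apply: homsE.
Qed.

Lemma cohom_map_comp X Y Z (g : gmap Y Z) (f : gmap X Y) i :
  chain_map f -> chain_map g ->
  cohom_map (compc g f) i = (cohom_map g i \o cohom_map f i)%VF.
Proof.
move=> fc gc; apply/lfunP=> u; rewrite -[u]cohom_projK comp_lfunE.
have Zu := cohom_lift_cycle u.
rewrite !cohom_mapE ?comp_lfunE //; first exact: chain_cycle.
exact: chain_comp.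
Qed.

Lemma cohom_map_id X i : cohom_map (@idc K A X) i = \1%VF.
Proof.
by apply/lfunP=> u; rewrite !comp_lfunE !id_lfunE cohom_projK.
Qed.

Lemma cohom_map_null X Y (f : gmap X Y) i : null_homotopic f -> cohom_map f i = 0.
Proof.
move=> [h [hh fE]]; apply/lfunP=> u; rewrite !comp_lfunE zero_lfunE; apply/eqP.
have := cohom_lift_cycle u; rewrite memv_ker => /eqP du.
have fB : f i (cohom_lift X i u) \in limg (dif Y (i - 1) i).
  rewrite fE add_lfunE !comp_lfunE du linear0 addr0 memv_img ?memvf //.
by rewrite subquot_proj_eq0 // (subvP (boundary_cycle _ _ _ _) _ fB).
Qed.

Lemma cohom_mapB X Y (f g : gmap X Y) i :
  cohom_map (fun j => f j - g j) i = cohom_map f i - cohom_map g i.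
Proof.
apply/lfunP=> u; rewrite add_lfunE opp_lfunE !comp_lfunE.
by rewrite add_lfunE opp_lfunE linearB.
Qed.

Lemma cohom_map_homotopic X Y (f g : gmap X Y) i :
  homotopic f g -> cohom_map f i = cohom_map g i.
Proof.
by move=> /(cohom_map_null i)/eqP; rewrite cohom_mapB subr_eq0 => /eqP.
Qed.

Lemma cohom_map_sum (I : finType) X Y (f : I -> gmap X Y) i :
  cohom_map (fun j => \sum_k f k j) i = \sum_k cohom_map (f k) i.
Proof.
apply/lfunP=> u; rewrite sum_lfunE !comp_lfunE sum_lfunE linear_sum.
by apply: eq_bigr => k _; rewrite !comp_lfunE.
Qed.

(** Only quotients and submodules matter for the conditions on theta, so a
    retraction is as good as a splitting. *)
Lemma retract_cohom X Y i : homotopy_retract X Y ->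
  is_quotient (cohomology Y i) (cohomology X i)
  /\ is_sub (cohomology X i) (cohomology Y i).
Proof.
move=> [j [p [jc pc pj]]].
have e : (cohom_map p i \o cohom_map j i)%VF = \1%VF.
  by rewrite -cohom_map_comp // (cohom_map_homotopic _ pj) cohom_map_id.
have K' u : cohom_map p i (cohom_map j i u) = u by rewrite -comp_lfunE e id_lfunE.
split.
  by exists (cohom_map p i); [exact: cohom_map_homs | exact: limg_full K'].
exists (cohom_map j i); first exact: cohom_map_homs.
by apply: lker_eq0 => v jv; rewrite -[v]K' jv linear0.
Qed.

Lemma nuvalB P (phi psi : nu P) (f : 'Hom(P, regm A)) :
  nuval (phi - psi) f = nuval phi f - nuval psi f.
Proof. by rewrite -scaleN1r addrC nuvalP mulN1r addrC. Qed.

Lemma nufB M N (f g : 'Hom(M, N)) : f \in homs M N -> g \in homs M N ->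
  nuf (f - g) = nuf f - nuf g.
Proof.
move=> fh gh; apply/lfunP=> phi; apply: nuval_ext => a ah.
rewrite add_lfunE opp_lfunE nuvalB !nuval_nuf ?memvB //.
by rewrite comp_lfunDr comp_lfunNr linearB.
Qed.

Lemma nufD M N (f g : 'Hom(M, N)) : f \in homs M N -> g \in homs M N ->
  nuf (f + g) = nuf f + nuf g.
Proof.
move=> fh gh; rewrite -{1}[g]opprK nufB ?memvN // -[- g]sub0r nufB ?homs0 //.
by rewrite nuf0 sub0r opprK.
Qed.

Lemma nuf_id M : nuf (\1%VF : 'Hom(M, M)) = \1%VF.
Proof.
apply/lfunP=> phi; apply: nuval_ext => a ah.
by rewrite nuval_nuf ?homs_id // comp_lfun1r id_lfunE.
Qed.

Definition nucm X Y (f : gmap X Y) : gmap (nuc X) (nuc Y) := fun i => nuf (f i).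

Lemma nucm_chain X Y (f : gmap X Y) : chain_map f -> chain_map (nucm f).
Proof.
move=> [fh fd]; split=> [i|i j]; first exact: nuf_homs.
by rewrite /nucm /= -!nuf_comp ?fd ?dif_homs.
Qed.

Lemma nucm_null X Y (f : gmap X Y) : null_homotopic f -> null_homotopic (nucm f).
Proof.
move=> [h [hh fE]]; exists (fun i j => nuf (h i j)).
split=> [i j|i]; first exact: nuf_homs.
by rewrite /nucm fE nufD ?nuf_comp ?homs_comp ?dif_homs.
Qed.

Lemma nucm_homotopic X Y (f g : gmap X Y) : chain_map f -> chain_map g ->
  homotopic f g -> homotopic (nucm f) (nucm g).
Proof.
move=> [fh _] [gh _] /nucm_null; apply: null_homotopic_ext => i.
exact: nufB.
Qed.

Lemma retract_nuc X Y : homotopy_retract X Y -> homotopy_retract (nuc X) (nuc Y).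
Proof.
move=> [j [p [jc pc pj]]]; exists (nucm j), (nucm p).
split; try exact: nucm_chain.
have h := nucm_homotopic (chain_comp pc jc) (chain_id X) pj.
apply: (homotopic_trans _ (homotopic_trans h _)); apply: homotopic_ext => i.
  by rewrite /nucm /compc nuf_comp //; [case: jc | case: pc].
exact: nuf_id.
Qed.

End HomotopyCalculus.

(** * Two-term complexes *)

Section TwoTermComplexes.
Variables (K : fieldType) (A : falgType K).

(** A complex with projective terms concentrated in the degrees -1 and 0. *)
Record tcplx := TCplx {
  tlow : rmod A;
  thigh : rmod A;
  tdif : 'Hom(tlow, thigh);
  tdif_homs : tdif \in homs tlow thigh;
  tlow_proj : projective tlow;
  thigh_proj : projective thigh }.

Implicit Types W : tcplx.

(** Matching on the constructors of int makes the terms and the differential of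
    the complex reduce to those of W in the degrees -1 and 0. *)
Definition cplx_of_ob W (i : int) : rmod A :=
  match i with Posz 0 => thigh W | Negz 0 => tlow W | _ => zero_rmod A end.

Definition cplx_of_dif W i j : 'Hom(cplx_of_ob W i, cplx_of_ob W j) :=
  match i, j return 'Hom(cplx_of_ob W i, cplx_of_ob W j) with
  | Negz 0, Posz 0 => tdif W
  | _, _ => 0
  end.

Lemma cplx_of_dif_homs W i j : cplx_of_dif W i j \in homs (cplx_of_ob W i) (cplx_of_ob W j).
Proof. by case: i => [[|i]|[|i]]; case: j => [[|j]|[|j]]; rewrite ?homs0 ?tdif_homs. Qed.

Lemma cplx_of_dif_shape W i j : j != i + 1 -> cplx_of_dif W i j = 0.
Proof. by case: i => [[|i]|[|i]]; case: j => [[|j]|[|j]]. Qed.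

Lemma cplx_of_dif_dif W i j k : (cplx_of_dif W j k \o cplx_of_dif W i j)%VF = 0.
Proof.
by case: i => [[|i]|[|i]]; case: j => [[|j]|[|j]]; case: k => [[|k]|[|k]];
  rewrite /= ?comp_lfun0l ?comp_lfun0r.
Qed.

Definition cplx_of W : cplx A := Cplx (cplx_of_dif_homs W) (@cplx_of_dif_shape W)
  (@cplx_of_dif_dif W).

Lemma zero_rmod_proj : projective (zero_rmod A).
Proof.
move=> M N g f gh gs fh; exists 0; first exact: homs0.
by rewrite comp_lfun0r (mzero_lfun f (zero_rmod_mzero A)).
Qed.

Lemma cplx_of_ob_zero W i : i <> 0 -> i <> -1 -> mzero (cplx_of_ob W i).
Proof.
by case: i => [[|i]|[|i]] //= *; apply: zero_rmod_mzero.
Qed.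

Lemma cplx_of_proj W i : projective (cplx_of W i).
Proof.
case: i => [[|i]|[|i]] /=; [exact: thigh_proj | exact: zero_rmod_proj
  | exact: tlow_proj | exact: zero_rmod_proj].
Qed.

Lemma cplx_of_bounded W : exists n : nat, forall i : int, (n < `|i|)%N -> mzero (cplx_of W i).
Proof. by exists 1%N => i i1; apply: cplx_of_ob_zero => i0; move: i1; rewrite i0. Qed.

Definition kb_of W : kbproj A := KbProj (@cplx_of_proj W) (cplx_of_bounded W).

Definition tcplx_map W W' (a : 'Hom(tlow W, tlow W')) (b : 'Hom(thigh W, thigh W')) : Prop :=
  [/\ a \in homs (tlow W) (tlow W'), b \in homs (thigh W) (thigh W')
    & (b \o tdif W = tdif W' \o a)%VF].

Definition map_of W W' (a : 'Hom(tlow W, tlow W')) (b : 'Hom(thigh W, thigh W')) : gmap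
  (cplx_of W) (cplx_of W') :=
  fun i => match i return 'Hom(cplx_of_ob W i, cplx_of_ob W' i) with
  | Posz 0 => b | Negz 0 => a | _ => 0 end.

Lemma map_of_chain W W' (a : 'Hom(tlow W, tlow W')) (b : 'Hom(thigh W, thigh W')) :
  tcplx_map a b -> chain_map (map_of a b).
Proof.
move=> [ah bh ab]; split=> [i|i j].
  by case: i => [[|i]|[|i]]; [exact: bh | exact: homs0 | exact: ah | exact: homs0].
by case: i => [[|i]|[|i]]; case: j => [[|j]|[|j]];
  rewrite /= ?comp_lfun0l ?comp_lfun0r.
Qed.

Lemma chain_tcplx_map W W' (f : gmap (cplx_of W) (cplx_of W')) : chain_map f ->
  tcplx_map (f (Negz 0)) (f (Posz 0)).
Proof.
by move=> [fh fd]; split; [exact: (fh (Negz 0)) | exact: (fh (Posz 0))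
  | exact: (fd (Negz 0) (Posz 0))].
Qed.

(** All other terms are zero modules. *)
Lemma gmap_cplx_ofE W X (f g : gmap (cplx_of W) X) :
  f (Negz 0) = g (Negz 0) -> f (Posz 0) = g (Posz 0) -> forall i, f i = g i.
Proof.
move=> e1 e0 i; case: i => [[|i]|[|i]] //.
  by rewrite [LHS]mzero_lfun ?[RHS]mzero_lfun //; apply: zero_rmod_mzero.
by rewrite [LHS]mzero_lfun ?[RHS]mzero_lfun //; apply: zero_rmod_mzero.
Qed.

Lemma tcplx_map_id W : tcplx_map (\1%VF : 'Hom(tlow W, tlow W)) (\1%VF : 'Hom(thigh W, thigh W)).
Proof. by split; rewrite ?homs_id // comp_lfun1l comp_lfun1r. Qed.

Lemma tcplx_map_comp W W' W'' (a : 'Hom(tlow W, tlow W')) (b : 'Hom(thigh W, thigh W'))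
    (a' : 'Hom(tlow W', tlow W'')) (b' : 'Hom(thigh W', thigh W'')) :
  tcplx_map a b -> tcplx_map a' b' -> tcplx_map (a' \o a)%VF (b' \o b)%VF.
Proof.
move=> [ah bh ab] [ah' bh' ab']; split; rewrite ?(homs_comp ah) ?(homs_comp bh) //.
by rewrite -comp_lfunA ab !comp_lfunA ab'.
Qed.

Lemma tcplx_map_sum W W' n (a : 'I_n -> 'Hom(tlow W, tlow W')) (b : 'I_n -> 'Hom(thigh W, thigh
  W')) :
  (forall k, tcplx_map (a k) (b k)) -> tcplx_map (\sum_k a k) (\sum_k b k).
Proof.
move=> ab; split.
- by apply: memv_suml => k _; case: (ab k).
- by apply: memv_suml => k _; case: (ab k).
- apply/lfunP=> v; rewrite !comp_lfunE !sum_lfunE linear_sum; apply: eq_bigr => k _.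
  by have [_ _ e] := ab k; rewrite /= -[LHS]comp_lfunE e comp_lfunE.
Qed.

Lemma tcplx_mapB W W' (a a' : 'Hom(tlow W, tlow W')) (b b' : 'Hom(thigh W, thigh W')) :
  tcplx_map a b -> tcplx_map a' b' -> tcplx_map (a - a') (b - b').
Proof.
move=> [ah bh ab] [ah' bh' ab']; split; rewrite ?memvB //.
by rewrite comp_lfunDl comp_lfunDr comp_lfunNl comp_lfunNr ab ab'.
Qed.

Definition tcplx_of (V : kbproj A) : tcplx :=
  TCplx (dif_homs V (Negz 0) (Posz 0)) (@kc_proj _ _ V (Negz 0)) (@kc_proj _ _ V (Posz 0)).

Lemma retract_tcplx_of (V : kbproj A) : (forall i, i != -1 -> i != 0 -> mzero (V i)) ->
  homotopy_retract V (cplx_of (tcplx_of V)).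
Proof.
move=> V0.
pose i : gmap V (cplx_of (tcplx_of V)) := fun k =>
  match k return 'Hom(V k, cplx_of_ob (tcplx_of V) k) with
  | Posz 0 => \1%VF | Negz 0 => \1%VF | _ => 0 end.
pose p : gmap (cplx_of (tcplx_of V)) V := fun k =>
  match k return 'Hom(cplx_of_ob (tcplx_of V) k, V k) with
  | Posz 0 => \1%VF | Negz 0 => \1%VF | _ => 0 end.
have Vp k : mzero (V (Posz k.+1)) by exact: V0.
have Vn k : mzero (V (Negz k.+1)) by exact: V0.
have Z := zero_rmod_mzero A.
have eqL (M N : rmod A) (f g : 'Hom(M, N)) : mzero M -> f = g.
  by move=> M0; rewrite (mzero_lfun f M0) (mzero_lfun g M0).
have eqR (M N : rmod A) (f g : 'Hom(M, N)) : mzero N -> f = g.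
  by move=> N0; rewrite (mzero_colfun f N0) (mzero_colfun g N0).
exists i, p; split.
- split=> [k|k l]; first by case: k => [[|k]|[|k]]; (exact: homs_id || exact: homs0).
  case: k => [[|k]|[|k]]; try exact: (eqL _ _ _ _ (Vp _));
    try exact: (eqL _ _ _ _ (Vn _)); case: l => [[|l]|[|l]];
    try exact: (eqR _ _ _ _ Z); rewrite /= ?comp_lfun0l ?comp_lfun1r ?comp_lfun1l //;
    exact: dif_shape.
- split=> [k|k l]; first by case: k => [[|k]|[|k]]; (exact: homs_id || exact: homs0).
  case: k => [[|k]|[|k]]; try exact: (eqL _ _ _ _ Z); case: l => [[|l]|[|l]];
    try exact: (eqR _ _ _ _ (Vp _)); try exact: (eqR _ _ _ _ (Vn _));
    rewrite /= ?comp_lfun0r ?comp_lfun1r ?comp_lfun1l //; exact/esym/dif_shape.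
- apply: homotopic_ext; case=> [[|k]|[|k]]; rewrite /compc /idc /= ?comp_lfun1l //.
    exact: (eqL _ _ _ _ (Vp k)).
  exact: (eqL _ _ _ _ (Vn k)).
Qed.

(** For a two-term complex these are the cokernel of d and the kernel of nu d;
    the maps cokerH_proj and kerN_inc below present them as such. *)
Definition cokerH W : rmod A := cohomology (cplx_of W) 0.
Definition kerN W : rmod A := cohomology (nuc (cplx_of W)) (-1).
Definition cokerH_proj W : 'Hom(thigh W, cokerH W) := cohom_proj (cplx_of W) 0.
Definition kerN_inc W : 'Hom(kerN W, nu (tlow W)) := cohom_lift (nuc (cplx_of W)) (-1).

Lemma cokerH_projP W :
  [/\ cokerH_proj W \in homs (thigh W) (cokerH W), limg (cokerH_proj W) = fullv & lker
    (cokerH_proj W) = limg (tdif W)].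
Proof.
have Zf v : v \in lker (dif (cplx_of W) 0 (0 + 1)) by rewrite memv_ker zero_lfunE.
split.
- by apply/homsP=> a v; apply: subquot_proj_act.
- exact: limg_full (@cohom_projK _ _ (cplx_of W) 0).
- apply/vspaceP=> v; rewrite memv_ker.
  exact: (@subquot_proj_eq0 _ _ _ _ _ (stable_ker (dif_homs (cplx_of W) 0 (0 + 1)))
    (stable_img (dif_homs (cplx_of W) (0 - 1) 0)) v (Zf v)).
Qed.

Lemma kerN_incP W : [/\ kerN_inc W \in homs (kerN W) (nu (tlow W)), lker (kerN_inc W) = 0%VS
  & limg (kerN_inc W) = lker (nuf (tdif W))].
Proof.
have B0 : limg (dif (nuc (cplx_of W)) (-1 - 1) (-1)) = 0%VS.
  by rewrite /= nuf0 lim0g.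
split.
- by apply/homsP=> a v; apply: subquot_lift_act.
- apply: lker_eq0 => v v0; rewrite -[v](@cohom_projK _ _ (nuc (cplx_of W)) (-1)).
  by rewrite [cohom_lift _ _ _]v0 linear0.
- apply/vspaceP=> v; apply/memv_imgP/idP => [[u _ ->]|Zv].
    exact: (@cohom_lift_cycle _ _ (nuc (cplx_of W)) (-1) u).
  exists (cohom_proj (nuc (cplx_of W)) (-1) v); rewrite ?memvf //.
  have := subquot_proj_diff (stable_ker (dif_homs (nuc (cplx_of W)) (-1) (-1 + 1)))
    (stable_img (dif_homs (nuc (cplx_of W)) (-1 - 1) (-1))) Zv.
  have B0' w : w \in limg (dif (nuc (cplx_of W)) (-1 - 1) (-1)) -> w = 0.
    by rewrite B0 memv0 => /eqP.
  by move/B0'/eqP; rewrite subr_eq0 => /eqP.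
Qed.

Lemma hdim_cokerH W X :
  hdim (thigh W) X = (hdim (cokerH W) X + \dim (precompl X (tdif W) @: homs (thigh W) X))%N.
Proof.
have [ph ps pK] := cokerH_projP W.
rewrite /hdim -(limg_ker_dim (precompl X (tdif W)) (homs (thigh W) X)); congr (_ + _)%N.
rewrite -(@dim_image_inj _ _ _ (precompl X (cokerH_proj W)) (homs (cokerH W) X)); last first.
  by move=> h _; rewrite precomplE => /(comp_epi_eq0 ps).
congr (\dim _); apply/vspaceP=> h; rewrite memv_cap memv_ker precomplE.
apply/andP/memv_imgP => [[hh /eqP hd]|[k kh ->]].
  have [|k kh kE] := factor_epi ph ps hh; last by exists k; rewrite ?precomplE.
  rewrite pK; apply/subvP=> _ /memv_imgP[v _ ->].
  by rewrite memv_ker -comp_lfunE hd zero_lfunE.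
rewrite precomplE (homs_comp ph kh); split=> //; apply/eqP/lfunP=> v.
rewrite !comp_lfunE zero_lfunE.
have: tdif W v \in lker (cokerH_proj W) by rewrite pK memv_img ?memvf.
by rewrite memv_ker => /eqP->; rewrite linear0.
Qed.

(** Both sides compare the Euler characteristic of Hom(W, X), whose cohomology
    consists of Hom(H, X) and of the dual of Hom(X, N). *)
Lemma hdim_two_term W X :
  (hdim (thigh W) X + hdim X (kerN W) = hdim (cokerH W) X + hdim (tlow W) X)%N.
Proof.
have [ih i0 iI] := kerN_incP W.
rewrite hdim_cokerH -(hdim_nu_kernel X (@tlow_proj W) (@thigh_proj W) (tdif_homs W) ih i0 iI).
by rewrite -!addnA; congr (_ + _)%N; rewrite addnC.
Qed.

(** A map of cokernels lifts to projective presentations. *)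
Lemma lift_H W W' (g : 'Hom(cokerH W, cokerH W')) : g \in homs (cokerH W) (cokerH W') ->
  exists a b, tcplx_map a b /\ (g \o cokerH_proj W = cokerH_proj W' \o b)%VF.
Proof.
move=> gh; have [ph ps pK] := cokerH_projP W; have [ph' ps' pK'] := cokerH_projP W'.
have [b bh bE] := @thigh_proj W _ _ _ _ ph' ps' (homs_comp ph gh).
have [|a ah aE] := proj_lift (@tlow_proj W) (tdif_homs W') (homs_comp (tdif_homs W) bh).
  apply/subvP=> _ /memv_imgP[v _ ->]; rewrite -pK' memv_ker -comp_lfunE.
  rewrite comp_lfunA bE !comp_lfunE.
  have : tdif W v \in lker (cokerH_proj W) by rewrite pK memv_img ?memvf.
  by rewrite memv_ker => /eqP->; rewrite linear0.
by exists a, b.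
Qed.

(** A map of kernels extends to the injective copresentations, since nu P is
    injective; the extension comes from a map of complexes of projectives
    because nu is full and faithful on projectives. *)
Lemma lift_N W W' (g : 'Hom(kerN W, kerN W')) : g \in homs (kerN W) (kerN W') ->
  exists a b, tcplx_map a b /\ (kerN_inc W' \o g = nuf a \o kerN_inc W)%VF.
Proof.
move=> gh; have [ih i0 iI] := kerN_incP W; have [ih' i0' iI'] := kerN_incP W'.
have [a' ah' aE'] := nu_injective (@tlow_proj W') ih i0 (homs_comp gh ih').
have dh := nuf_homs (tdif_homs W); have dh' := nuf_homs (tdif_homs W').
have [I [r [s [rh sh rs s0 rsE]]]] := image_factor dh.
have [|c ch cE] := factor_epi rh rs (homs_comp ah' dh').
  apply/subvP=> v rv; rewrite memv_ker.
  have : v \in lker (nuf (tdif W)).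
    by move: rv; rewrite !memv_ker -rsE comp_lfunE => /eqP->; rewrite linear0.
  rewrite -iI => /memv_imgP[u _ ->]; rewrite comp_lfunE -[a' _]comp_lfunE aE' comp_lfunE.
  by rewrite -memv_ker -iI' memv_img ?memvf.
have [b' bh' bE'] := nu_injective (@thigh_proj W') sh s0 ch.
have [a ah aE] := nu_full (@tlow_proj W') ah'.
have [b bh bE] := nu_full (@thigh_proj W') bh'.
exists a, b; split; last by rewrite aE aE'.
split=> //; apply/eqP; rewrite -subr_eq0; apply/eqP.
have h1 := homs_comp (tdif_homs W) bh; have h2 := homs_comp ah (tdif_homs W').
apply: (nu_faithful (@thigh_proj W')); first by rewrite memvB.
rewrite nufB // !nuf_comp ?tdif_homs // bE aE -[X in (b' \o X)%VF]rsE comp_lfunA bE' cE.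
by rewrite subrr.
Qed.

End TwoTermComplexes.

(** * Fitting's lemma and minimal two-term models *)

Section Models.
Variables (K : fieldType) (A : falgType K).
Implicit Types (W : tcplx A) (U : kbproj A) (M N : rmod A).

Definition tcplx_dim W := (\dim {: tlow W} + \dim {: thigh W})%N.

(** The image of an idempotent is again a two-term complex of projectives. The
    last clause serves for the minimality of models: an idempotent whose image
    is not smaller is the identity. *)
Lemma split_idem W (e1 : 'End(tlow W)) (e0 : 'End(thigh W)) :
  tcplx_map e1 e0 -> (e1 \o e1 = e1)%VF -> (e0 \o e0 = e0)%VF ->
  exists W' (i1 : 'Hom(tlow W', tlow W)) (i0 : 'Hom(thigh W', thigh W))
    (p1 : 'Hom(tlow W, tlow W')) (p0 : 'Hom(thigh W, thigh W')),
    [/\ tcplx_map i1 i0, tcplx_map p1 p0,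
        (p1 \o i1 = \1)%VF /\ (p0 \o i0 = \1)%VF,
        (i1 \o p1 = e1)%VF /\ (i0 \o p0 = e0)%VF
      & (tcplx_dim W <= tcplx_dim W')%N -> e1 = \1%VF /\ e0 = \1%VF].
Proof.
move=> [e1h e0h e10] ee1 ee0.
have section (M N : rmod A) (p : 'Hom(M, N)) (i : 'Hom(N, M)) (e : 'End(M)) :
    limg p = fullv -> lker i = 0%VS -> (i \o p)%VF = e -> (e \o e = e)%VF ->
    (p \o i = \1)%VF.
  move=> ps i0 ip ee; apply/lfunP=> v; have [u <-] := limg_fullP v ps.
  rewrite id_lfunE comp_lfunE; apply: (lker0_inj i0).
  by rewrite -![i (p _)]comp_lfunE ip -comp_lfunE ee.
have [I1 [p1 [i1 [p1h i1h p1s i1k ip1]]]] := image_factor e1h.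
have [I0 [p0 [i0 [p0h i0h p0s i0k ip0]]]] := image_factor e0h.
have pi1 := section _ _ _ _ _ p1s i1k ip1 ee1.
have pi0 := section _ _ _ _ _ p0s i0k ip0 ee0.
have dh : (p0 \o (tdif W \o i1))%VF \in homs I1 I0.
  exact: homs_comp (homs_comp i1h (tdif_homs W)) p0h.
exists (TCplx dh (proj_summand (@tlow_proj _ _ W) i1h p1h pi1)
  (proj_summand (@thigh_proj _ _ W) i0h p0h pi0)), i1, i0, p1, p0.
split=> //.
- split=> //=; rewrite !comp_lfunA ip0 e10 -comp_lfunA -ip1.
  by rewrite -!comp_lfunA pi1 comp_lfun1r.
- split=> //=; rewrite -!comp_lfunA ip1 -e10 comp_lfunA -ip0.
  by rewrite !comp_lfunA pi0 comp_lfun1l.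
rewrite /tcplx_dim /= => le.
have le1 : (\dim {: I1} <= \dim {: tlow W})%N.
  by rewrite -p1s -[X in (_ <= X)%N](limg_ker_dim p1) leq_addl.
have le0 : (\dim {: I0} <= \dim {: thigh W})%N.
  by rewrite -p0s -[X in (_ <= X)%N](limg_ker_dim p0) leq_addl.
have one (M N : rmod A) (p : 'Hom(M, N)) (i : 'Hom(N, M)) (e : 'End(M)) :
    limg p = fullv -> lker i = 0%VS -> (i \o p)%VF = e -> (e \o e = e)%VF ->
    (\dim {: M} <= \dim {: N})%N -> e = \1%VF.
  move=> ps i0' ip ee MN.
  have p0' : lker p = 0%VS.
    apply/eqP; rewrite -dimv_eq0 -leqn0 -(leq_add2r (\dim {: N})) add0n.
    by apply: leq_trans MN; rewrite -[X in (_ <= X)%N](limg_ker_dim p) capfv ps.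
  apply/lfunP=> v; rewrite id_lfunE; apply: (lker0_inj p0'); apply: (lker0_inj i0').
  by rewrite -![i (p _)]comp_lfunE ip -comp_lfunE ee.
split; [apply: one p1s i1k ip1 ee1 _ | apply: one p0s i0k ip0 ee0 _]; lia.
Qed.

Fixpoint lfun_pow (V : vectType K) (f : 'End(V)) n : 'End(V) :=
  if n is n'.+1 then (f \o lfun_pow f n')%VF else \1%VF.

Lemma lfun_powE (V : vectType K) (f : 'End(V)) n v : lfun_pow f n v = iter n f v.
Proof. by elim: n => [|n IH] /=; rewrite ?id_lfunE // comp_lfunE IH. Qed.

Lemma lfun_powD (V : vectType K) (f : 'End(V)) m n : (lfun_pow f m \o lfun_pow f n)%VF =
  lfun_pow f (m + n).
Proof. by apply/lfunP=> v; rewrite comp_lfunE !lfun_powE iterD. Qed.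

Lemma tcplx_map_pow W (a : 'End(tlow W)) (b : 'End(thigh W)) n :
  tcplx_map a b -> tcplx_map (lfun_pow a n) (lfun_pow b n).
Proof.
move=> ab; elim: n => [|n IH] /=; first exact: tcplx_map_id.
exact: tcplx_map_comp IH ab.
Qed.

(** When f and its square have the same kernel, this is the projection onto the
    image of f along the kernel of f; it is built with a partial inverse of
    f o f. *)
Definition fit (V : vectType K) (f : 'End(V)) : 'End(V) :=
  (f \o ((f \o f)^-1 \o f))%VF.

Section Fit.
Variables (V : vectType K) (f : 'End(V)).
Hypothesis ff : lker (f \o f)%VF = lker f.

Lemma stable_limg : limg (f \o f)%VF = limg f.
Proof.
apply/eqP; rewrite eqEdim; apply/andP; split.
  by rewrite limg_comp limgS ?subvf.
have h1 := limg_ker_dim f fullv; have h2 := limg_ker_dim (f \o f)%VF fullv.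
by rewrite !capfv in h1 h2; rewrite ff in h2; lia.
Qed.

Lemma stable_inj u v : f (f u) = f (f v) -> f u = f v.
Proof.
move=> e; apply/eqP; rewrite -subr_eq0 -linearB -memv_ker -ff memv_ker.
by rewrite comp_lfunE linearB /= linearB /= e subrr.
Qed.

Lemma fitE v : f (fit f v) = f v.
Proof.
rewrite /fit !comp_lfunE -[f (f _)]comp_lfunE limg_lfunVK //.
by rewrite stable_limg memv_img ?memvf.
Qed.

Lemma fit_img v : exists u, fit f v = f u.
Proof. by exists (((f \o f)^-1 \o f)%VF v); rewrite /fit comp_lfunE. Qed.

(** This characterization shows that fit f commutes with all that commutes with
    f: with the action of A, and with the differential. *)
Lemma fit_unique v w : f (f w) = f v -> fit f v = f w.
Proof.
move=> e; have [u uE] := fit_img v; rewrite uE; apply: stable_inj.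
by rewrite -uE fitE.
Qed.

Lemma fit_idem : (fit f \o fit f = fit f)%VF.
Proof.
apply/lfunP=> v; rewrite comp_lfunE; have [u uE] := fit_img v.
by rewrite uE; apply: fit_unique.
Qed.

Lemma fit1_inj : fit f = \1%VF -> lker f = 0%VS.
Proof.
move=> f1; apply: lker_eq0 => v fv.
have [u uE] := fit_img v; rewrite f1 id_lfunE in uE; rewrite uE -[RHS](linear0 f).
by apply: stable_inj; rewrite -uE fv !linear0.
Qed.

End Fit.

Lemma fit_tcplx_map W (a : 'End(tlow W)) (b : 'End(thigh W)) :
  lker (a \o a)%VF = lker a -> lker (b \o b)%VF = lker b ->
  tcplx_map a b -> tcplx_map (fit a) (fit b).
Proof.
move=> sa sb [ah bh ab].
have fith (M : rmod A) (f : 'End(M)) : lker (f \o f)%VF = lker f ->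
    f \in homs M M -> fit f \in homs M M.
  move=> sf fh; apply/homsP=> c v; have [u uE] := fit_img f v.
  rewrite uE -(homsE _ _ fh); apply: (fit_unique sf).
  by rewrite !(homsE _ _ fh) -uE (fitE sf).
have com x : b (tdif W x) = tdif W (a x) by rewrite -comp_lfunE ab comp_lfunE.
split; [exact: fith | exact: fith | apply/lfunP=> v].
rewrite [LHS]comp_lfunE [RHS]comp_lfunE; have [u uE] := fit_img a v.
by rewrite uE -com; apply: (fit_unique sb); rewrite !com -uE (fitE sa).
Qed.

(** The dimensions of the kernels of the powers of a and b are bounded; take n
    where their sum is largest. The successor provides a positive exponent, so
    that injectivity of the power implies that of the map. *)
Lemma stable_power (V V' : vectType K) (a : 'End(V)) (b : 'End(V')) : exists n,
  lker (lfun_pow a n.+1 \o lfun_pow a n.+1)%VF = lker (lfun_pow a n.+1) /\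
  lker (lfun_pow b n.+1 \o lfun_pow b n.+1)%VF = lker (lfun_pow b n.+1).
Proof.
pose d n := (\dim (lker (lfun_pow a n.+1)) + \dim (lker (lfun_pow b n.+1)))%N.
have [k [[n nE] kmax]] : exists k, (exists n, d n = k) /\
    forall k', (exists n, d n = k') -> (k' <= k)%N.
  apply: (@max_nat _ (\dim {: V} + \dim {: V'})) => [_ [n <-]|]; last by exists (d 0), 0.
  by rewrite leq_add // dimvS // subvf.
exists n; have : (d (n + n.+1) <= d n)%N by rewrite nE; apply: kmax; exists (n + n.+1)%N.
rewrite /d -!addSn -!lfun_powD => le.
have sub (X : vectType K) (f : 'End(X)) : (lker f <= lker (f \o f)%VF)%VS.
  apply/subvP=> v; rewrite !memv_ker comp_lfunE => /eqP->.
  by rewrite linear0.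
have la := dimvS (sub _ (lfun_pow a n.+1)); have lb := dimvS (sub _ (lfun_pow b n.+1)).
by split; apply/esym/eqP; rewrite eqEdim sub; lia.
Qed.

Lemma fitting_tcplx W (a : 'End(tlow W)) (b : 'End(thigh W)) : tcplx_map a b ->
  exists n (e1 : 'End(tlow W)) (e0 : 'End(thigh W)),
  [/\ tcplx_map e1 e0, (e1 \o e1 = e1)%VF /\ (e0 \o e0 = e0)%VF,
      (lfun_pow a n \o e1 = lfun_pow a n)%VF /\ (lfun_pow b n \o e0 = lfun_pow b n)%VF
    & e1 = \1%VF -> e0 = \1%VF -> lker a = 0%VS /\ lker b = 0%VS].
Proof.
move=> ab; have [n [sa sb]] := stable_power a b.
exists n.+1, (fit (lfun_pow a n.+1)), (fit (lfun_pow b n.+1)).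
have inj (V : vectType K) (f : 'End(V)) : lker (lfun_pow f n.+1) = 0%VS -> lker f = 0%VS.
  move=> f0; apply: lker_eq0 => v fv; apply: (lker0_inj f0).
  by rewrite linear0 lfun_powE iterSr fv -lfun_powE linear0.
split.
- exact/(fit_tcplx_map sa sb)/tcplx_map_pow.
- by split; apply: fit_idem.
- by split; apply/lfunP=> v; rewrite comp_lfunE fitE.
- by move=> e1 e0; split; apply: inj; apply: fit1_inj.
Qed.

Lemma map_of_comp W W' W'' (a : 'Hom(tlow W, tlow W')) (b : 'Hom(thigh W, thigh W'))
    (a' : 'Hom(tlow W', tlow W'')) (b' : 'Hom(thigh W', thigh W'')) i :
  compc (map_of a' b') (map_of a b) i = map_of (a' \o a)%VF (b' \o b)%VF i.
Proof. exact: (@gmap_cplx_ofE _ _ W (cplx_of W'')). Qed.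

Lemma map_of_id W i : map_of (\1%VF : 'End(tlow W)) (\1%VF : 'End(thigh W)) i = \1%VF.
Proof. exact: (@gmap_cplx_ofE _ _ W (cplx_of W) (map_of _ _) (@idc _ _ _)). Qed.

(** Minimality of the dimension rules out contractible summands, so that
    statements up to homotopy become statements about plain maps. *)
Definition is_model U W : Prop := homotopy_retract U (cplx_of W) /\
  forall W', homotopy_retract U (cplx_of W') -> (tcplx_dim W <= tcplx_dim W')%N.

Lemma exists_model U W : homotopy_retract U (cplx_of W) -> exists W', is_model U W'.
Proof.
have [n] := ubnP (tcplx_dim W); elim: n W => // n IH W Wn UW.
have [[W' UW' lt]|nW] := pselect (exists2 W', homotopy_retract U (cplx_of W') & (tcplx_dim W' <
  tcplx_dim W)%N).
  exact: (IH W' (leq_trans lt Wn)).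
exists W; split=> // W' UW'; rewrite leqNgt; apply/negP=> lt.
by apply: nW; exists W'.
Qed.

Lemma kb_iso_trans (X Y Z : kbproj A) : kb_iso X Y -> kb_iso Y Z -> kb_iso X Z.
Proof.
move=> [f [g [fc gc gf fg]]] [f' [g' [fc' gc' gf' fg']]].
exists (compc f' f), (compc g g'); split; try exact: chain_comp.
- apply: homotopic_trans gf.
  have h := homotopic_compl gc (homotopic_compr fc gf').
  apply: (homotopic_trans _ (homotopic_trans h _)); apply: homotopic_ext => k.
    by rewrite /compc !comp_lfunA.
  by rewrite /compc comp_lfun1l.
- apply: homotopic_trans fg'.
  have h := homotopic_compl fc' (homotopic_compr gc' fg).
  apply: (homotopic_trans _ (homotopic_trans h _)); apply: homotopic_ext => k.
    by rewrite /compc !comp_lfunA.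
  by rewrite /compc comp_lfun1l.
Qed.

Lemma kb_iso_sym (X Y : kbproj A) : kb_iso X Y -> kb_iso Y X.
Proof. by move=> [f [g [fc gc gf fg]]]; exists g, f. Qed.

Lemma tcplx_map_inv W W' (a : 'Hom(tlow W, tlow W')) (b : 'Hom(thigh W, thigh W')) :
  tcplx_map a b -> lker a = 0%VS -> lker b = 0%VS -> limg a = fullv -> limg b = fullv ->
  exists a' b', [/\ tcplx_map a' b', (a' \o a = \1)%VF /\ (b' \o b = \1)%VF
    & (a \o a' = \1)%VF /\ (b \o b' = \1)%VF].
Proof.
move=> [ah bh ab] a0 b0 as_ bs.
have inv (M N : rmod A) (f : 'Hom(M, N)) : f \in homs M N -> lker f = 0%VS ->
    limg f = fullv -> [/\ (f^-1)%VF \in homs N M, (f^-1 \o f = \1)%VF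
    & (f \o f^-1 = \1)%VF].
  move=> fh f0 fs; have fK := lker0_lfunK (introT eqP f0).
  have fVK v : f ((f^-1)%VF v) = v by rewrite limg_lfunVK // fs memvf.
  split; last by apply/lfunP=> v; rewrite comp_lfunE fVK id_lfunE.
    by apply/homsP=> c v; apply: (lker0_inj f0); rewrite (homsE _ _ fh) !fVK.
  by apply/lfunP=> v; rewrite comp_lfunE fK id_lfunE.
have [a'h aa aa'] := inv _ _ a ah a0 as_; have [b'h bb bb'] := inv _ _ b bh b0 bs.
exists (a^-1)%VF, (b^-1)%VF; split=> //; split=> //.
rewrite -[RHS]comp_lfun1l -bb -comp_lfunA; congr (_ \o _)%VF.
by rewrite comp_lfunA ab -comp_lfunA aa' comp_lfun1r.
Qed.

Lemma lker0_limg_full (V : vectType K) (f : 'End(V)) : lker f = 0%VS -> limg f = fullv.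
Proof.
move=> f0; apply/eqP; rewrite eqEdim subvf /=.
by rewrite -(limg_ker_dim f fullv) f0 capv0 dimv0.
Qed.

(** Let E = i p. Some power of E is annihilated by 1 - e for an idempotent e, and
    since p E is homotopic to p, U is a retract of the image of e. By minimality
    e = 1, so E is invertible; being idempotent up to homotopy it is homotopic
    to the identity. *)
Lemma model_iso U W : is_model U W -> kb_iso U (kb_of W).
Proof.
move=> [[i [p [ic pc pi]]] Wmin]; pose E := compc i p.
have Ec : chain_map E by apply: chain_comp.
pose a : 'End(tlow W) := E (Negz 0); pose b : 'End(thigh W) := E (Posz 0).
have ab : tcplx_map a b by apply: chain_tcplx_map.
have EE k : E k = map_of a b k by apply: (@gmap_cplx_ofE _ _ W (cplx_of W)).
have pE : homotopic (compc p E) p.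
  apply: (homotopic_trans _ (homotopic_trans (homotopic_compr pc pi) _));
    apply: homotopic_ext => k; by rewrite /compc ?comp_lfunA // comp_lfun1l.
(* p absorbs E up to homotopy, because p i is homotopic to the identity. *)
have pEn n : homotopic (compc p (map_of (lfun_pow a n) (lfun_pow b n))) p.
  elim: n => [|n IH].
    by apply: homotopic_ext => k; rewrite /compc map_of_id comp_lfun1r.
  apply: homotopic_trans IH.
  have h := homotopic_compr (map_of_chain (tcplx_map_pow n ab)) pE.
  apply: (homotopic_trans _ h); apply: homotopic_ext => k.
  by rewrite /compc -comp_lfunA EE -[X in (_ \o X)%VF]map_of_comp.
have [n [e1 [e0 [ec [ee1 ee0] [ne1 ne0] e_one]]]] := fitting_tcplx ab.
have [W' [i1 [i0 [p1 [p0 [ic' pc' _ [ip1 ip0] e_dim]]]]]] := split_idem ec ee1 ee0.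
have [eE1 eE0] : e1 = \1%VF /\ e0 = \1%VF.
  apply/e_dim/Wmin; exists (compc (map_of p1 p0) i), (compc p (map_of i1 i0)).
  split; try by apply: chain_comp => //; apply: map_of_chain.
  apply: homotopic_trans pi.
  have h1 : homotopic (compc (compc p (map_of i1 i0)) (compc (map_of p1 p0) i))
      (compc (compc p (map_of e1 e0)) i).
    apply: homotopic_ext => k; rewrite /compc -comp_lfunA [X in (_ \o X)%VF]comp_lfunA.
    by rewrite -[X in (p k \o (X \o _))%VF]/(compc (map_of i1 i0) (map_of p1 p0) k) map_of_comp
      ip1 ip0 comp_lfunA.
  apply: homotopic_trans h1 _; apply: homotopic_compr => //.
  have h2 := homotopic_compr (map_of_chain ec) (homotopic_sym (pEn n)).
  apply: homotopic_trans h2 (homotopic_trans _ (pEn n)).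
  apply: homotopic_ext => k; rewrite /compc -comp_lfunA; congr (_ \o _)%VF.
  by rewrite -[LHS]/(compc _ _ k) map_of_comp ne1 ne0.
have [a0 b0] := e_one eE1 eE0.
have [a' [b' [ab' [a'a b'b] _]]] := tcplx_map_inv ab a0 b0 (lker0_limg_full a0)
  (lker0_limg_full b0).
exists i, p; split=> //.
(* An invertible map that is idempotent up to homotopy is homotopic to the
   identity. *)
have EEE : homotopic (compc E E) E.
  apply: (homotopic_trans _ (homotopic_compl ic pE)); apply: homotopic_ext => k.
  by rewrite /compc -comp_lfunA.
have := homotopic_compl (map_of_chain ab') EEE.
have inv k : compc (map_of a' b') E k = \1%VF.
  by rewrite /compc EE -[LHS]/(compc _ _ k) map_of_comp a'a b'b map_of_id.
move=> h; apply: homotopic_trans (homotopic_trans _ h) _; apply: homotopic_ext => k.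
  rewrite -[RHS]/(map_of a' b' k \o (E k \o E k))%VF comp_lfunA.
  by rewrite -[X in (X \o _)%VF]/(compc (map_of a' b') E k) inv comp_lfun1l.
exact: inv.
Qed.

(** Fitting's lemma: the idempotent e attached to the endomorphism splits W, and
    hence U, into two summands. One of them is contractible, so U is a retract
    of the other, which by minimality is all of W: e is 0 or 1. *)
Lemma model_dichotomy U W (a : 'End(tlow W)) (b : 'End(thigh W)) :
  kb_indecomposable U -> is_model U W -> tcplx_map a b ->
  (lker a = 0%VS /\ lker b = 0%VS) \/ exists n, lfun_pow a n = 0 /\ lfun_pow b n = 0.
Proof.
move=> [_ Uind] UW ab; have [i [p [ic pc pi ip]]] := model_iso UW; case: UW => _ Wmin.
have [n [e1 [e0 [ec [ee1 ee0] [ne1 ne0] e_one]]]] := fitting_tcplx ab.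
pose f1 : 'End(tlow W) := \1%VF - e1; pose f0 : 'End(thigh W) := \1%VF - e0.
have fc : tcplx_map f1 f0 by apply: tcplx_mapB ec; apply: tcplx_map_id.
have ortho (V : vectType K) (e : 'End(V)) : (e \o e = e)%VF ->
    [/\ ((\1%VF - e) \o (\1%VF - e) = \1%VF - e)%VF, (e \o (\1%VF - e) = 0)%VF
      & ((\1%VF - e) \o e = 0)%VF].
  move=> ee; rewrite comp_lfunDl comp_lfun1l comp_lfunNl comp_lfunDr comp_lfun1r comp_lfunNr.
  rewrite ee subrr oppr0 addr0; split=> //.
  by rewrite comp_lfunDl comp_lfun1l comp_lfunNl ee subrr.
have [ff1 ef1 fe1] := ortho _ _ ee1; have [ff0 ef0 fe0] := ortho _ _ ee0.
have [W' [i1 [i0 [p1 [p0 [ic' pc' [pi1 pi0] [ip1 ip0] e_dim]]]]]] := split_idem ec ee1 ee0.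
have [W'' [j1 [j0 [q1 [q0 [jc qc [qj1 qj0] [jq1 jq0] f_dim]]]]]] := split_idem fc ff1 ff0.
pose Wb (c : bool) := if c then W' else W''.
pose inj c : gmap (kb_of (Wb c)) U := match c return gmap (kb_of (Wb c)) U with
  | true => compc p (map_of i1 i0) | false => compc p (map_of j1 j0) end.
pose prj c : gmap U (kb_of (Wb c)) := match c return gmap U (kb_of (Wb c)) with
  | true => compc (map_of p1 p0) i | false => compc (map_of q1 q0) i end.
have inner (X Y : tcplx A) (x1 : 'Hom(tlow X, tlow W)) (x0 : 'Hom(thigh X, thigh W))
    (y1 : 'Hom(tlow W, tlow Y)) (y0 : 'Hom(thigh W, thigh Y)) : tcplx_map x1 x0 -> tcplx_map y1
      y0 ->
    homotopic (compc (compc (map_of y1 y0) i) (compc p (map_of x1 x0)))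
      (map_of (y1 \o x1)%VF (y0 \o x0)%VF).
  move=> xc yc.
  have h := homotopic_compl (map_of_chain yc) (homotopic_compr (map_of_chain xc) ip).
  apply: (homotopic_trans _ (homotopic_trans h _)); apply: homotopic_ext => k.
    by rewrite /compc !comp_lfunA.
  by rewrite -map_of_comp /compc comp_lfun1l.
have outer (X : tcplx A) (x1 : 'Hom(tlow X, tlow W)) (x0 : 'Hom(thigh X, thigh W))
    (y1 : 'Hom(tlow W, tlow X)) (y0 : 'Hom(thigh W, thigh X)) k :
    compc (compc p (map_of x1 x0)) (compc (map_of y1 y0) i) k
      = (p k \o (map_of (x1 \o y1)%VF (x0 \o y0)%VF k \o i k))%VF.
  by rewrite -map_of_comp /compc !comp_lfunA.
have qi1 : (q1 \o i1 = 0)%VF.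
  rewrite -[q1]comp_lfun1l -qj1 -[i1]comp_lfun1r -pi1 -!comp_lfunA.
  rewrite [(j1 \o _)%VF]comp_lfunA jq1 [(i1 \o _)%VF]comp_lfunA ip1.
  by rewrite [(f1 \o _)%VF]comp_lfunA fe1 comp_lfun0l comp_lfun0r.
have qi0 : (q0 \o i0 = 0)%VF.
  rewrite -[q0]comp_lfun1l -qj0 -[i0]comp_lfun1r -pi0 -!comp_lfunA.
  rewrite [(j0 \o _)%VF]comp_lfunA jq0 [(i0 \o _)%VF]comp_lfunA ip0.
  by rewrite [(f0 \o _)%VF]comp_lfunA fe0 comp_lfun0l comp_lfun0r.
have pj1 : (p1 \o j1 = 0)%VF.
  rewrite -[p1]comp_lfun1l -pi1 -[j1]comp_lfun1r -qj1 -!comp_lfunA.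
  rewrite [(i1 \o _)%VF]comp_lfunA ip1 [(j1 \o _)%VF]comp_lfunA jq1.
  by rewrite [(e1 \o _)%VF]comp_lfunA ef1 comp_lfun0l comp_lfun0r.
have pj0 : (p0 \o j0 = 0)%VF.
  rewrite -[p0]comp_lfun1l -pi0 -[j0]comp_lfun1r -qj0 -!comp_lfunA.
  rewrite [(i0 \o _)%VF]comp_lfunA ip0 [(j0 \o _)%VF]comp_lfunA jq0.
  by rewrite [(e0 \o _)%VF]comp_lfunA ef0 comp_lfun0l comp_lfun0r.
have map_of0 (X Y : tcplx A) : forall k, map_of (0 : 'Hom(tlow X, tlow Y)) (0 : 'Hom(thigh X,
  thigh Y)) k = 0.
  by apply: (@gmap_cplx_ofE _ _ X (cplx_of Y) _ (fun=> 0)).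
have map_of_null (X Y : tcplx A) : null_homotopic (map_of (0 : 'Hom(tlow X, tlow Y)) (0 :
  'Hom(thigh X, thigh Y))).
  by apply: null_homotopic_ext (@null_homotopic0 _ _ _ _) => k; rewrite map_of0.
have null_of (X Y : cplx A) (f g : gmap X Y) : homotopic f g -> null_homotopic g ->
  null_homotopic f.
  by move=> fg /(null_homotopicD fg); apply: null_homotopic_ext => k; rewrite subrK.
have map_ofD (X Y : tcplx A) (x1 y1 : 'Hom(tlow X, tlow Y)) (x0 y0 : 'Hom(thigh X, thigh Y)) k :
    map_of x1 x0 k + map_of y1 y0 k = map_of (x1 + y1) (x0 + y0) k.
  by apply: (@gmap_cplx_ofE _ _ X (cplx_of Y) (fun k => map_of x1 x0 k + map_of y1 y0 k)).
(* The two projectors sum to the identity of W, and p i is homotopic to the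
   identity of U. *)
have sum_one : homotopic (fun k => \sum_c compc (inj c) (prj c) k) (@idc _ _ U).
  apply: homotopic_trans pi; apply: homotopic_ext => k.
  rewrite (bigD1 true) // (big_pred1 false) /=; last by case.
  rewrite !outer -comp_lfunDr -comp_lfunDl map_ofD ip1 ip0 jq1 jq0 /f1 /f0.
  by rewrite ![_ + (\1%VF - _)]addrC !subrK map_of_id comp_lfun1l.
have /Uind[c] : kb_dsum U (fun c => kb_of (Wb c)).
  exists inj, prj; split.
  - by case; apply: chain_comp => //; apply: map_of_chain.
  - by case; apply: chain_comp => //; apply: map_of_chain.
  - case; [have := inner _ _ _ _ _ _ ic' pc' | have := inner _ _ _ _ _ _ jc qc];
      move=> h; apply: (homotopic_trans h); apply: homotopic_ext => k.
      by rewrite pi1 pi0 map_of_id.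
    by rewrite qj1 qj0 map_of_id.
  - case=> [] [] // _; [have := inner _ _ _ _ _ _ ic' qc | have := inner _ _ _ _ _ _ jc pc'];
      move=> h; apply: (null_of _ _ _ _ h).
      by rewrite qi1 qi0.
    by rewrite pj1 pj0.
  - exact: sum_one.
have retr (c' : bool) : kb_zero (kb_of (Wb (~~ c'))) -> homotopy_retract U (cplx_of (Wb c')).
  move=> Z; exists (prj c'), (inj c'); split.
  - by case: (c'); apply: chain_comp => //; apply: map_of_chain.
  - by case: (c'); apply: chain_comp => //; apply: map_of_chain.
  have prjc : chain_map (prj (~~ c')) by case: (c'); apply: chain_comp => //; apply: map_of_chain.
  have injc : chain_map (inj (~~ c')) by case: (c'); apply: chain_comp => //; apply: map_of_chain.
  have := null_homotopic_compl injc (null_homotopic_compr prjc Z).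
  move=> /null_homotopicN h; have := null_homotopicD sum_one h.
  apply: null_homotopic_ext => k.
  rewrite (bigD1 c') // (big_pred1 (~~ c')) /=; last by case: (c'); case.
  by rewrite /compc /idc comp_lfun1l addrAC addrK.
case: c => Z.
  right; exists n; have /f_dim[f1E f0E] := Wmin _ (retr false Z).
  have e10 : e1 = 0 by rewrite -[e1](subKr \1%VF) -/f1 f1E subrr.
  have e00 : e0 = 0 by rewrite -[e0](subKr \1%VF) -/f0 f0E subrr.
  by rewrite -ne1 -ne0 e10 e00 !comp_lfun0r.
left; have /e_dim[e1E e0E] := Wmin _ (retr true Z).
exact: e_one.
Qed.

End Models.

(** * Endomorphisms factoring through the other summands *)

Section Radical.
Variables (K : fieldType) (A : falgType K) (m : nat) (W : 'I_m -> tcplx A).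

(** The W i are pairwise not isomorphic, and their endomorphism rings are local
    in the strong form that endomorphisms are invertible or nilpotent. *)
Hypothesis dichotomy : forall i (a : 'End(tlow (W i))) (b : 'End(thigh (W i))),
  tcplx_map a b -> (lker a = 0%VS /\ lker b = 0%VS) \/ exists n, lfun_pow a n = 0 /\ lfun_pow b
    n = 0.
Hypothesis W_nonzero : forall i, ~ (mzero (tlow (W i)) /\ mzero (thigh (W i))).
Hypothesis W_distinct : forall i j (a : 'Hom(tlow (W i), tlow (W j)))
    (b : 'Hom(thigh (W i), thigh (W j))), tcplx_map a b -> lker a = 0%VS -> lker b = 0%VS ->
  limg a = fullv -> limg b = fullv -> i = j.

Lemma lker_comp (U V T : vectType K) (f : 'Hom(U, V)) (g : 'Hom(V, T)) :
  lker (g \o f)%VF = 0%VS -> lker f = 0%VS.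
Proof.
move=> gf; apply: lker_eq0 => v fv; apply: (lker0_inj gf).
by rewrite linear0 comp_lfunE fv linear0.
Qed.

Lemma limg_compr (U V T : vectType K) (f : 'Hom(U, V)) (g : 'Hom(V, T)) :
  limg (g \o f)%VF = fullv -> limg g = fullv.
Proof.
move=> gf; apply/eqP; rewrite eqEsubv subvf -gf limg_comp.
by apply: limgS; rewrite subvf.
Qed.

Lemma lfun_pow_swap (U V : vectType K) (f : 'Hom(U, V)) (g : 'Hom(V, U)) n :
  lfun_pow (f \o g)%VF n = 0 -> lfun_pow (g \o f)%VF n.+1 = 0.
Proof.
move=> h; have e k v : iter k.+1 (g \o f)%VF v = g (iter k (f \o g)%VF (f v)).
  elim: k => [|k IHk]; first by rewrite /= comp_lfunE.
  by rewrite iterS IHk comp_lfunE [in RHS]iterS [in RHS]comp_lfunE.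
by apply/lfunP=> v; rewrite lfun_powE e -lfun_powE h !zero_lfunE linear0.
Qed.

Lemma nilpotent_not_injective i (a : 'End(tlow (W i))) (b : 'End(thigh (W i))) n :
  lker a = 0%VS -> lker b = 0%VS -> lfun_pow a n = 0 -> lfun_pow b n = 0 -> False.
Proof.
move=> a0 b0 an bn; apply: (@W_nonzero i).
have inj (M : rmod A) (f : 'End(M)) k : lker f = 0%VS -> lfun_pow f k = 0 -> mzero M.
  move=> f0 fn; apply/mzeroP=> v.
  have : lfun_pow f k v = 0 by rewrite fn zero_lfunE.
  elim: k {fn} => [|k IH] /=; first by rewrite id_lfunE.
  by rewrite comp_lfunE -[RHS](linear0 f) => /(lker0_inj f0).
by split; [apply: inj a0 an | apply: inj b0 bn].
Qed.

(** If f v = v then v = f^n v = 0. *)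
Lemma nilpotent_one_sub (V : vectType K) (f : 'End(V)) n :
  lfun_pow f n = 0 -> lker (\1%VF - f) = 0%VS.
Proof.
move=> fn; apply: lker_eq0 => v; rewrite add_lfunE opp_lfunE id_lfunE.
move=> /eqP; rewrite subr_eq0 => /eqP vE.
have : lfun_pow f n v = 0 by rewrite fn zero_lfunE.
rewrite lfun_powE; elim: n {fn} => [//|k IH].
by rewrite iterSr -vE.
Qed.

(** Otherwise the composite W j -> W i -> W j is not nilpotent, so it is
    invertible by the dichotomy, and W i and W j are isomorphic. *)
Lemma through_not_injective i j (g1 : 'Hom(tlow (W i), tlow (W j))) (g0 : 'Hom(thigh (W i),
  thigh (W j)))
    (h1 : 'Hom(tlow (W j), tlow (W i))) (h0 : 'Hom(thigh (W j), thigh (W i))) :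
  j != i -> tcplx_map g1 g0 -> tcplx_map h1 h0 ->
  lker (h1 \o g1)%VF = 0%VS -> lker (h0 \o g0)%VF = 0%VS -> False.
Proof.
move=> ji gc hc a0 b0; have [[c0 d0]|[n [an bn]]] := dichotomy (tcplx_map_comp hc gc).
  move/eqP: ji; apply; apply/esym/(W_distinct gc).
  - exact: lker_comp a0.
  - exact: lker_comp b0.
  - exact: limg_compr (lker0_limg_full c0).
  - exact: limg_compr (lker0_limg_full d0).
exact: (nilpotent_not_injective a0 b0 (lfun_pow_swap an) (lfun_pow_swap bn)).
Qed.

(** The usual argument for local rings, by induction on the number of terms.
    Multiply by the inverse of the sum, so that the terms sum to 1. If the first
    one is not invertible it is nilpotent, and the others still have an
    invertible sum. *)
Lemma sum_through_not_injective i n (j : 'I_n -> 'I_m)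
    (g1 : forall k, 'Hom(tlow (W i), tlow (W (j k)))) (g0 : forall k, 'Hom(thigh (W i), thigh
      (W (j k))))
    (h1 : forall k, 'Hom(tlow (W (j k)), tlow (W i))) (h0 : forall k, 'Hom(thigh (W (j k)),
      thigh (W i))) :
  (forall k, j k != i) -> (forall k, tcplx_map (g1 k) (g0 k)) -> (forall k, tcplx_map (h1 k)
    (h0 k)) ->
  lker (\sum_k (h1 k \o g1 k)%VF) = 0%VS -> lker (\sum_k (h0 k \o g0 k)%VF) = 0%VS -> False.
Proof.
elim: n j g1 g0 h1 h0 => [|n IH] j g1 g0 h1 h0 ji gc hc.
  rewrite !big_ord0 => a0 b0; apply: (@W_nonzero i).
  by split; apply/mzeroP=> v; [apply: (lker0_inj a0) | apply: (lker0_inj b0)];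
    rewrite !zero_lfunE.
set a := \sum_k _; set b := \sum_k _ => a0 b0.
have ab : tcplx_map a b by apply: tcplx_map_sum => k; apply: tcplx_map_comp.
have [a' [b' [ab' [a'a b'b] [aa' bb']]]] := tcplx_map_inv ab a0 b0 (lker0_limg_full a0)
  (lker0_limg_full b0).
have ab0 := tcplx_map_comp (gc ord0) (hc ord0).
have [[x0 y0]|[k [xk yk]]] := dichotomy (tcplx_map_comp ab0 ab').
  exact: (through_not_injective (ji ord0) (gc ord0) (hc ord0) (lker_comp x0) (lker_comp y0)).
have rest (V : vectType K) (s s' x y : 'End(V)) : (s' \o s = \1)%VF -> s = x + y ->
    lfun_pow (s' \o x)%VF k = 0 -> lker y = 0%VS.
  move=> s's sE /nilpotent_one_sub; rewrite -s's {1}sE comp_lfunDr addrAC subrr add0r.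
  exact: lker_comp.
apply: (IH (fun k => j (fintype.lift ord0 k)) (fun k => g1 _) (fun k => g0 _)
  (fun k => h1 _) (fun k => h0 _)) => //.
  by apply: rest a'a _ xk; rewrite /a big_ord_recl.
by apply: rest b'b _ yk; rewrite /b big_ord_recl.
Qed.

Lemma sum_through_nilpotent i n (j : 'I_n -> 'I_m)
    (g1 : forall k, 'Hom(tlow (W i), tlow (W (j k)))) (g0 : forall k, 'Hom(thigh (W i), thigh
      (W (j k))))
    (h1 : forall k, 'Hom(tlow (W (j k)), tlow (W i))) (h0 : forall k, 'Hom(thigh (W (j k)),
      thigh (W i))) :
  (forall k, j k != i) -> (forall k, tcplx_map (g1 k) (g0 k)) -> (forall k, tcplx_map (h1 k)
    (h0 k)) ->
  exists d, lfun_pow (\sum_k (h1 k \o g1 k)%VF) d = 0 /\ lfun_pow (\sum_k (h0 k \o g0 k)%VF) d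
    = 0.
Proof.
move=> ji gc hc; case: (@dichotomy i (\sum_k (h1 k \o g1 k)%VF) (\sum_k (h0 k \o g0 k)%VF)) => //.
  by apply: tcplx_map_sum => k; apply: tcplx_map_comp.
by case=> a0 b0; case: (sum_through_not_injective ji gc hc a0 b0).
Qed.

(** Lift all maps to complexes; there the composite is nilpotent. *)
Lemma cokerH_radical i n (j : 'I_n -> 'I_m)
    (g : forall k, 'Hom(cokerH (W i), cokerH (W (j k)))) (h : forall k, 'Hom(cokerH (W (j k)),
      cokerH (W i))) :
  (forall k, j k != i) -> (forall k, g k \in homs (cokerH (W i)) (cokerH (W (j k)))) ->
  (forall k, h k \in homs (cokerH (W (j k))) (cokerH (W i))) ->
  exists d, forall v, iter d (fun v => \sum_k h k (g k v)) v = 0.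
Proof.
move=> ji gh hh.
pose g1 k := sval (cid (lift_H (gh k))); pose g0 k := sval (cid (svalP (cid (lift_H (gh k))))).
pose h1 k := sval (cid (lift_H (hh k))); pose h0 k := sval (cid (svalP (cid (lift_H (hh k))))).
have gP k : tcplx_map (g1 k) (g0 k) /\ (g k \o cokerH_proj (W i) = cokerH_proj (W (j k)) \o g0
  k)%VF.
  exact: svalP (cid (svalP (cid (lift_H (gh k))))).
have hP k : tcplx_map (h1 k) (h0 k) /\ (h k \o cokerH_proj (W (j k)) = cokerH_proj (W i) \o h0
  k)%VF.
  exact: svalP (cid (svalP (cid (lift_H (hh k))))).
have [d [_ d0]] := sum_through_nilpotent ji (fun k => (gP k).1) (fun k => (hP k).1).
exists d => v; have [_ ps _] := cokerH_projP (W i); have [u <-] := limg_fullP v ps.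
suff -> : iter d (fun v => \sum_k h k (g k v)) (cokerH_proj (W i) u)
    = cokerH_proj (W i) (lfun_pow (\sum_k (h0 k \o g0 k)%VF) d u) by rewrite d0 zero_lfunE
      linear0.
rewrite lfun_powE; elim: d {d0} => //= d ->; set x := iter _ _ _.
rewrite sum_lfunE linear_sum; apply: eq_bigr => k _ /=.
by rewrite -[g k _]comp_lfunE (gP k).2 comp_lfunE -[LHS]comp_lfunE (hP k).2 !comp_lfunE.
Qed.

Lemma nuf_sum (M N : rmod A) n (f : 'I_n -> 'Hom(M, N)) :
  (forall k, f k \in homs M N) -> nuf (\sum_k f k) = \sum_k nuf (f k).
Proof.
elim: n f => [|n IH] f fh; first by rewrite !big_ord0 nuf0.
have rh : \sum_(k < n) f (fintype.lift ord0 k) \in homs M N.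
  by apply: memv_suml => k _; apply: fh.
by rewrite !big_ord_recl nufD ?fh // IH // => k; apply: fh.
Qed.

Lemma kerN_radical i n (j : 'I_n -> 'I_m)
    (g : forall k, 'Hom(kerN (W i), kerN (W (j k)))) (h : forall k, 'Hom(kerN (W (j k)), kerN
      (W i))) :
  (forall k, j k != i) -> (forall k, g k \in homs (kerN (W i)) (kerN (W (j k)))) ->
  (forall k, h k \in homs (kerN (W (j k))) (kerN (W i))) ->
  exists d, forall v, iter d (fun v => \sum_k h k (g k v)) v = 0.
Proof.
move=> ji gh hh.
pose g1 k := sval (cid (lift_N (gh k))); pose g0 k := sval (cid (svalP (cid (lift_N (gh k))))).
pose h1 k := sval (cid (lift_N (hh k))); pose h0 k := sval (cid (svalP (cid (lift_N (hh k))))).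
have gP k : tcplx_map (g1 k) (g0 k) /\ (kerN_inc (W (j k)) \o g k = nuf (g1 k) \o kerN_inc (W
  i))%VF.
  exact: svalP (cid (svalP (cid (lift_N (gh k))))).
have hP k : tcplx_map (h1 k) (h0 k) /\ (kerN_inc (W i) \o h k = nuf (h1 k) \o kerN_inc (W (j
  k)))%VF.
  exact: svalP (cid (svalP (cid (lift_N (hh k))))).
have [d [d0 _]] := sum_through_nilpotent ji (fun k => (gP k).1) (fun k => (hP k).1).
have [_ i0 _] := kerN_incP (W i).
have gh1 k : g1 k \in homs _ _ by case: (gP k) => -[].
have hh1 k : h1 k \in homs _ _ by case: (hP k) => -[].
pose a := \sum_k (h1 k \o g1 k)%VF.
have ah : a \in homs _ _ by apply: memv_suml => k _; apply: homs_comp.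
exists d => v; apply: (lker0_inj i0); rewrite linear0.
suff -> : kerN_inc (W i) (iter d (fun v => \sum_k h k (g k v)) v) = nuf (lfun_pow a d)
  (kerN_inc (W i) v).
  by rewrite d0 nuf0 zero_lfunE.
elim: d {d0} => /= [|d IH]; first by rewrite nuf_id id_lfunE.
set x := iter _ _ _ in IH *.
have adh : lfun_pow a d \in homs _ _.
  elim: d {IH x} => [|d IH] /=; [exact: homs_id | exact: homs_comp IH ah].
rewrite nuf_comp // comp_lfunE -IH nuf_sum; last by move=> k; apply: homs_comp.
rewrite sum_lfunE linear_sum; apply: eq_bigr => k _ /=.
rewrite nuf_comp // comp_lfunE -[nuf (g1 k) _]comp_lfunE -(gP k).2 comp_lfunE.
by rewrite -[RHS]comp_lfunE -(hP k).2 comp_lfunE.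
Qed.

End Radical.

(** * Consequences of indecomposability and of the presilting condition *)

Section Presilting.
Variables (K : fieldType) (A : falgType K).
Implicit Types (W : tcplx A) (U : kbproj A).

Lemma kb_zero_retract U W : homotopy_retract U (cplx_of W) -> kb_zero (kb_of W) -> kb_zero U.
Proof.
move=> [i [p [ic pc pi]]] W0.
have h := null_homotopic_compl pc (null_homotopic_compr ic W0).
have := null_homotopicD (homotopic_sym pi) h; apply: null_homotopic_ext => k.
by rewrite /compc /idc comp_lfun1l subrK.
Qed.

(** If both modules vanish, then Hom(W, X) is acyclic for all X, so the identity
    of degree -1 factors through d; as d is onto, W is contractible. *)
Lemma model_nonzero U W : ~ kb_zero U -> homotopy_retract U (cplx_of W) ->
  ~ mzero (cokerH W) \/ ~ mzero (kerN W).
Proof.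
move=> U0 UW; have [H0|] := pselect (mzero (cokerH W)); last by left.
have [N0|] := pselect (mzero (kerN W)); last by right.
exfalso; apply/U0/(kb_zero_retract UW).
have [ph ps pK] := cokerH_projP W.
have ds : limg (tdif W) = fullv.
  by rewrite -pK; apply/vspaceP=> v; rewrite memvf memv_ker (mzero_colfun (cokerH_proj W) H0)
    zero_lfunE eqxx.
have hH X : hdim (cokerH W) X = 0%N.
  by apply/hdim_eq0P=> f _; apply: mzero_lfun.
have hN X : hdim X (kerN W) = 0%N.
  by apply/hdim_eq0P=> f _; apply: mzero_colfun.
have := hdim_two_term W (tlow W); rewrite hdim_cokerH hH hN addn0 !add0n => e.
have : (precompl (tlow W) (tdif W) @: homs (thigh W) (tlow W))%VS == homs (tlow W) (tlow W).
  rewrite eqEdim e leqnn andbT; apply/subvP=> _ /memv_imgP[f fh ->].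
  by rewrite precomplE (homs_comp (tdif_homs W) fh).
move=> /eqP im; have := homs_id (tlow W); rewrite -im => /memv_imgP[s sh].
rewrite precomplE => sd.
have ds1 : (tdif W \o s = \1)%VF.
  apply/eqP; rewrite -subr_eq0; apply/eqP/(comp_epi_eq0 ds).
  by rewrite comp_lfunDl comp_lfunNl comp_lfun1l -comp_lfunA -sd comp_lfun1r subrr.
pose h k l : 'Hom(cplx_of_ob W k, cplx_of_ob W l) := match k, l return 'Hom(cplx_of_ob W k,
  cplx_of_ob W l) with
  | Posz 0, Negz 0 => s | _, _ => 0 end.
exists h; split.
  by move=> k l; case: k => [[|k]|[|k]]; case: l => [[|l]|[|l]]; (exact: sh || exact: homs0).
apply: (@gmap_cplx_ofE _ _ W (cplx_of W) (@idc _ _ _)).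
  rewrite -[LHS]/(\1%VF : 'End(tlow W)) sd.
  by rewrite -[RHS]/(0 \o 0 + (s \o tdif W))%VF comp_lfun0r add0r.
rewrite -[LHS]/(\1%VF : 'End(thigh W)) -ds1.
by rewrite -[RHS]/((tdif W \o s) + (0 \o 0))%VF comp_lfun0r addr0.
Qed.

Section Shifted.
Variables (W W' : tcplx A) (al : 'Hom(tlow W, thigh W')).
Hypothesis alh : al \in homs (tlow W) (thigh W').

(** A map W -> W'[1] amounts to a module map from degree -1 of W to degree 0 of
    W'. *)
Definition shift_map : gmap (cplx_of W) (shift (cplx_of W') 1) := fun i =>
  match i return 'Hom(cplx_of_ob W i, cplx_of_ob W' (i + 1)) with Negz 0 => al | _ => 0 end.

Lemma shift_map_chain : chain_map shift_map.
Proof.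
split=> [i|i j].
  by case: i => [[|i]|[|i]]; (exact: alh || exact: homs0).
have z0 W0 k : cplx_of_dif W0 (Posz 0) k = 0 by case: k => [[|k]|[|k]].
have -> : (shift_map j \o dif (cplx_of W) i j)%VF = 0.
  by case: i => [[|i]|[|i]]; case: j => [[|j]|[|j]]; (exact: comp_lfun0l || exact: comp_lfun0r).
have -> // : (dif (shift (cplx_of W') 1) i j \o shift_map i)%VF = 0.
case: i => [[|i]|[|i]]; try exact: comp_lfun0r.
by rewrite -[dif _ _ _]/((-1 : K) ^ 1 *: cplx_of_dif W' (Posz 0) (j + 1)) z0 scaler0 comp_lfun0l.
Qed.

End Shifted.

Lemma shift_chain (X Y : cplx A) (f : gmap X Y) l : chain_map f ->
  chain_map (fun i => f (i + l) : 'Hom(shift X l i, shift Y l i)).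
Proof.
move=> [fh fd]; split=> [i|i j]; first exact: fh.
by rewrite /= -comp_lfunZr -comp_lfunZl fd.
Qed.

(** al defines a chain map W -> W'[1]. Transported to U -> U[1] it is null
    homotopic; transporting the homotopy back gives the factorization for al
    conjugated by p i and p' i'. These are homotopic to the identity, which adds
    further terms of the same form. *)
Lemma presilting_factor U W W' (al : 'Hom(tlow W, thigh W')) :
  presilting U -> homotopy_retract (cplx_of W) U -> homotopy_retract (cplx_of W') U ->
  al \in homs (tlow W) (thigh W') ->
  exists (s : 'Hom(tlow W, tlow W')) (t : 'Hom(thigh W, thigh W')),
    [/\ s \in homs (tlow W) (tlow W'), t \in homs (thigh W) (thigh W')
      & al = ((tdif W' \o s) + (t \o tdif W))%VF].
Proof.
move=> Ups [i [p [ic pc [h [hh pi]]]]] [i' [p' [ic' pc' [h' [hh' pi']]]]] alh.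
have ac := shift_map_chain alh.
pose si : gmap (shift (cplx_of W') 1) (shift U 1) := fun k => i' (k + 1).
pose sp : gmap (shift U 1) (shift (cplx_of W') 1) := fun k => p' (k + 1).
have sic : chain_map si by apply: shift_chain.
have spc : chain_map sp by apply: shift_chain.
have N : null_homotopic (compc si (compc (shift_map al) p)).
  by apply: (Ups 1) => //; apply: chain_comp => //; apply: chain_comp.
have [k [kh kE]] := null_homotopic_compl spc (null_homotopic_compr ic N).
pose F : 'End(tlow W) := (p (Negz 0) \o i (Negz 0))%VF.
pose G : 'End(thigh W') := (p' (Posz 0) \o i' (Posz 0))%VF.
pose x : 'Hom(thigh W, tlow W) := h (Posz 0) (Negz 0).
pose x' : 'Hom(thigh W', tlow W') := h' (Posz 0) (Negz 0).
pose y : 'Hom(tlow W, tlow W') := k (Negz 0) (Negz 1).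
pose z : 'Hom(thigh W, thigh W') := k (Posz 0) (Negz 0).
(* In degree -1 the homotopy for W has one term only, as W is zero in degree
   -2; similarly in degree 0 for W'. *)
have FE : F = \1%VF + (x \o tdif W)%VF.
  have /eqP := pi (Negz 0); rewrite subr_eq => /eqP.
  rewrite -[LHS]/F => ->.
  rewrite -[X in (X + _) + _ = _]/(0 \o _)%VF comp_lfun0l add0r addrC.
  by congr (_ + _).
have GE : G = \1%VF + (tdif W' \o x')%VF.
  have /eqP := pi' (Posz 0); rewrite subr_eq => /eqP.
  rewrite -[LHS]/G => ->.
  rewrite -[X in (_ + X) + _ = _]/(_ \o 0)%VF comp_lfun0r addr0 addrC.
  by congr (_ + _).
have aE : (G \o (al \o F))%VF = ((- tdif W' \o y) + (z \o tdif W))%VF.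
  have /= e := kE (Negz 0).
  transitivity (p' (Posz 0) \o ((i' (Posz 0) \o (al \o p (Negz 0))) \o i (Negz 0)))%VF.
    by rewrite /G /F !comp_lfunA.
  apply: etrans e _; congr (_ + _).
  by rewrite expr1z scaleN1r.
have [xh xh' yh zh] : [/\ x \in homs (thigh W) (tlow W), x' \in homs (thigh W') (tlow W'),
    y \in homs (tlow W) (tlow W') & z \in homs (thigh W) (thigh W')].
  split; [exact: (hh (Posz 0) (Negz 0)) | exact: (hh' (Posz 0) (Negz 0))
    | exact: (kh (Negz 0) (Negz 1)) | exact: (kh (Posz 0) (Negz 0))].
have Fh : F \in homs (tlow W) (tlow W).
  by rewrite FE memvD ?homs_id // (homs_comp (tdif_homs W) xh).
exists (- y - (x' \o (al \o F))%VF), (z - (al \o x)%VF); split.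
- by rewrite memvB ?memvN // (homs_comp (homs_comp Fh alh) xh').
- by rewrite memvB // (homs_comp xh alh).
have e1 : (G \o (al \o F))%VF = al + (al \o (x \o tdif W))%VF + (tdif W' \o (x' \o (al \o F)))%VF.
  rewrite GE comp_lfunDl comp_lfun1l {1}FE comp_lfunDr comp_lfun1r.
  by rewrite -comp_lfunA.
have {1}-> : al = (- tdif W' \o y)%VF + (z \o tdif W)%VF - (tdif W' \o (x' \o (al \o F)))%VF
    - (al \o (x \o tdif W))%VF by rewrite -aE e1 !addrK.
rewrite comp_lfunDr comp_lfunDl !comp_lfunNr !comp_lfunNl -!comp_lfunA.
by rewrite -addrA addrACA.
Qed.

(** Maps into the second term are dual to the maps from degree -1 of W to the
    cokernel for W', modulo those that factor through d. Each of them lifts to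
    degree 0 of W', and presilting_factor shows that it factors through d. *)
Lemma presilting_hdim U W W' : presilting U -> homotopy_retract (cplx_of W) U ->
  homotopy_retract (cplx_of W') U ->
  hdim (cokerH W') (kerN W) = 0%N.
Proof.
move=> Ups Wr Wr'; have [ih i0 iI] := kerN_incP W; have [ph ps pK] := cokerH_projP W'.
have := hdim_nu_kernel (cokerH W') (@tlow_proj _ _ W) (@thigh_proj _ _ W) (tdif_homs W) ih i0 iI.
rewrite -[RHS]add0n; set B := (_ @: _)%VS; suff -> : \dim B = hdim (tlow W) (cokerH W').
  by move/addIn.
congr (\dim _); apply/eqP; rewrite eqEsubv; apply/andP; split.
  by apply/subvP=> _ /memv_imgP[f fh ->]; rewrite precomplE (homs_comp (tdif_homs W) fh).
apply/subvP=> f fh.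
have [al alh alE] := @tlow_proj _ _ W _ _ _ f ph ps fh.
have [s [t [sh th aE]]] := presilting_factor Ups Wr Wr' alh.
apply/memv_imgP; exists (cokerH_proj W' \o t)%VF; first exact: homs_comp th ph.
rewrite precomplE -alE aE comp_lfunDr comp_lfunA.
rewrite (_ : cokerH_proj W' \o tdif W' = 0)%VF ?comp_lfun0l ?add0r ?comp_lfunA //.
apply/lfunP=> v; rewrite comp_lfunE zero_lfunE; apply/eqP.
by rewrite -memv_ker pK memv_img ?memvf.
Qed.

End Presilting.

(** * Homotopy invariance of the Euler form *)

Section EulerInvariance.
Variables (R : realType) (K : fieldType) (A : falgType K).
Implicit Types (U V : kbproj A) (M : rmod A).

Section HomComplex.
Variables (X Y : cplx A) (M : rmod A).

Definition hom_cycles (Z : cplx A) k : {vspace 'Hom(Z k, M)} :=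
  (homs (Z k) M :&: lker (precompl M (dif Z (k - 1) k)))%VS.
Definition hom_boundaries (Z : cplx A) j k : {vspace 'Hom(Z j, M)} :=
  (precompl M (dif Z j k) @: homs (Z k) M)%VS.

Lemma hdim_hom_complex (Z : cplx A) k :
  hdim (Z k) M = (\dim (hom_cycles Z k) + \dim (hom_boundaries Z (k - 1) k))%N.
Proof. by rewrite /hdim limg_ker_dim. Qed.

Lemma hom_boundary_cycle (Z : cplx A) k : (hom_boundaries Z k (k + 1) <= hom_cycles Z k)%VS.
Proof.
apply/subvP=> _ /memv_imgP[f fh ->]; rewrite memv_cap memv_ker !precomplE.
by rewrite (homs_comp (dif_homs Z _ _) fh) -comp_lfunA dif_dif comp_lfun0r eqxx.
Qed.

(** A homotopy retraction embeds the cohomology of Hom(X, M) in that of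
    Hom(Y, M). With natural numbers the inequality between the dimensions of
    cycles modulo boundaries is stated without subtraction. *)
Lemma retract_hom_cohomology k : homotopy_retract X Y ->
  (\dim (hom_cycles X k) + \dim (hom_boundaries Y k (k + 1))
     <= \dim (hom_cycles Y k) + \dim (hom_boundaries X k (k + 1)))%N.
Proof.
move=> [i [p [[ih idif] [ph pd] [h [hh pi]]]]].
pose P := precompl M (p k).
have PZ : (P @: hom_cycles X k <= hom_cycles Y k)%VS.
  apply/subvP=> _ /memv_imgP[f fX ->]; move: fX; rewrite !memv_cap !memv_ker !precomplE.
  move=> /andP[fh /eqP fd]; rewrite (homs_comp (ph k) fh) -comp_lfunA pd comp_lfunA fd
    comp_lfun0l.
  by rewrite eqxx.
have PB f : f \in hom_cycles X k -> P f \in hom_boundaries Y k (k + 1) ->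
    f \in hom_boundaries X k (k + 1).
  rewrite memv_cap memv_ker precomplE => /andP[fh /eqP fd].
  rewrite /P precomplE => /memv_imgP[g gh]; rewrite precomplE => fp.
  have fE : f = (f \o (p k \o i k))%VF - (f \o (h (k + 1) k \o dif X k (k + 1)))%VF.
    have /eqP := pi k; rewrite subr_eq => /eqP; rewrite -[LHS]/(p k \o i k)%VF => ->.
    rewrite !comp_lfunDr comp_lfunA fd comp_lfun0l add0r comp_lfun1r.
    by rewrite addrC addKr.
  rewrite fE comp_lfunA fp -comp_lfunA -idif memvB //; last first.
    rewrite comp_lfunA -precomplE memv_img //; exact: homs_comp (hh _ _) fh.
  rewrite comp_lfunA -precomplE memv_img //; exact: homs_comp (ih _) gh.
set ZX := hom_cycles X k in PZ PB *; set BX := hom_boundaries X k _ in PB *.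
set BY := hom_boundaries Y k _ in PB *; set ZY := hom_cycles Y k in PZ *.
have BZX : (BX <= ZX)%VS := hom_boundary_cycle X k.
have BZY : (BY <= ZY)%VS := hom_boundary_cycle Y k.
have kerE : (ZX :&: lker P)%VS = (BX :&: lker P)%VS.
  apply/vspaceP=> f; rewrite [LHS]memv_cap [RHS]memv_cap.
  apply/andP/andP => -[fX fk]; split=> //.
    have Pf0 : P f = 0 by apply/eqP; rewrite -memv_ker.
    by apply: (PB f fX); rewrite Pf0 mem0v.
  exact: (subvP BZX).
have capE : (P @: ZX :&: BY <= P @: BX)%VS.
  apply/subvP=> _ /memv_capP[/memv_imgP[f fX ->] PfB].
  by rewrite memv_img // PB.
have e1 := limg_ker_dim P ZX; have e2 := limg_ker_dim P BX.
have e3 := dimv_sum_cap (P @: ZX) BY.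
have e4 := dimvS capE.
have e5 : (\dim (P @: ZX + BY) <= \dim ZY)%N by rewrite dimvS // subv_add PZ BZY.
by rewrite -e1 -e2 kerE -addnA [leqRHS]addnCA leq_add2l -e3 leq_add.
Qed.

End HomComplex.

Lemma kb_class_sum U n : (forall i : int, (n < `|i|)%N -> mzero (U i)) ->
  kb_class R U = \sum_(k < (n + n).+1)
    ((-1 : R) ^ (k%:Z - n%:Z)) *: K0_class R (@kc_proj K A U (k%:Z - n%:Z)).
Proof.
move=> Un; rewrite /kb_class; pose r := [seq k%:Z - n%:Z | k <- index_iota 0 (n + n).+1].
have mem_r (i : int) : (`|i| <= n)%N -> i \in r.
  by move=> i_le; apply/mapP; exists (absz (i + n%:Z)); rewrite ?mem_index_iota; lia.
rewrite (fsbigE r).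
- rewrite /r big_map big_mkord big_mkcond.
  by apply: eq_bigr => k _; rewrite in_setT.
- by rewrite map_inj_uniq ?iota_uniq // => a b /addIr [].
- by [].
- move=> i _ /negP iN0; rewrite K0_class0 ?scaler0 //; apply: Un.
  by rewrite ltnNge; apply/negP=> /mem_r.
Qed.

Lemma euler_kb_class U n M : (forall i : int, (n < `|i|)%N -> mzero (U i)) ->
  euler M (kb_class R U) = \sum_(k < (n + n).+1)
    (-1) ^ (k%:Z - n%:Z) * (hdim (U (k%:Z - n%:Z)) M)%:R.
Proof.
move=> Un; rewrite (kb_class_sum Un) linear_sum; apply: eq_bigr => k _.
by rewrite linearZ /= euler_class.
Qed.

(** The contributions of b telescope to boundary terms, which vanish. *)
Lemma alternating_sum (c z b : int -> nat) (n : nat) :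
  (forall i, c i = (z i + b (i - 1)%R)%N) -> b (- n%:Z - 1) = 0%N -> b n%:Z = 0%N ->
  \sum_(k < (n + n).+1) (-1 : R) ^ (k%:Z - n%:Z) * (c (k%:Z - n%:Z))%:R
  = \sum_(k < (n + n).+1)
      (-1 : R) ^ (k%:Z - n%:Z) * ((z (k%:Z - n%:Z))%:R - (b (k%:Z - n%:Z))%:R).
Proof.
move=> cE b0 bn; apply/eqP; rewrite -subr_eq0 -sumrB.
pose g (k : nat) : R := (-1) ^ (k%:Z - n%:Z) * (b (k%:Z - n%:Z - 1))%:R.
rewrite (eq_bigr (fun k : 'I_(n + n).+1 => - (g k.+1 - g k))) => [|k _].
  rewrite sumrN -(big_mkord predT (fun k => g k.+1 - g k)) telescope_sumr //.
  have -> : g (n + n).+1 = 0.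
    rewrite /g (_ : _ - 1 = n%:Z) ?bn ?mulr0 //; lia.
  have -> : g 0%N = 0 by rewrite /g sub0r b0 mulr0.
  by rewrite subrr oppr0.
rewrite cE natrD /g.
have -> : (k.+1)%:Z - n%:Z = (k%:Z - n%:Z) + 1 by lia.
rewrite addrK [_ ^ (_ + 1)]expfzDr ?oppr_eq0 ?oner_eq0 // expr1z.
ring.
Qed.

Lemma hom_boundaries0 (Z : cplx A) M j k : mzero (Z k) -> \dim (hom_boundaries M Z j k) = 0%N.
Proof.
move=> Z0; apply/eqP; rewrite dimv_eq0 -subv0; apply/subvP=> _ /memv_imgP[f _ ->].
by rewrite precomplE (mzero_lfun f Z0) comp_lfun0l mem0v.
Qed.

Lemma hom_boundaries0l (Z : cplx A) M j k : mzero (Z j) -> \dim (hom_boundaries M Z j k) = 0%N.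
Proof.
move=> Z0; apply/eqP; rewrite dimv_eq0 -subv0; apply/subvP=> f _.
by rewrite (mzero_lfun f Z0) mem0v.
Qed.

Lemma kb_iso_retract U V : kb_iso U V -> homotopy_retract U V.
Proof. by move=> [f [g [fc gc gf _]]]; exists f, g. Qed.

(** Both sides are alternating sums of the dimensions of the cohomology of
    Hom(-, M), which homotopy equivalences preserve. *)
Lemma euler_kb_iso U V M : kb_iso U V -> euler M (kb_class R U) = euler M (kb_class R V).
Proof.
move=> UV; have UrV := kb_iso_retract UV; have VrU := kb_iso_retract (kb_iso_sym UV).
have [n1 n1P] := kc_bounded U; have [n2 n2P] := kc_bounded V.
pose n := maxn n1 n2.
have Un i : (n < `|i|)%N -> mzero (U i) by move=> ni; apply: n1P; rewrite /n in ni; lia.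
have Vn i : (n < `|i|)%N -> mzero (V i) by move=> ni; apply: n2P; rewrite /n in ni; lia.
rewrite (euler_kb_class _ Un) (euler_kb_class _ Vn).
have cE (Z : kbproj A) i : hdim (Z i) M
    = (\dim (hom_cycles M Z i) + \dim (hom_boundaries M Z (i - 1) (i - 1 + 1)))%N.
  by rewrite subrK; exact: hdim_hom_complex.
(* Just outside the range of summation all terms of both complexes vanish. *)
have bl : (n < absz (- n%:Z - 1)%R)%N by lia.
have bn : (n < absz (n%:Z + 1)%R)%N by lia.
rewrite (@alternating_sum _ _ (fun i => \dim (hom_boundaries M U i (i + 1))) n (cE U)
  (hom_boundaries0l M _ (Un _ bl)) (hom_boundaries0 M _ (Un _ bn))).
rewrite (@alternating_sum _ _ (fun i => \dim (hom_boundaries M V i (i + 1))) n (cE V)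
  (hom_boundaries0l M _ (Vn _ bl)) (hom_boundaries0 M _ (Vn _ bn))).
apply: eq_bigr => k _; congr (_ * _).
have := retract_hom_cohomology M (k%:Z - n%:Z) UrV.
have := retract_hom_cohomology M (k%:Z - n%:Z) VrU.
rewrite -!(ler_nat R) !natrD; cbv beta => h1 h2; lra.
Qed.

Lemma euler_kb_of (W : tcplx A) M :
  euler M (kb_class R (kb_of W)) = (hdim (thigh W) M)%:R - (hdim (tlow W) M)%:R.
Proof.
rewrite (@euler_kb_class _ 1) => [|i i1]; last first.
  by apply: cplx_of_ob_zero => i0; move: i1; rewrite i0.
rewrite !big_ord_recl big_ord0 /=.
have -> : hdim (zero_rmod A) M = 0%N.
  by apply/hdim_eq0P=> f _; apply: mzero_lfun; apply: zero_rmod_mzero.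
by rewrite mulr0 !addr0 subrr expr0z mul1r sub0r exprN1 invrN1 mulN1r addrC.
Qed.

End EulerInvariance.

(** * The cones of U and of its summands *)

Section Assembly.
Variables (R : realType) (K : fieldType) (A : falgType K).
Implicit Types (U V : kbproj A) (W : tcplx A) (M X : rmod A) (theta : K0 R A).

Lemma Topen_quotient theta M X : Topen theta M -> is_quotient M X -> Topen theta X.
Proof.
move=> /TopenP TM MX; apply/TopenP=> Y XY; apply: TM.
exact: is_quotient_trans MX XY.
Qed.

Lemma Fopen_sub theta M X : Fopen theta M -> is_sub X M -> Fopen theta X.
Proof.
move=> /FopenP TM MX; apply/FopenP=> Y XY; apply: TM.
exact: is_sub_trans XY MX.
Qed.

Lemma coneDo_model U W theta : kb_iso U (kb_of W) ->
  coneDo U theta <-> Topen theta (cokerH W) /\ Fopen theta (kerN W).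
Proof.
move=> UW; have r1 := kb_iso_retract UW; have r2 := kb_iso_retract (kb_iso_sym UW).
split=> -[T F]; split.
- exact: Topen_quotient T (retract_cohom 0 r2).1.
- exact: Fopen_sub F (retract_cohom (-1) (retract_nuc r2)).2.
- exact: Topen_quotient T (retract_cohom 0 r1).1.
- exact: Fopen_sub F (retract_cohom (-1) (retract_nuc r1)).2.
Qed.

Lemma coneD_model U W theta : kb_iso U (kb_of W) ->
  coneD U theta <-> Tbar theta (cokerH W) /\ Fbar theta (kerN W).
Proof.
move=> UW; have r1 := kb_iso_retract UW; have r2 := kb_iso_retract (kb_iso_sym UW).
split=> -[T F]; split.
- exact: Tbar_quotient T (retract_cohom 0 r2).1.
- exact: Fbar_sub F (retract_cohom (-1) (retract_nuc r2)).2.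
- exact: Tbar_quotient T (retract_cohom 0 r1).1.
- exact: Fbar_sub F (retract_cohom (-1) (retract_nuc r1)).2.
Qed.

Lemma dsum_retract m U (Us : 'I_m -> kbproj A) i : kb_dsum U Us -> homotopy_retract (Us i) U.
Proof. by move=> [inj [prj [ic pc pi _ _]]]; exists (inj i), (prj i). Qed.

(** H^0(U) is a quotient and a sum of the H^0(U_i), H^-1(nu U) contains them and
    embeds into their product, up to the identification by the biproduct maps. *)
Lemma coneD_dsum m U (Us : 'I_m -> kbproj A) theta : kb_dsum U Us ->
  coneD U theta <-> forall i, coneD (Us i) theta.
Proof.
move=> Ud; split=> [[T F] i|Di].
  have r := dsum_retract i Ud; split.
    exact: Tbar_quotient T (retract_cohom 0 r).1.
  exact: Fbar_sub F (retract_cohom (-1) (retract_nuc r)).2.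
have [inj [prj [ic pc _ _ sumE]]] := Ud.
have chainS : chain_map (fun k => \sum_i compc (inj i) (prj i) k).
  have cc i := chain_comp (ic i) (pc i).
  split=> [k|k l]; first by apply: memv_suml => i _; case: (cc i) => + _; apply.
  apply/lfunP=> v; rewrite !comp_lfunE !sum_lfunE linear_sum; apply: eq_bigr => i _.
  by have [_ e] := cc i; rewrite /= -[LHS]comp_lfunE e comp_lfunE.
split.
  apply: (Tbar_span (f := fun i => cohom_map (inj i) 0)) => [i|i|Y q qh q0].
  - exact: cohom_map_homs.
  - by case: (Di i).
  rewrite -[q]comp_lfun1r -cohom_map_id -(cohom_map_homotopic 0 sumE) cohom_map_sum.
  apply/lfunP=> v; rewrite comp_lfunE sum_lfunE linear_sum zero_lfunE big1 // => i _.
  by rewrite /= cohom_map_comp // -[LHS]comp_lfunE comp_lfunA q0 comp_lfun0l zero_lfunE.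
apply: (Fbar_cospan (f := fun i => cohom_map (nucm (prj i)) (-1))) => [i|i|Y q qh q0].
- exact/cohom_map_homs/nucm_chain.
- by case: (Di i).
have nsum : homotopic (fun k => \sum_i compc (nucm (inj i)) (nucm (prj i)) k) (@idc _ _ (nuc U)).
  have h := nucm_homotopic chainS (chain_id U) sumE.
  apply: (homotopic_trans _ (homotopic_trans h _)); apply: homotopic_ext => k; last exact: nuf_id.
  rewrite /nucm nuf_sum => [|i]; last by case: (chain_comp (ic i) (pc i)) => + _; apply.
  apply: eq_bigr => i _; rewrite /compc nuf_comp //; [case: (pc i) | case: (ic i)] => + _; apply.
rewrite -[q]comp_lfun1l -cohom_map_id -(cohom_map_homotopic (-1) nsum) cohom_map_sum.
apply/lfunP=> v; rewrite comp_lfunE sum_lfunE zero_lfunE big1 // => i _.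
rewrite cohom_map_comp; [|exact: nucm_chain|exact: nucm_chain].
by rewrite comp_lfunE -[cohom_map (nucm (prj i)) _ _]comp_lfunE q0 zero_lfunE linear0.
Qed.

Lemma map_of_iso W W' (a : 'Hom(tlow W, tlow W')) (b : 'Hom(thigh W, thigh W')) : tcplx_map a b ->
  lker a = 0%VS -> lker b = 0%VS -> limg a = fullv -> limg b = fullv ->
  kb_iso (kb_of W) (kb_of W').
Proof.
move=> ab a0 b0 as_ bs.
have [a' [b' [ab' [a'a b'b] [aa' bb']]]] := tcplx_map_inv ab a0 b0 as_ bs.
exists (map_of a b), (map_of a' b'); split; try exact: map_of_chain.
  by apply: homotopic_ext => k; rewrite map_of_comp a'a b'b map_of_id.
by apply: homotopic_ext => k; rewrite map_of_comp aa' bb' map_of_id.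
Qed.

End Assembly.

Theorem theorem1p7 (R : realType) (K : fieldType) (A : falgType K)
    (U : kbproj A) (m : nat) (Us : 'I_m -> kbproj A)
    (U_two_term : two_term U) (U_presilting : presilting U)
    (U_dsum : kb_dsum U Us)
    (Us_indec : forall i, kb_indecomposable (Us i))
    (U_basic : forall i j, kb_iso (Us i) (Us j) -> i = j) :
  exists lam lam' : K0 R A -> K0 R A,
    [/\ lambda_maps U Us lam lam',
        forall mu mu' : K0 R A -> K0 R A, lambda_maps U Us mu mu' ->
          forall theta, coneD U theta ->
            mu theta = lam theta /\ mu' theta = lam' theta,
        set_bij (coneC Us `*` link U Us) (coneD U)
          (fun p : K0 R A * K0 R A => p.1 + p.2),
        forall theta, coneD U theta ->
          [/\ coneC Us (lam theta), link U Us (lam' theta)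
            & lam theta + lam' theta = theta]
      & forall eta eta', coneC Us eta -> link U Us eta' ->
          lam (eta + eta') = eta /\ lam' (eta + eta') = eta'].
Proof.
have [V UV V_two] := U_two_term.
have UsU i : homotopy_retract (Us i) U := dsum_retract i U_dsum.
(* U_i is a retract of U, hence of a complex in the degrees -1 and 0. *)
have exW i : exists W, is_model (Us i) W.
  apply: (@exists_model _ _ _ (tcplx_of V)); apply: retract_trans (UsU i) _.
  by apply: retract_trans (kb_iso_retract UV) _; apply: retract_tcplx_of.
pose W i := sval (cid (exW i)); have WP i : is_model (Us i) (W i) := svalP (cid (exW i)).
have WE i : kb_iso (Us i) (kb_of (W i)) := model_iso (WP i).
have WU i : homotopy_retract (cplx_of (W i)) U.
  exact: retract_trans (kb_iso_retract (kb_iso_sym (WE i))) (UsU i).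
pose c i := kb_class R (Us i).
have cE i X : euler X (c i) = (hdim (cokerH (W i)) X)%:R - (hdim X (kerN (W i)))%:R.
  rewrite /c (euler_kb_iso R X (WE i)) euler_kb_of.
  by have /(congr1 (fun n => n%:R : R)) := hdim_two_term (W i) X; rewrite !natrD; lra.
have HN0 i j : hdim (cokerH (W i)) (kerN (W j)) = 0%N.
  exact: presilting_hdim U_presilting (WU j) (WU i).
have nonzero i : ~ mzero (cokerH (W i)) \/ ~ mzero (kerN (W i)).
  by apply: (@model_nonzero _ _ (Us i)); [case: (Us_indec i) | case: (WP i)].
have dich i (a : 'End(tlow (W i))) (b : 'End(thigh (W i))) :=
  @model_dichotomy _ _ _ _ a b (Us_indec i) (WP i).
have W_nonzero i : ~ (mzero (tlow (W i)) /\ mzero (thigh (W i))).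
  move=> [z1 z0]; case: (Us_indec i) => + _; apply.
  apply: (kb_zero_retract (WP i).1); apply: null_homotopic_ext (@null_homotopic0 _ _ _ _).
  apply: (@gmap_cplx_ofE _ _ (W i) (cplx_of (W i)) (fun=> 0) (@idc _ _ _)).
    by rewrite [RHS](mzero_lfun _ z1).
  by rewrite [RHS](mzero_lfun _ z0).
have W_distinct i j (a : 'Hom(tlow (W i), tlow (W j))) (b : 'Hom(thigh (W i), thigh (W j))) :
    tcplx_map a b -> lker a = 0%VS -> lker b = 0%VS -> limg a = fullv -> limg b = fullv -> i = j.
  move=> ab a0 b0 as_ bs; apply: U_basic.
  exact: kb_iso_trans (WE i) (kb_iso_trans (map_of_iso ab a0 b0 as_ bs) (kb_iso_sym (WE j))).
have := core_decomposition cE HN0 nonzero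
  (@cokerH_radical _ _ _ W dich W_nonzero W_distinct)
  (@kerN_radical _ _ _ W dich W_nonzero W_distinct).
have <- : coneD U = wall_cone (fun i => cokerH (W i)) (fun i => kerN (W i)) :> set (K0 R A).
  apply/seteqP; split=> theta.
    by move=> /(coneD_dsum _ U_dsum) Di i; apply/(coneD_model _ (WE i)).
  by move=> Di; apply/(coneD_dsum _ U_dsum) => i; apply/(coneD_model _ (WE i)).
have <- : (fun i => coneDo (Us i) : set (K0 R A)) = open_cone (fun i => cokerH (W i)) (fun i =>
  kerN (W i)).
  apply/funext=> i; apply/seteqP; split=> theta.
    by move=> /(coneDo_model _ (WE i)).
  by move=> ?; apply/(coneDo_model _ (WE i)).
by [].
Qed.
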